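(* Let $A,B\subseteq\mathbb{R}^d$ be measurable sets with non-empty interiors such that $S_{A,B}$ is compact. Let $f:[0,1]\to\mathbb{C}$ satisfy $f(0)=0$ and be such that $|f(x)|$ is non-decreasing near $0$ (i.e. on $[0,\beta]$ for some $\beta>0$). If $f(S_{A,B})$ is trace class, then $f$ is trace class admissible for $L^2(\mathbb{R}^d)$.
   Context: The Fourier transform on $L^2(\mathbb{R}^d)$ is $\mathcal{F}f(\xi)=\int_{\mathbb{R}^d}e^{-2\pi i x\cdot\xi}f(x)\,dx$. For a measurable set $A\subset\mathbb{R}^d$, $P_A$ is multiplication by the indicator $1_A$ and $Q_A=\mathcal{F}^{-1}P_A\mathcal{F}$. For measurable $A,B\subset\mathbb{R}^d$, $S_{A,B}=P_AQ_BP_A$, a bounded non-negative self-adjoint operator on $L^2(\mathbb{R}^d)$ of norm at most $1$. For a compact self-adjoint operator $T$ with eigenvalues $1\ge\lambda_1\ge\lambda_2\ge\dots\ge0$ (counted with multiplicity) and corresponding orthonormal eigenvectors $v_1,v_2,\dots$, and $f:[0,1]\to\mathbb{C}$ with $f(0)=0$, define $f(T)v=\sum_{n}f(\lambda_n)\langle v,v_n\rangle v_n$; it is trace class when $\operatorname{Tr}f(T)=\sum_nf(\lambda_n)$ converges absolutely. For $f:[0,1]\to\mathbb{C}$ let $M_0f(t)=\sup_{0\le x\le t}|f(x)|$. The function $f$ is trace class admissible for $L^2(\mathbb{R}^d)$ if there is $\delta\in(0,1/e)$ such that $$\int_0^\delta\frac{M_0f(\varepsilon)\,\left(\log\frac1\varepsilon\right)^{d-1}}{\varepsilon\left(\log\log\frac1\varepsilon\right)^d}\,d\varepsilon<\infty.$$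 *)

(* Defs.v *)
From HB Require Import structures.
From mathcomp Require Import all_boot all_order all_algebra.
From mathcomp Require Import all_classical all_reals all_analysis.
From mathcomp Require Import complex.

Set Implicit Arguments.
Unset Strict Implicit.
Unset Printing Implicit Defensive.

Import Order.TTheory GRing.Theory Num.Theory.
Import numFieldNormedType.Exports.

Local Open Scope classical_set_scope.
Local Open Scope ring_scope.
Local Open Scope complex_scope.

(** * Lebesgue measure on R^d *)

Section lebesgue_measure_Rd.
Context {R : realType} {d : nat}.

Definition box (I : 'rV[R]_d * 'rV[R]_d) : set 'rV[R]_d :=
  [set x | forall i, I.1 ord0 i <= x ord0 i <= I.2 ord0 i].

Definition box_volume (I : 'rV[R]_d * 'rV[R]_d) : R :=
  \prod_(i < d) Num.max 0 (I.2 ord0 i - I.1 ord0 i).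

Lemma box_volume_ge0 I : 0 <= box_volume I.
Proof. by apply: prodr_ge0 => i _; rewrite le_max lexx. Qed.

(* The countable families of boxes are sets, possibly empty, so that the empty
   set has measure 0 also for d = 0. *)
Definition lebesgue_outer (X : set 'rV[R]_d) : \bar R :=
  ereal_inf [set (\esum_(I in C) (box_volume I)%:E)%E |
    C in [set C | countable C /\ X `<=` \bigcup_(I in C) box I]].

Let vol_ge0 I : (0 <= (box_volume I)%:E)%E.
Proof. by rewrite lee_fin box_volume_ge0. Qed.

Lemma lebesgue_outer_ge0 X : (0 <= lebesgue_outer X)%E.
Proof. by apply: le_ereal_inf_tmp => _ [C _ <-]; exact: esum_ge0. Qed.

Lemma lebesgue_outer0 : lebesgue_outer set0 = 0%E.
Proof.
apply/eqP; rewrite eq_le lebesgue_outer_ge0 andbT.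
by apply: ereal_inf_lbound; exists set0; rewrite ?esum_set0//=; split.
Qed.

Lemma lebesgue_outer_subadditive A F :
  subset_sigma_subadditive lebesgue_outer A F.
Proof.
move=> AF; have [[n Fn]|] := pselect (exists n, lebesgue_outer (F n) = +oo%E).
  rewrite (eseries_pinfty _ _ Fn) ?leey// => m _.
  by rewrite -ltNye (lt_le_trans _ (lebesgue_outer_ge0 _)).
rewrite -forallNE => Foo.
apply/lee_addgt0Pr => e e0.
rewrite (le_trans _ (epsilon_trick _ _ (ltW e0)))//; last first.
  by move=> n; exact: lebesgue_outer_ge0.
pose P n (C : set ('rV[R]_d * 'rV[R]_d)) :=
  [/\ countable C, F n `<=` \bigcup_(I in C) box I &
   (\esum_(I in C) (box_volume I)%:E
     <= lebesgue_outer (F n) + (e / (2 ^ n.+1)%:R)%:E)%E].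
have [C PC] : {C : nat -> set ('rV[R]_d * 'rV[R]_d) & forall n, P n (C n)}.
  apply: (@choice _ _ P) => n.
  have en : 0 < e / (2 ^ n.+1)%:R by rewrite divr_gt0// ltr0n expn_gt0.
  have Ffin : lebesgue_outer (F n) \is a fin_num.
    by rewrite ge0_fin_numE ?lebesgue_outer_ge0// ltey; apply/eqP; exact: Foo.
  have [_ [C [cC FC] <-] ltC] := lb_ereal_inf_adherent en Ffin.
  by exists C; split => //; exact: ltW.
have CU : \bigcup_n C n = \bigcup_n seqDU C n by rewrite -seqDU_bigcup_eq.
apply: (@le_trans _ _ (\esum_(I in \bigcup_n C n) (box_volume I)%:E)%E).
  apply: ereal_inf_lbound; exists (\bigcup_n C n) => //; split.
    by apply: bigcup_countable => // n _; have [] := PC n.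
  move=> x /AF[n _ Fnx]; have [_ + _] := PC n.
  by move=> /(_ _ Fnx)[I CnI xI]; exists I => //; exists n.
have tC : trivIset [set: nat] (seqDU C) by exact: trivIset_seqDU.
rewrite CU nneseries_sum_bigcup//.
apply: lee_nneseries => n _; first by move=> _; exact: esum_ge0.
have [_ _] := PC n; apply: le_trans.
rewrite [leRHS](esumID (seqDU C n))// setIidr; last exact: subset_seqDU.
by rewrite leeDl//; exact: esum_ge0.
Qed.

HB.instance Definition _ := isSubsetOuterMeasure.Build R 'rV[R]_d lebesgue_outer
  lebesgue_outer0 lebesgue_outer_ge0 lebesgue_outer_subadditive.

End lebesgue_measure_Rd.

Arguments lebesgue_outer R d : clear implicits.

(* R^d with the sigma-algebra of Lebesgue measurable sets. *)
Notation Rd R d := (caratheodory_type (lebesgue_outer R d)).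

Definition lebesgue_Rd (R : realType) (d : nat) : set (Rd R d) -> \bar R :=
  lebesgue_outer R d.
Arguments lebesgue_Rd R d : clear implicits.

HB.instance Definition _ (R : realType) (d : nat) :=
  isMeasure.Build _ (Rd R d) R (lebesgue_Rd R d)
    (@caratheodory_measure0 _ _ (lebesgue_outer R d))
    (@caratheodory_measure_ge0 _ _ (lebesgue_outer R d))
    (@caratheodory_measure_sigma_additive _ _ (lebesgue_outer R d)).

(** * The complex Hilbert space L^2(R^d)

   Elements of L^2(R^d) are represented by functions [Rd R d -> R[i]], up to
   almost everywhere equality, and operators on L^2(R^d) by functions acting on
   such representatives. *)

Section L2_space.
Context {R : realType} {d : nat}.
Implicit Types f g : Rd R d -> R[i].

Local Notation mu := (lebesgue_Rd R d).

Definition cmodulus (z : R[i]) : R :=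
  Num.sqrt (complex.Re z ^+ 2 + complex.Im z ^+ 2).

Definition cmeasurable f : Prop :=
  measurable_fun [set: Rd R d] (fun x => complex.Re (f x)) /\
  measurable_fun [set: Rd R d] (fun x => complex.Im (f x)).

Definition cintegral f : R[i] :=
  (\int[mu]_x complex.Re (f x)) +i* (\int[mu]_x complex.Im (f x)).

Definition in_L1 f : Prop :=
  cmeasurable f /\ (\int[mu]_x (cmodulus (f x))%:E < +oo)%E.

Definition sqL2norm f : \bar R := (\int[mu]_x (cmodulus (f x) ^+ 2)%:E)%E.

Definition in_L2 f : Prop := cmeasurable f /\ (sqL2norm f < +oo)%E.

Definition L2_inner f g : R[i] := cintegral (fun x => f x * conjc (g x)).

Definition L2_cvg (u : nat -> Rd R d -> R[i]) f : Prop :=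
  (fun n => sqL2norm (fun x => u n x - f x)) @ \oo --> 0%E.

End L2_space.

(** * The Fourier transform and the operators S_{A,B} *)

Section fourier.
Context {R : realType} {d : nat}.
Implicit Types (f g : Rd R d -> R[i]) (A B : set 'rV[R]_d).

Definition dot (x y : 'rV[R]_d) : R := \sum_(i < d) x ord0 i * y ord0 i.

(* [expNi t] is exp (- i t). *)
Definition expNi (t : R) : R[i] := cos t -i* sin t.

Definition fourier_integral f : Rd R d -> R[i] :=
  fun xi => cintegral (fun x => expNi (2 * pi * dot x xi) * f x).

(* The graph of the Fourier transform of L^2: the closure in L^2 x L^2 of the
   graph of the integral formula, which makes sense on the intersection of L^1
   and L^2 only. *)
Definition fourier_graph f g : Prop :=
  [/\ in_L2 f, in_L2 g &
      exists u : nat -> Rd R d -> R[i],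
        [/\ forall n, in_L1 (u n) /\ in_L2 (u n), L2_cvg u f &
            L2_cvg (fun n => fourier_integral (u n)) g] ].

(* By Plancherel's theorem, each f in L^2 has an image and a preimage under the
   Fourier transform, unique up to almost everywhere equality; the junk value of
   [xget] is used only outside of L^2. *)
Definition fourier f : Rd R d -> R[i] :=
  xget (fun=> 0) [set g | fourier_graph f g].

Definition inverse_fourier g : Rd R d -> R[i] :=
  xget (fun=> 0) [set f | fourier_graph f g].

Definition P_op A f : Rd R d -> R[i] := fun x => \1_A x * f x.

Definition Q_op B f : Rd R d -> R[i] := inverse_fourier (P_op B (fourier f)).

Definition S_op A B f : Rd R d -> R[i] := P_op A (Q_op B (P_op A f)).

End fourier.

(** * Compact operators, their eigenvalues, and trace class functions of them *)

Section operators.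
Context {R : realType} {d : nat}.
Implicit Type T : (Rd R d -> R[i]) -> Rd R d -> R[i].

Local Notation mu := (lebesgue_Rd R d).

Definition compact_operator T : Prop :=
  forall u : nat -> Rd R d -> R[i],
    (forall n, in_L2 (u n)) ->
    (exists M : R, forall n, (sqL2norm (u n) <= M%:E)%E) ->
    exists phi : nat -> nat, exists g : Rd R d -> R[i],
      [/\ {homo phi : m n / (m < n)%N}, in_L2 g &
          L2_cvg (fun n => T (u (phi n))) g].

Definition in_eigenspace T (lambda : R) (v : Rd R d -> R[i]) : Prop :=
  in_L2 v /\ {ae mu, forall x, T v x = lambda%:C * v x}.

Definition orthonormal (v : nat -> Rd R d -> R[i]) : Prop :=
  forall m n, L2_inner (v m) (v n) = (m == n)%:R.

(* [lambda] lists the eigenvalues of T in non-increasing order and [v] the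
   corresponding eigenvectors. The last clause says that each nonzero eigenvalue
   is listed with its full multiplicity. The kernel of T need not be exhausted
   by [v]: it does not contribute to f(T) since f 0 = 0. If T has finite rank,
   [lambda] is eventually 0. *)
Definition eigensystem T (lambda : nat -> R) (v : nat -> Rd R d -> R[i]) :
    Prop :=
  [/\ forall n, 0 <= lambda n <= 1,
      forall m n, (m <= n)%N -> lambda n <= lambda m,
      orthonormal v,
      forall n, in_eigenspace T (lambda n) (v n) &
      forall (nu : R) (w : Rd R d -> R[i]), nu != 0 -> in_eigenspace T nu w ->
        (forall n, lambda n = nu -> L2_inner w (v n) = 0) ->
        {ae mu, forall x, w x = 0} ].

(* f(T) is trace class: the series Tr f(T) = \sum_n f (lambda n) converges
   absolutely. This does not depend on the eigensystem. *)
Definition trace_class_fun (f : R -> R[i]) T : Prop :=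
  exists (lambda : nat -> R) (v : nat -> Rd R d -> R[i]),
    eigensystem T lambda v /\
    (\sum_(0 <= n <oo) (cmodulus (f (lambda n)))%:E < +oo)%E.

End operators.

(** * Trace class admissible functions

   Functions on [0, 1] are represented by functions on R of which only the
   values on [0, 1] are used. *)

Section admissible.
Context {R : realType}.
Implicit Type f : R -> R[i].

Definition M0 f (t : R) : \bar R :=
  ereal_sup [set (cmodulus (f x))%:E | x in `[0, t]].

Definition trace_class_admissible (d : nat) f : Prop :=
  exists delta : R, 0 < delta < expR (-1) /\
    (\int[lebesgue_measure]_(e in `]0%R, delta[)
       (M0 f e * (ln e^-1 ^+ d.-1 / (e * ln (ln e^-1) ^+ d))%:E) < +oo)%E.

End admissible.

(* Main.v *)
(** The restriction of the concentration operator S = P_A Q_B P_A to functions h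
    supported in A has the quadratic form <S h, h> = |1_B F h|^2, where F is the
    Fourier transform, so that by the min-max principle every N-dimensional space
    of test functions on which |1_B F h|^2 >= eps |h|^2 yields N eigenvalues at
    least eps.  The test functions are the translates h_j(x) = psi(x - x0 - t j),
    j in {0, ..., n-1}^d, of a narrow bump psi, with t of order 1/n.  Their
    transforms are F psi times trigonometric polynomials in xi; sampled on a grid of
    step 1/n inside B, the coefficients of such a polynomial are recovered by
    inverting a tensor power of a Vandermonde matrix whose nodes are 1/n^2
    separated, at the cost of a factor (C n^2)^(d n).  Hence
    lambda_k >= e_n := exp(- C n log n) for all k < n^d.
    On (e_(n+1), e_n] the weight of the admissibility integral has mass
    O(n^(d-1)), and at least n^(d-1) of the eigenvalues lambda_k with
    (n-1)^d <= k < n^d satisfy |f(lambda_k)| >= |f(e_n)| = M_0 f(e_n), so the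
    integral is bounded by the trace norm of f(S).

    That F is unitary is proved on Lipschitz functions of compact support: the
    transforms of their step approximations on the grid of mesh 1/n are
    trigonometric polynomials, to which Parseval's identity applies on a period
    cube, and no mass escapes to infinity because the difference quotients of a
    Lipschitz function are bounded. *)

Require Import Defs.
From HB Require Import structures.
From mathcomp Require Import finmap.
From mathcomp Require Import all_boot all_order all_algebra.
From mathcomp Require Import all_classical all_reals all_analysis.
From mathcomp Require Import measurable_realfun.
From mathcomp Require Import complex.
From mathcomp Require Import ring lra.
Import Order.TTheory GRing.Theory Num.Theory.
Import numFieldNormedType.Exports.
Local Open Scope classical_set_scope.
Local Open Scope ring_scope.

Set Implicit Arguments.
Unset Strict Implicit.
Unset Printing Implicit Defensive.

(** * Complex modulus and complex-valued integration *)

(** Elements of $L^2$ are functions, not classes, and [fourier] and [inverse_fourier] choose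
    arbitrary representatives, so [S_op] is linear and symmetric only up to null functions. The
    variational argument is therefore run for a semi-inner product and sees the operator only
    through the form $\langle Su, w\rangle$. No spectral theorem is used: any given eigensystem will
    do, as long as nonzero eigenvalues are listed with full multiplicity.

    The Fourier transform is given by a closed graph, so nothing can be computed with $S_{A,B}$
    before Plancherel's theorem is available. Surjectivity comes from the multiplication formula
    $\int (Ff) h = \int f\,(Fh)$ instead of an inversion formula.

    The crude loss $(Cn^2)^{dn}$ is affordable because only the order $n\log n$ of its logarithm
    matters. On the shell between $e_{n+1}$ and $e_n$ the weight contributes $(n\log n)^{d-1}$ from
    its numerator, $(\log n)^{-d}$ from its denominator and $\log(e_n/e_{n+1})$, of order $\log n$,
    from $d\varepsilon/\varepsilon$; the logarithms cancel and leave $n^{d-1}$, the order of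
    $n^d-(n-1)^d$. *)

Section sequence_limits.
Variable R : realType.
Implicit Types u v : nat -> R.

Lemma cvg_lbound u (l c : R) : u @ \oo --> l -> (forall n, c <= u n) -> c <= l.
Proof.
by move=> ul cu; apply: (@closed_cvg _ _ \oo _ u [set x | c <= x] (@closed_ge R c) _ _ ul); apply: nearW.
Qed.

Lemma cvg_ubound u (l c : R) : u @ \oo --> l -> (forall n, u n <= c) -> l <= c.
Proof.
by move=> ul cu; apply: (@closed_cvg _ _ \oo _ u [set x | x <= c] (@closed_le R c) _ _ ul); apply: nearW.
Qed.

Lemma squeeze_cvg0 u v : (forall n, 0 <= u n) -> (forall n, u n <= v n) ->
  v @ \oo --> (0 : R) -> u @ \oo --> (0 : R).
Proof.
move=> u0 uv; apply: (@squeeze_cvgr _ _ _ _ (fun=> 0)); last exact: cvg_cst.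
by apply: nearW => n; rewrite u0 uv.
Qed.

End sequence_limits.

Section complex_modulus.
Variable R : realType.
Implicit Types z w : R[i].

Lemma complex_ext z w :
  complex.Re z = complex.Re w -> complex.Im z = complex.Im w -> z = w.
Proof. by case: z w => [a b] [c d] /= -> ->. Qed.

Lemma ReD z w : complex.Re (z + w) = complex.Re z + complex.Re w.
Proof. by case: z w => [a b] [c d]. Qed.
Lemma ImD z w : complex.Im (z + w) = complex.Im z + complex.Im w.
Proof. by case: z w => [a b] [c d]. Qed.
Lemma ReN z : complex.Re (- z) = - complex.Re z.
Proof. by case: z. Qed.
Lemma ImN z : complex.Im (- z) = - complex.Im z.
Proof. by case: z. Qed.
Lemma ReM z w : complex.Re (z * w) =
  complex.Re z * complex.Re w - complex.Im z * complex.Im w.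
Proof. by case: z w => [a b] [c d]. Qed.
Lemma ImM z w : complex.Im (z * w) =
  complex.Re z * complex.Im w + complex.Im z * complex.Re w.
Proof. by case: z w => [a b] [c d] /=; rewrite addrC mulrC addrC mulrC. Qed.
Lemma ReJ z : complex.Re (conjc z) = complex.Re z.
Proof. by case: z. Qed.
Lemma ImJ z : complex.Im (conjc z) = - complex.Im z.
Proof. by case: z. Qed.
Lemma ReR (x : R) : complex.Re (x%:C)%C = x. Proof. by []. Qed.
Lemma ImR (x : R) : complex.Im (x%:C)%C = 0. Proof. by []. Qed.

Definition ReIm := (ReD, ImD, ReN, ImN, ReM, ImM, ReJ, ImJ, ReR, ImR).

Lemma Re_sum (I : Type) (s : seq I) (P : pred I) (F : I -> R[i]) :
  complex.Re (\sum_(i <- s | P i) F i) = \sum_(i <- s | P i) complex.Re (F i).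
Proof. by apply: (big_morph (@complex.Re R)) => // x y; rewrite ReD. Qed.
Lemma cmodulusE z : cmodulus z = ComplexField.Normc.normc z.
Proof. by case: z. Qed.

Lemma sqr_cmodulus z :
  cmodulus z ^+ 2 = complex.Re z ^+ 2 + complex.Im z ^+ 2.
Proof. by rewrite sqr_sqrtr// addr_ge0// sqr_ge0. Qed.

Lemma cmodulus_ge0 z : 0 <= cmodulus z. Proof. exact: sqrtr_ge0. Qed.

Lemma cmodulusM z w : cmodulus (z * w) = cmodulus z * cmodulus w.
Proof. by rewrite !cmodulusE ComplexField.Normc.normcM. Qed.

Lemma cmodulusD z w : cmodulus (z + w) <= cmodulus z + cmodulus w.
Proof. by rewrite !cmodulusE le_normcD. Qed.

Lemma cmodulusN z : cmodulus (- z) = cmodulus z.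
Proof. by rewrite /cmodulus !ReIm !sqrrN. Qed.

Lemma cmodulusJ z : cmodulus (conjc z) = cmodulus z.
Proof. by rewrite /cmodulus !ReIm !sqrrN. Qed.

Lemma cmodulus0 : cmodulus (0 : R[i]) = 0.
Proof. by rewrite /cmodulus/= !expr0n/= addr0 sqrtr0. Qed.

Lemma cmodulus1 : cmodulus (1 : R[i]) = 1.
Proof. by rewrite /cmodulus/= expr1n !expr0n/= addr0 sqrtr1. Qed.

Lemma cmodulusR (x : R) : cmodulus (x%:C)%C = `|x|.
Proof. by rewrite /cmodulus/= expr0n/= addr0 sqrtr_sqr. Qed.

Lemma cmodulus_eq0 z : (cmodulus z == 0) = (z == 0).
Proof.
apply/eqP/eqP => [|->]; last exact: cmodulus0.
by rewrite cmodulusE; exact: ComplexField.Normc.eq0_normc.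
Qed.

Lemma cmodulusV z : cmodulus z^-1 = (cmodulus z)^-1.
Proof. by rewrite !cmodulusE ComplexField.Normc.normcV. Qed.

Lemma cmodulus_sum (I : Type) (s : seq I) (P : pred I) (F : I -> R[i]) :
  cmodulus (\sum_(i <- s | P i) F i) <= \sum_(i <- s | P i) cmodulus (F i).
Proof.
elim/big_rec2 : _ => [|i a b _ ih]; first by rewrite cmodulus0.
by rewrite (le_trans (cmodulusD _ _))// lerD2l.
Qed.

Lemma cmodulus_prod (I : Type) (s : seq I) (P : pred I) (F : I -> R[i]) :
  cmodulus (\prod_(i <- s | P i) F i) = \prod_(i <- s | P i) cmodulus (F i).
Proof. by apply: (big_morph _ cmodulusM cmodulus1). Qed.

Lemma cmodulusB z w : cmodulus (z - w) = cmodulus (w - z).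
Proof. by rewrite -cmodulusN opprB. Qed.

Lemma ler_cmodulusB z w : cmodulus z - cmodulus w <= cmodulus (z - w).
Proof. by rewrite lerBlDr (le_trans _ (cmodulusD _ _))// subrK. Qed.

Lemma Re_le_cmodulus z : `|complex.Re z| <= cmodulus z.
Proof. by rewrite -sqrtr_sqr ler_wsqrtr// lerDl sqr_ge0. Qed.

Lemma Im_le_cmodulus z : `|complex.Im z| <= cmodulus z.
Proof. by rewrite -sqrtr_sqr ler_wsqrtr// lerDr sqr_ge0. Qed.

Lemma cmodulus_le_ReIm z : cmodulus z <= `|complex.Re z| + `|complex.Im z|.
Proof.
rewrite -(@ler_pXn2r _ 2)// ?nnegrE ?cmodulus_ge0 ?addr_ge0//.
rewrite sqr_cmodulus sqrrD !real_normK ?num_real// -addrA (addrC (_ *+ 2)) addrA.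
by rewrite lerDl mulrn_wge0// mulr_ge0.
Qed.

Lemma conjcM z w : conjc (z * w) = conjc z * conjc w.
Proof. by apply: complex_ext; rewrite !ReIm; ring. Qed.

Lemma conjcD z w : conjc (z + w) = conjc z + conjc w.
Proof. by apply: complex_ext; rewrite !ReIm; ring. Qed.

Lemma mulcJ z : z * conjc z = ((cmodulus z ^+ 2)%:C)%C.
Proof.
by apply: complex_ext; rewrite !ReIm ?sqr_cmodulus; ring.
Qed.

Lemma sqr_cmodulusD_le z w :
  cmodulus (z + w) ^+ 2 <= 2 * cmodulus z ^+ 2 + 2 * cmodulus w ^+ 2.
Proof.
rewrite !sqr_cmodulus !ReIm.
rewrite -subr_ge0.
rewrite (_ : _ - _ = (complex.Re z - complex.Re w) ^+ 2 +
                     (complex.Im z - complex.Im w) ^+ 2); last by ring.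
by rewrite addr_ge0// sqr_ge0.
Qed.

Lemma cmodulusM_le z w :
  cmodulus (z * w) <= cmodulus z ^+ 2 + cmodulus w ^+ 2.
Proof.
rewrite cmodulusM.
have := cmodulus_ge0 z; have := cmodulus_ge0 w; nra.
Qed.

End complex_modulus.

Section complex_integral.
Context {dT : measure_display} {T : measurableType dT} {R : realType}.
Implicit Types f g : T -> R[i].

(* [cmeas], [cint], [cL1] and, below, [sqL2], [cL2], [L2ip] are convertible to the
   constants of Defs at [mu := lebesgue_Rd R d]. *)
Definition cmeas f : Prop :=
  measurable_fun [set: T] (fun x => complex.Re (f x)) /\
  measurable_fun [set: T] (fun x => complex.Im (f x)).

Variable mu : {measure set T -> \bar R}.

Definition cint f : R[i] := Complex
  (\int[mu]_x complex.Re (f x)) (\int[mu]_x complex.Im (f x)).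

Definition cL1 f : Prop :=
  cmeas f /\ (\int[mu]_x (cmodulus (f x))%:E < +oo)%E.

Definition integrableR (g : T -> R) := mu.-integrable setT (EFin \o g).

Lemma cmeas_cst (c : R[i]) : cmeas (fun _ : T => c).
Proof. by split; exact: measurable_cst. Qed.

Lemma cmeasD f g : cmeas f -> cmeas g ->
  cmeas (fun x => f x + g x).
Proof.
move=> [f1 f2] [g1 g2]; split.
  by under eq_fun do rewrite ReD; exact: measurable_funD.
by under eq_fun do rewrite ImD; exact: measurable_funD.
Qed.

Lemma cmeasM f g : cmeas f -> cmeas g ->
  cmeas (fun x => f x * g x).
Proof.
move=> [f1 f2] [g1 g2]; split.
  by under eq_fun do rewrite ReM; apply: measurable_funB; exact: measurable_funM.
by under eq_fun do rewrite ImM; apply: measurable_funD; exact: measurable_funM.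
Qed.

Lemma cmeasZ (c : R[i]) f : cmeas f -> cmeas (fun x => c * f x).
Proof. by move=> mf; apply: cmeasM => //; exact: cmeas_cst. Qed.

Lemma cmeasN f : cmeas f -> cmeas (fun x => - f x).
Proof. by under [X in _ -> cmeas X]eq_fun do rewrite -mulN1r; exact: cmeasZ. Qed.

Lemma cmeasB f g : cmeas f -> cmeas g ->
  cmeas (fun x => f x - g x).
Proof. by move=> mf mg; exact: (cmeasD mf (cmeasN mg)). Qed.

Lemma cmeasJ f : cmeas f -> cmeas (fun x => conjc (f x)).
Proof.
move=> [f1 f2]; split; first by under eq_fun do rewrite ReJ.
by under eq_fun do rewrite ImJ; exact: measurableT_comp.
Qed.

Lemma cmeasR (g : T -> R) :
  measurable_fun setT g -> cmeas (fun x => (g x)%:C)%C.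
Proof. by move=> mg; split => //=; exact: measurable_cst. Qed.

Lemma cmeas_sum (I : Type) (s : seq I) (F : I -> T -> R[i]) :
  (forall i, cmeas (F i)) -> cmeas (fun x => \sum_(i <- s) F i x).
Proof.
move=> mF; elim: s => [|i s ih].
  by under eq_fun do rewrite big_nil; exact: cmeas_cst.
by under eq_fun do rewrite big_cons; exact: cmeasD.
Qed.

Lemma measurable_sqr_cmodulus f : cmeas f ->
  measurable_fun setT (fun x => cmodulus (f x) ^+ 2).
Proof.
move=> [f1 f2]; under eq_fun do rewrite sqr_cmodulus.
by apply: measurable_funD; exact: measurable_funX.
Qed.

Lemma measurable_cmodulus f : cmeas f ->
  measurable_fun setT (fun x => cmodulus (f x)).
Proof.
move=> mf; rewrite (_ : (fun x => _) =
   (@Num.sqrt R) \o (fun x => cmodulus (f x) ^+ 2)); last first.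
  by apply/funext => x /=; rewrite sqrtr_sqr ger0_norm// cmodulus_ge0.
apply: measurableT_comp; last exact: measurable_sqr_cmodulus.
by apply: continuous_measurable_fun; exact: sqrt_continuous.
Qed.

Lemma cL1_cmodulus f : cL1 f -> integrableR (fun x => cmodulus (f x)).
Proof.
move=> [mf foo]; apply/integrableP; split.
  by apply/measurable_EFinP; exact: measurable_cmodulus.
by under eq_integral do rewrite gee0_abs ?lee_fin ?cmodulus_ge0//.
Qed.

Lemma cL1_le f (g : T -> R) : cmeas f -> integrableR g ->
  (forall x, cmodulus (f x) <= g x) -> cL1 f.
Proof.
move=> mf /integrableP[mg goo] fg; split => //.
apply: le_lt_trans goo; apply: ge0_le_integral => //.
- by move=> x _; rewrite lee_fin cmodulus_ge0.
- by apply/measurable_EFinP; exact: measurable_cmodulus.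
- exact: measurableT_comp.
- by move=> x _ /=; rewrite lee_fin (le_trans (fg x))// ler_norm.
Qed.

Lemma cL1P f : cL1 f <->
  integrableR (fun x => complex.Re (f x)) /\ integrableR (fun x => complex.Im (f x)).
Proof.
split=> [/[dup] [[[m1 m2] _]] /cL1_cmodulus fi|[i1 i2]].
  split; apply: (le_integrable measurableT _ _ fi); [|move=> x _| |move=> x _] => /=.
  - exact/measurable_EFinP.
  - by rewrite lee_fin (ger0_norm (cmodulus_ge0 _)) Re_le_cmodulus.
  - exact/measurable_EFinP.
  - by rewrite lee_fin (ger0_norm (cmodulus_ge0 _)) Im_le_cmodulus.
apply: (@cL1_le _ (fun x => `|complex.Re (f x)| + `|complex.Im (f x)|)).
- by split; apply/measurable_EFinP; apply: measurable_int; eassumption.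
- rewrite /integrableR; have := integrableD measurableT (integrable_norm i1) (integrable_norm i2).
  by apply: eq_integrable.
- by move=> x; exact: cmodulus_le_ReIm.
Qed.

Lemma cL1D f g : cL1 f -> cL1 g -> cL1 (fun x => f x + g x).
Proof.
move=> /cL1P[f1 f2] /cL1P[g1 g2]; apply/cL1P; split.
  by under eq_fun do rewrite ReD; exact: (integrableD measurableT f1 g1).
by under eq_fun do rewrite ImD; exact: (integrableD measurableT f2 g2).
Qed.

Lemma cL1_bounded f (g : T -> R[i]) (K : R) : cmeas g -> cL1 f ->
  (forall x, cmodulus (g x) <= K) -> cL1 (fun x => g x * f x).
Proof.
move=> mg L1f gK; apply: (@cL1_le _ (fun x => K * cmodulus (f x))).
- by apply: cmeasM => //; case: L1f.
- exact: (integrableZl measurableT K (cL1_cmodulus L1f)).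
- by move=> x; rewrite cmodulusM ler_wpM2r// cmodulus_ge0.
Qed.

Lemma cL1Z (c : R[i]) f : cL1 f -> cL1 (fun x => c * f x).
Proof.
by move=> L1f; apply: (@cL1_bounded _ _ (cmodulus c)) => //; exact: cmeas_cst.
Qed.

Lemma cL1N f : cL1 f -> cL1 (fun x => - f x).
Proof. by under [X in _ -> cL1 X]eq_fun do rewrite -mulN1r; exact: cL1Z. Qed.

Lemma cL1_0 : cL1 (fun _ : T => (0 : R[i])).
Proof.
split; first exact: cmeas_cst.
by under eq_integral do rewrite cmodulus0; rewrite integral0 ltry.
Qed.

Lemma cL1_sum (I : Type) (s : seq I) (F : I -> T -> R[i]) :
  (forall i, cL1 (F i)) -> cL1 (fun x => \sum_(i <- s) F i x).
Proof.
move=> mF; elim: s => [|i s ih].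
  by under eq_fun do rewrite big_nil; exact: cL1_0.
by under eq_fun do rewrite big_cons; exact: cL1D.
Qed.

Lemma cintD f g : cL1 f -> cL1 g ->
  cint (fun x => f x + g x) = cint f + cint g.
Proof.
move=> /cL1P[f1 f2] /cL1P[g1 g2]; apply: complex_ext; rewrite !ReIm /=.
  by under [LHS]eq_Rintegral do rewrite ReD; rewrite RintegralD.
by under eq_Rintegral do rewrite ImD; rewrite RintegralD.
Qed.

Lemma cintZ (c : R[i]) f : cL1 f ->
  cint (fun x => c * f x) = c * cint f.
Proof.
move=> /cL1P[f1 f2].
apply: complex_ext; rewrite ?ReM ?ImM /=.
  under eq_Rintegral do rewrite ReM.
  rewrite RintegralB// ?RintegralZl//.
  - exact: (integrableZl measurableT _ f1).
  - exact: (integrableZl measurableT _ f2).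
under eq_Rintegral do rewrite ImM.
rewrite RintegralD// ?RintegralZl//.
- exact: (integrableZl measurableT _ f2).
- exact: (integrableZl measurableT _ f1).
Qed.

Lemma cintN f : cL1 f -> cint (fun x => - f x) = - cint f.
Proof.
move=> L1f; rewrite -mulN1r -cintZ//.
by congr cint; apply/funext => x; rewrite mulN1r.
Qed.

Lemma cintB f g : cL1 f -> cL1 g ->
  cint (fun x => f x - g x) = cint f - cint g.
Proof. by move=> f1 g1; rewrite cintD ?cintN//; exact: cL1N. Qed.

Lemma cint0 : cint (fun _ : T => (0 : R[i])) = 0.
Proof. by rewrite /cint /= Rintegral_cst// mul0r. Qed.

Lemma cint_sum (I : Type) (s : seq I) (F : I -> T -> R[i]) :
  (forall i, cL1 (F i)) ->
  cint (fun x => \sum_(i <- s) F i x) = \sum_(i <- s) cint (F i).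
Proof.
move=> mF; elim: s => [|i s ih].
  by under eq_fun do rewrite big_nil; rewrite big_nil cint0.
under eq_fun do rewrite big_cons; rewrite big_cons cintD ?ih//.
exact: cL1_sum.
Qed.

Lemma cintJ f : cL1 f ->
  cint (fun x => conjc (f x)) = conjc (cint f).
Proof.
move=> /cL1P[f1 f2]; apply: complex_ext; rewrite !ReIm /=.
  by apply: eq_Rintegral => x _; rewrite ReJ.
under eq_Rintegral do rewrite ImJ -mulN1r.
by rewrite RintegralZl// mulN1r.
Qed.

(** Multiplying by [conjc I] rotates the integral onto the real axis: $|I|^2$ is the real part of
    $\int \bar I f$, hence at most $|I|\int|f|$. *)
Lemma cmodulus_cint f : cL1 f ->
  cmodulus (cint f) <= \int[mu]_x cmodulus (f x).
Proof.
move=> L1f; set I := cint f.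
have [->|I0] := eqVneq (cmodulus I) 0.
  by apply: Rintegral_ge0 => x _; exact: cmodulus_ge0.
have I1 : cmodulus I ^+ 2 <= cmodulus I * \int[mu]_x cmodulus (f x).
  have -> : cmodulus I ^+ 2 = complex.Re (cint (fun x => conjc I * f x)).
    by rewrite cintZ// mulrC mulcJ.
  rewrite /= -RintegralZl//; last exact: cL1_cmodulus.
  apply: le_Rintegral => //.
  - by have /cL1P[] := cL1Z (conjc I) L1f.
  - exact: (integrableZl measurableT _ (cL1_cmodulus L1f)).
  - move=> x _; rewrite (le_trans (ler_norm _))// (le_trans (Re_le_cmodulus _))//.
    change (cmodulus (conjc I * f x) <= cmodulus I * cmodulus (f x)).
    by rewrite cmodulusM cmodulusJ.
have I_gt0 : 0 < cmodulus I by rewrite lt_def I0 cmodulus_ge0.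
by rewrite -(ler_pM2l I_gt0) -expr2.
Qed.

(** Complex limits are expressed by real sequences of moduli tending to 0. The limit [f] inherits
    the bound [g], so the real dominated convergence theorem applies to $|f_n-f|\le 2g$. *)
Lemma cint_dominated_cvg (f_ : nat -> T -> R[i]) f (g : T -> R) :
  (forall n, cmeas (f_ n)) -> cmeas f ->
  (forall x, (fun n => cmodulus (f_ n x - f x)) @ \oo --> 0) ->
  integrableR g -> (forall n x, cmodulus (f_ n x) <= g x) ->
  (fun n => cmodulus (cint (f_ n) - cint f)) @ \oo --> 0.
Proof.
move=> mf_ mf ff ig fg.
have fgl x : cmodulus (f x) <= g x.
  have h n : cmodulus (f x) <= g x + cmodulus (f_ n x - f x).
    rewrite (le_trans _ (lerD (fg n x) (lexx _)))// cmodulusB.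
    by rewrite (le_trans _ (cmodulusD _ _))// subrKC.
  have : (fun n => g x + cmodulus (f_ n x - f x)) @ \oo --> g x + 0.
    by apply: cvgD => //; exact: cvg_cst.
  by rewrite addr0 => /cvg_lbound; apply.
have L1f : cL1 f by exact: (cL1_le mf ig).
have L1f_ n : cL1 (f_ n) by exact: (cL1_le (mf_ n) ig).
have mB n : cmeas (fun x => f_ n x - f x) by exact: cmeasB.
have [] := @dominated_convergence _ _ _ mu setT measurableT
  (fun n x => (cmodulus (f_ n x - f x))%:E) (cst 0%E) (fun x => (2 * g x)%:E).
- by move=> n; apply/measurable_EFinP; exact: measurable_cmodulus.
- exact: measurable_cst.
- by apply: aeW => x _; apply: cvg_EFin; [exact: nearW|exact: ff].
- exact: (integrableZl measurableT 2 ig).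
- apply: aeW => x n _ /=; rewrite lee_fin ger0_norm ?cmodulus_ge0//.
  by rewrite (le_trans (cmodulusD _ _))// cmodulusN mulr_natl mulr2n lerD.
move=> _ _; rewrite integral0 => /fine_cvgP[_].
apply: (@squeeze_cvgr _ _ _ _ (fun=> 0)); last exact: cvg_cst.
apply: nearW => n; rewrite cmodulus_ge0/= -cintB//.
exact: (cmodulus_cint (cL1D (L1f_ n) (cL1N L1f))).
Qed.

End complex_integral.

(** * The variational principle in semi-inner product spaces *)

Section semi_hilbert.
Context {R : realType} {V : lmodType R[i]}.
Implicit Types (H : set V) (ip : V -> V -> R[i]).

(** The domain [H] is a subset of an ambient space of functions, and the form may vanish on nonzero
    vectors because functions are not identified almost everywhere. Both the $L^2$ product and
    $\langle Su, w\rangle$ are instances, so Cauchy-Schwarz is available for each. *)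
Record semi_ip H ip : Prop := SemiIp {
  sipHD : forall u v, H u -> H v -> H (u + v);
  sipHZ : forall a u, H u -> H (a *: u);
  sipD : forall u v w, H u -> H v -> H w -> ip (u + v) w = ip u w + ip v w;
  sipZ : forall a u w, H u -> H w -> ip (a *: u) w = a * ip u w;
  sipJ : forall u v, H u -> H v -> ip v u = conjc (ip u v);
  sip_ge0 : forall u, H u -> 0 <= complex.Re (ip u u) }.

Variables (H : set V) (ip : V -> V -> R[i]).
Hypothesis sip : semi_ip H ip.
Let HD := sipHD sip.
Let HZ := sipHZ sip.
Let ipD := sipD sip.
Let ipZ := sipZ sip.
Let ipJ := sipJ sip.
Let ip_ge0 := sip_ge0 sip.

Definition sqn u := complex.Re (ip u u).
Local Notation q := sqn.

Lemma sipHN u : H u -> H (- u).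
Proof. by move=> Hu; rewrite -scaleN1r; exact: HZ. Qed.

Lemma sipHB u v : H u -> H v -> H (u - v).
Proof. by move=> Hu Hv; exact: (HD Hu (sipHN Hv)). Qed.

Lemma sipN u v : H u -> H v -> ip (- u) v = - ip u v.
Proof. by move=> Hu Hv; rewrite -scaleN1r ipZ// mulN1r. Qed.

Lemma sipB u v w : H u -> H v -> H w -> ip (u - v) w = ip u w - ip v w.
Proof. by move=> Hu Hv Hw; rewrite ipD ?sipN//; exact: sipHN. Qed.

Lemma sipDr u v w : H u -> H v -> H w -> ip u (v + w) = ip u v + ip u w.
Proof.
by move=> Hu Hv Hw; rewrite (ipJ (HD Hv Hw) Hu) ipD// rmorphD/= -!ipJ.
Qed.

Lemma sipZr a u v : H u -> H v -> ip u (a *: v) = conjc a * ip u v.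
Proof. by move=> Hu Hv; rewrite (ipJ (HZ a Hv) Hu) ipZ// rmorphM/= -ipJ. Qed.

Lemma sipNr u v : H u -> H v -> ip u (- v) = - ip u v.
Proof. by move=> Hu Hv; rewrite (ipJ (sipHN Hv) Hu) sipN// rmorphN/= -ipJ. Qed.

Lemma sipBr u v w : H u -> H v -> H w -> ip u (v - w) = ip u v - ip u w.
Proof. by move=> Hu Hv Hw; rewrite sipDr ?sipNr//; exact: sipHN. Qed.

Lemma sipH_sum (I : finType) (c : I -> R[i]) (h : I -> V) : H 0 ->
  (forall i, H (h i)) -> H (\sum_i c i *: h i).
Proof.
by move=> H0 Hh; apply: (big_ind H H0 HD) => i _; exact: HZ.
Qed.

Lemma sip_suml (I : finType) (c : I -> R[i]) (h : I -> V) v : H 0 ->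
  (forall i, H (h i)) -> H v ->
  ip (\sum_i c i *: h i) v = \sum_i c i * ip (h i) v.
Proof.
move=> H0 Hh Hv.
pose P u z := H u /\ ip u v = z.
suff [] : P (\sum_i c i *: h i) (\sum_i c i * ip (h i) v) by [].
apply: (big_ind2 P).
- by split => //; rewrite -(scale0r 0) ipZ// mul0r.
- by move=> u1 z1 u2 z2 [h1 <-] [h2 <-]; split; [exact: HD|rewrite ipD].
- by move=> i _; split; [exact: HZ|rewrite ipZ].
Qed.

Lemma sip_self u : H u -> ip u u = ((q u)%:C)%C.
Proof.
move=> Hu; apply: complex_ext => //=.
by have /(congr1 (@complex.Im R)) := ipJ Hu Hu; rewrite ImJ; lra.
Qed.

Lemma sqnD u v : H u -> H v -> q (u + v) = q u + q v + 2 * complex.Re (ip u v).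
Proof.
move=> Hu Hv; rewrite /q ipD//; last exact: HD.
rewrite !sipDr// (ipJ Hu Hv) !ReIm; ring.
Qed.

Lemma sqnZ a u : H u -> q (a *: u) = cmodulus a ^+ 2 * q u.
Proof.
move=> Hu; rewrite /q ipZ//; last exact: HZ.
by rewrite sipZr// mulrA mulcJ sip_self// -rmorphM.
Qed.

Lemma sqnN u : H u -> q (- u) = q u.
Proof. by move=> Hu; rewrite -scaleN1r sqnZ// cmodulusN cmodulus1 expr1n mul1r. Qed.

Lemma sqnBC u v : H u -> H v -> q (u - v) = q (v - u).
Proof. by move=> Hu Hv; rewrite -sqnN ?opprB//; exact: sipHB. Qed.

Lemma sqnB u v : H u -> H v -> q (u - v) = q u + q v - 2 * complex.Re (ip u v).
Proof.
move=> Hu Hv; rewrite sqnD ?sqnN ?sipNr//; last exact: sipHN.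
by rewrite ReN mulrN.
Qed.

Lemma sqnD_le u v : H u -> H v -> q (u + v) <= 2 * q u + 2 * q v.
Proof.
move=> Hu Hv; have := ip_ge0 (sipHB Hu Hv); rewrite -/(q _) sqnB// sqnD//; lra.
Qed.

Lemma sqnB_le u v : H u -> H v -> q (u - v) <= 2 * q u + 2 * q v.
Proof.
move=> Hu Hv; rewrite (le_trans (sqnD_le Hu (sipHN Hv)))// sqnN//.
Qed.

Lemma sqn_triangle u v w : H u -> H v -> H w ->
  q (u - w) <= 2 * q (u - v) + 2 * q (v - w).
Proof.
move=> Hu Hv Hw; rewrite (_ : u - w = (u - v) + (v - w)); last by rewrite addrA subrK.
by apply: sqnD_le; exact: sipHB.
Qed.

Lemma sip_CauchySchwarz u v : H u -> H v -> cmodulus (ip u v) ^+ 2 <= q u * q v.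
Proof.
move=> Hu Hv; set z := ip u v.
have key (a b : R[i]) : 0 <= cmodulus a ^+ 2 * q u + cmodulus b ^+ 2 * q v +
    2 * complex.Re (a * conjc b * z).
  have := ip_ge0 (HD (HZ a Hu) (HZ b Hv)).
  rewrite -/(q _) sqnD; [|exact: HZ|exact: HZ].
  by rewrite !sqnZ// ipZ ?sipZr ?mulrA//; exact: HZ.
have qu := ip_ge0 Hu; have qv := ip_ge0 Hv; rewrite -/(q _) in qu qv.
have zz s : complex.Re (((s%:C)%C : R[i]) * conjc z * z) = s * cmodulus z ^+ 2.
  by rewrite -mulrA (mulrC _ z) mulcJ -rmorphM.
have := cmodulus_ge0 z; set m := cmodulus z => m0.
(* For a null vector [v], [key] at $1$ and $sz$ gives $q(u)+2sm^2\ge 0$ for every real $s$, which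
   forces $m=0$. *)
have [qv0|qv0] := eqVneq (q v) 0.
  have h (s : R) : 0 <= q u + 2 * (s * m ^+ 2).
    have := key 1 ((s%:C)%C * z); rewrite qv0 mulr0 addr0 cmodulus1 expr1n !mul1r.
    by rewrite conjcM (conjc_real s) zz.
  rewrite qv0 mulr0; have [->|m20] := eqVneq (m ^+ 2) 0; first by [].
  by have := h (- (q u + 1) / m ^+ 2); rewrite divfK//; lra.
have {}qv0 : 0 < q v by rewrite lt_def qv0.
(* This is positivity at $-q(v)\,u+\langle u,v\rangle v$, a multiple of the component of $u$
   orthogonal to $v$. *)
have := key ((- q v)%:C)%C z; rewrite zz -/m cmodulusR real_normK ?num_real//.
rewrite (_ : _ + _ = q v * (q u * q v - m ^+ 2)); last by ring.
by rewrite pmulr_rge0// subr_ge0.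
Qed.

Lemma sip_eq0 u v : H u -> H v -> q u = 0 -> ip u v = 0.
Proof.
move=> Hu Hv qu0; have := sip_CauchySchwarz Hu Hv; rewrite qu0 mul0r => h.
apply/eqP; rewrite -cmodulus_eq0 -sqrf_eq0 eq_le h/=; exact: sqr_ge0.
Qed.

Lemma sqn_eqB u v : H u -> H v -> q (u - v) = 0 -> q u = q v.
Proof.
move=> Hu Hv q0; have Huv := sipHB Hu Hv.
by rewrite -{1}(subrK v u) sqnD// q0 sip_eq0//= add0r mulr0 addr0.
Qed.

Lemma sip_eqB u v w : H u -> H v -> H w -> q (u - v) = 0 -> ip u w = ip v w.
Proof.
move=> Hu Hv Hw q0; apply/eqP; rewrite -subr_eq0 -sipB//.
by rewrite sip_eq0//; exact: sipHB.
Qed.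

Lemma sqn0_le u : H u -> (forall e, 0 < e -> q u <= e) -> q u = 0.
Proof.
move=> Hu h; apply/eqP; rewrite eq_le ip_ge0// andbT.
by apply/ler_addgt0Pr => e e0; rewrite add0r h.
Qed.

(** The modulus is squared so that Cauchy-Schwarz leaves an estimate polynomial in [q], without
    square roots. *)
Lemma sip_cvg (u_ v_ : nat -> V) u v : (forall n, H (u_ n)) -> (forall n, H (v_ n)) ->
  H u -> H v -> (fun n => q (u_ n - u)) @ \oo --> (0 : R) ->
  (fun n => q (v_ n - v)) @ \oo --> (0 : R) ->
  (fun n => cmodulus (ip (u_ n) (v_ n) - ip u v) ^+ 2) @ \oo --> (0 : R).
Proof.
move=> Hu_ Hv_ Hu Hv uu vv.
apply: (@squeeze_cvg0 _ _ (fun n => 2 * (q (u_ n - u) * (2 * q (v_ n - v) + 2 * q v)) +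
    2 * (q u * q (v_ n - v)))) => [n|n|]; first exact: sqr_ge0.
  rewrite (_ : ip _ _ - _ = ip (u_ n - u) (v_ n) + ip u (v_ n - v)); last first.
    by rewrite sipB// sipBr// addrA subrK.
  rewrite (le_trans (sqr_cmodulusD_le _ _))// lerD// ler_wpM2l//.
    rewrite (le_trans (sip_CauchySchwarz _ _))//; first exact: sipHB.
    rewrite ler_wpM2l//; first by apply: ip_ge0; exact: sipHB.
    rewrite -{1}(subrK v (v_ n)); apply: sqnD_le => //; exact: sipHB.
  by apply: sip_CauchySchwarz => //; exact: sipHB.
have -> : (0 : R) = 2 * (0 * (2 * 0 + 2 * q v)) + 2 * (q u * 0) by ring.
by apply: cvgD; (apply: cvgM; first exact: cvg_cst); apply: cvgM => //;
  [apply: cvgD; [|exact: cvg_cst]; apply: cvgM => //|]; exact: cvg_cst.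
Qed.

Lemma sqn_cvg (u_ : nat -> V) u : (forall n, H (u_ n)) ->
  H u -> (fun n => q (u_ n - u)) @ \oo --> (0 : R) ->
  (fun n => q (u_ n)) @ \oo --> q u.
Proof.
move=> Hu_ Hu uu; have h := sip_cvg Hu_ Hu_ Hu Hu uu uu.
apply/cvgrPdist_lt => e e0.
have e20 : 0 < e ^+ 2 by rewrite exprn_gt0.
have /cvgrPdist_lt/(_ _ e20) := h; apply: filterS => n.
rewrite sub0r normrN ger0_norm ?sqr_ge0// => hn.
have {}hn : cmodulus (ip (u_ n) (u_ n) - ip u u) < e.
  by rewrite -(@ltr_pXn2r _ 2)// ?nnegrE ?cmodulus_ge0 ?ltW.
rewrite distrC (le_lt_trans _ hn)// (le_trans _ (Re_le_cmodulus _))//.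
by rewrite !ReIm.
Qed.

Lemma sqn_cvg_uniq (u_ : nat -> V) u v : (forall n, H (u_ n)) -> H u -> H v ->
  (fun n => q (u_ n - u)) @ \oo --> (0 : R) ->
  (fun n => q (u_ n - v)) @ \oo --> (0 : R) -> q (u - v) = 0.
Proof.
move=> Hu_ Hu Hv uu uv; apply/eqP; rewrite eq_le ip_ge0 ?andbT; last exact: sipHB.
have h : (fun n => 2 * q (u_ n - u) + 2 * q (u_ n - v)) @ \oo --> (0 : R).
  have -> : (0 : R) = 2 * 0 + 2 * 0 by ring.
  by apply: cvgD; apply: cvgM => //; exact: cvg_cst.
apply: (cvg_lbound h) => n; rewrite (sqnBC (Hu_ n) Hu).
exact: sqn_triangle.
Qed.

End semi_hilbert.

(** Provides, in the span of more than $m$ test functions, a nontrivial combination orthogonal to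
    the first $m$ eigenvectors. *)
Lemma underdetermined_system (F : fieldType) (I : finType) (m : nat)
    (a : I -> nat -> F) : (m < #|I|)%N ->
  exists2 c : I -> F, (exists i, c i != 0) &
    forall n, (n < m)%N -> \sum_i c i * a i n = 0.
Proof.
move=> mI; pose A := \matrix_(i < #|I|, j < m) a (enum_val i) j.
have : kermx A != 0.
  rewrite -mxrank_eq0 mxrank_ker -lt0n subn_gt0.
  by rewrite (leq_ltn_trans (rank_leq_col _)).
case/rowV0Pn => w /sub_kermxP wA /rV0Pn[j wj].
exists (fun i => w ord0 (enum_rank i)); first by exists (enum_val j); rewrite enum_valK.
move=> n nm; have /matrixP/(_ ord0 (Ordinal nm)) := wA.
rewrite !mxE => wA0; rewrite -[RHS]wA0 (reindex (fun j : 'I_#|I| => enum_val j))/=; last first.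
  by exists enum_rank => ? _; [exact: enum_valK|exact: enum_rankK].
by apply: eq_bigr => i _; rewrite enum_valK mxE.
Qed.

Section variational.
Context {R : realType} {V : lmodType R[i]}.
Variables (H : set V) (ip : V -> V -> R[i]) (T : V -> V).
Hypothesis sip : semi_ip H ip.
Hypothesis H0 : H 0.
Hypothesis HT : forall u, H u -> H (T u).
Local Notation q := (sqn ip).
Let B u v := ip (T u) v.
Hypothesis sipB_ : semi_ip H B.
Hypothesis B_le : forall u, H u -> sqn B u <= q u.
Hypothesis T_compact : forall u : nat -> V, (forall n, H (u n)) ->
  (exists M, forall n, q (u n) <= M) ->
  exists (phi : nat -> nat) g, [/\ {homo phi : m n / (m < n)%N}, H g &
    (fun n => q (T (u (phi n)) - g)) @ \oo --> (0 : R)].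
Variables (lam : nat -> R) (v : nat -> V).
Hypothesis Hv : forall n, H (v n).
Hypothesis lam_noninc : forall m n, (m <= n)%N -> lam n <= lam m.
Hypothesis eig : forall n, q (T (v n) - (lam n)%:C%C *: v n) = 0.
Hypothesis eig_full : forall (nu : R) w, nu != 0 -> H w ->
  q (T w - nu%:C%C *: w) = 0 -> (forall n, lam n = nu -> ip w (v n) = 0) -> q w = 0.

Let qB u : H u -> sqn B u = complex.Re (ip (T u) u). Proof. by []. Qed.

(** [T] need not be additive as a map of functions; additivity is known only through [B]. With
    $z=Tu-Tw$ one has $q(z)=B(u-w,z)$, and Cauchy-Schwarz for [B] together with [B_le] gives
    $q(z)^2\le q(u-w)\,q(z)$. *)
Let TB_le u w : H u -> H w -> q (T u - T w) <= q (u - w).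
Proof.
move=> Hu Hw; set z := T u - T w.
have Hz : H z by apply: (sipHB sip); exact: HT.
have Huw := sipHB sip Hu Hw.
have zE : ip z z = B (u - w) z.
  by rewrite {1}/z (sipB sip) ?(sipB sipB_)//; exact: HT.
have := sip_CauchySchwarz sipB_ Huw Hz; rewrite -zE (sip_self sip Hz) cmodulusR.
rewrite real_normK ?num_real//.
have := B_le Huw; have := B_le Hz.
have := sip_ge0 sip Hz; have := sip_ge0 sip Huw; rewrite -!/(q _).
have := sip_ge0 sipB_ Hz; have := sip_ge0 sipB_ Huw; rewrite -!/(sqn B _).
move=> ? ? ? ? h1 h2 h3.
have {h3} : q z ^+ 2 <= q (u - w) * q z by apply: (le_trans h3); apply: ler_pM.
nra.
Qed.

(* If lam m < eps, then a maximizing sequence of the form B on the unit sphere of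
   the orthogonal complement of v 0, ..., v (m - 1) converges by compactness to an
   eigenvector of eigenvalue at least eps, orthogonal to all v n with n < m. *)
Lemma eigenvalue_lower_bound (I : finType) (h : I -> V) (eps : R) :
  0 < eps -> (forall i, H (h i)) ->
  (forall c : I -> R[i], (exists i, c i != 0) ->
    0 < q (\sum_i c i *: h i) /\
    eps * q (\sum_i c i *: h i) <= sqn B (\sum_i c i *: h i)) ->
  forall m, (m < #|I|)%N -> eps <= lam m.
Proof.
move=> eps0 Hh hB m mI; rewrite leNgt; apply/negP => lam_eps.
pose M u := H u /\ forall n, (n < m)%N -> ip u (v n) = 0.
have MH u : M u -> H u by case.
have MZ a u : M u -> M (a *: u).
  move=> [Hu uv]; split; first exact: (sipHZ sip).
  by move=> n nm; rewrite (sipZ sip)// uv// mulr0.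
(* Invariance follows from the symmetry of [B] and the eigenvector equation for [v n], which holds
   up to a null vector only; inside [ip] that is enough. *)
have MT u : M u -> M (T u).
  move=> [Hu uv]; split; first exact: HT.
  move=> n nm; rewrite -/(B u (v n)) (sipJ sipB_ (Hv n) Hu) /B.
  rewrite (sip_eqB sip _ _ _ (eig n))//; [|exact: HT|exact: (sipHZ sip)].
  by rewrite (sipZ sip)// rmorphM/= -(sipJ sip)// uv// mulr0.
have [c c0 cv] := underdetermined_system (fun i n => ip (h i) (v n)) mI.
pose u0 := \sum_i c i *: h i.
have Mu0 : M u0.
  split; first exact: (sipH_sum sip).
  by move=> n nm; rewrite (sip_suml sip)// cv.
have [qu0 Bu0] := hB _ c0; rewrite -/u0 in qu0 Bu0.
have normalize u : M u -> 0 < q u ->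
    exists2 w, M w /\ q w = 1 & sqn B w = sqn B u / q u.
  move=> Mu qu; exists (((Num.sqrt (q u))^-1)%:C%C *: u).
    split; first exact: MZ.
    rewrite (sqnZ sip)//; last exact: MH.
    by rewrite cmodulusR real_normK ?num_real// exprVn sqr_sqrtr ?ltW// mulVf// gt_eqF.
  rewrite (sqnZ sipB_)//; last exact: MH.
  by rewrite cmodulusR real_normK ?num_real// exprVn sqr_sqrtr ?ltW// mulrC.
pose S : set R := [set sqn B u | u in [set u | M u /\ q u = 1]].
have Sub : ubound S 1 by move=> _ [u [Mu <-] <-]; apply: B_le; exact: MH.
have [w0 [Mw0 qw0] Bw0] := normalize _ Mu0 qu0.
have supS : has_sup S by split; [exists (sqn B w0); exists w0|exists 1].
pose nu := sup S.
have S_nu u : M u -> q u = 1 -> sqn B u <= nu.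
  by move=> Mu qu; apply: (ub_le_sup supS.2); exists u.
have eps_nu : eps <= nu.
  by rewrite (le_trans _ (S_nu _ Mw0 qw0))// Bw0 ler_pdivlMr.
have nu0 : 0 < nu by exact: lt_le_trans eps_nu.
have B_nu u : M u -> sqn B u <= nu * q u.
  move=> Mu; have := sip_ge0 sip (MH _ Mu); rewrite -/(q u) le_eqVlt => /predU1P[q0|q0].
    by rewrite -q0 mulr0 q0; apply: B_le; exact: MH.
  have [w [Mw qw] Bw] := normalize _ Mu q0.
  by have := S_nu _ Mw qw; rewrite Bw ler_pdivrMr.
(* Cauchy-Schwarz for [B] at $u$ and $Tu$ gives $q(Tu)^2\le B(u)\,B(Tu)\le B(u)\,\nu\,q(Tu)$, the
   last step because $Tu$ is in [M]. *)
have qT u : M u -> q (T u) <= nu * sqn B u.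
  move=> Mu; have Hu := MH _ Mu; have HTu := HT Hu.
  have := sip_CauchySchwarz sipB_ Hu HTu; rewrite /B (sip_self sip HTu) cmodulusR.
  rewrite real_normK ?num_real// => CS.
  have := B_nu _ (MT _ Mu); have := sip_ge0 sip HTu; rewrite -/(q _).
  have := sip_ge0 sipB_ Hu; rewrite -/(sqn B _) => b0 q0 BT.
  have : q (T u) ^+ 2 <= sqn B u * (nu * q (T u)).
    by apply: (le_trans CS); apply: ler_wpM2l.
  have := mulr_ge0 (ltW nu0) b0; nra.
have /choice[f fP] k : exists f, [/\ M f, q f = 1 & nu - k.+1%:R^-1 < sqn B f].
  have k0 : 0 < k.+1%:R^-1 :> R by rewrite invr_gt0.
  have [_ [u [Mu qu] <-] lt] := sup_adherent k0 supS.
  by exists u.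
have Mf k : M (f k) by case: (fP k).
have Hf k : H (f k) := MH _ (Mf k).
have qf k : q (f k) = 1 by case: (fP k).
have HZ a u : H u -> H (a *: u) by exact: (sipHZ sip).
have HB u w : H u -> H w -> H (u - w) by exact: (sipHB sip).
(* A near maximizer is a near eigenvector: expanding the square and using [qT], $q(Tf-\nu f)\le \nu
   B(f)+\nu^2-2\nu B(f)=\nu(\nu-B(f))$. *)
have Tnu k : q (T (f k) - nu%:C%C *: f k) <= nu * k.+1%:R^-1.
  rewrite (sqnB sip); [|exact: HT|exact: HZ].
  rewrite (sqnZ sip)// (sipZr sip)//; last exact: HT.
  rewrite conjc_real cmodulusR real_normK ?num_real// qf.
  have := qT _ (Mf k); have [_ _] := fP k; rewrite (qB (Hf k)) !ReIm mul0r subr0.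
  set b := complex.Re _; set a := k.+1%:R^-1 => h1 h2.
  have : 0 <= nu * (b - (nu - a)) by rewrite mulr_ge0 ?subr_ge0 ?ltW.
  by rewrite expr2; nra.
have [|phi [g [phi_mono Hg Tg]]] := T_compact Hf; first by exists 1 => n; rewrite qf.
have phi_ge n : (n <= phi n)%N.
  by elim: n => // n ih; apply: (leq_ltn_trans ih); exact: phi_mono.
have nuC : nu%:C%C != 0 :> R[i] by rewrite -cmodulus_eq0 cmodulusR normr_eq0 gt_eqF.
(* Along the subsequence $\nu f$ is close to $Tf$, which tends to $g$; as $\nu>0$, the vectors $f$
   themselves converge to $g/\nu$. *)
pose w := (nu^-1)%:C%C *: g.
have Hw : H w by exact: HZ.
have gE : g = nu%:C%C *: w.
  by rewrite scalerA -rmorphM/= mulfV ?gt_eqF// scale1r.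
have Tf0 : (fun n => q (T (f (phi n)) - nu%:C%C *: f (phi n))) @ \oo --> (0 : R).
  apply: (@squeeze_cvg0 _ _ (fun n => nu * n.+1%:R^-1)) => [n|n|].
  - by apply: (sip_ge0 sip); apply: HB; [exact: HT|exact: HZ].
  - rewrite (le_trans (Tnu _))// (ler_wpM2l (ltW nu0))// lef_pV2 ?posrE//.
    by rewrite ler_nat ltnS.
  - by rewrite -(mulr0 nu); apply: cvgM; [exact: cvg_cst|exact: cvg_harmonic].
have fw : (fun n => q (f (phi n) - w)) @ \oo --> (0 : R).
  apply: (@squeeze_cvg0 _ _ (fun n => nu ^- 2 *
     (2 * q (T (f (phi n)) - nu%:C%C *: f (phi n)) + 2 * q (T (f (phi n)) - g)))) => [n|n|].
  - by apply: (sip_ge0 sip); exact: HB.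
  - rewrite ler_pdivlMl ?exprn_gt0//.
    have -> : nu ^+ 2 * q (f (phi n) - w) = q (nu%:C%C *: f (phi n) - g).
      rewrite gE -scalerBr (sqnZ sip) ?cmodulusR ?real_normK ?num_real//.
      exact: HB.
    rewrite (sqnBC sip (HT (Hf _)) (HZ _ _ (Hf _))).
    by apply: (sqn_triangle sip) => //; [exact: HZ|exact: HT].
  - rewrite -(mulr0 (nu ^- 2)); apply: cvgM; first exact: cvg_cst.
    have -> : (0 : R) = 2 * 0 + 2 * 0 by ring.
    by apply: cvgD; apply: cvgM => //; exact: cvg_cst.
have qw1 : q w = 1.
  have qfw := sqn_cvg sip (fun n => Hf (phi n)) Hw fw.
  have : (fun n => q (f (phi n))) @ \oo --> (1 : R).
    by under eq_fun do rewrite qf; exact: cvg_cst.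
  by move=> /cvg_lim h1; rewrite -(cvg_lim _ qfw)// h1.
have wv n : (n < m)%N -> ip w (v n) = 0.
  move=> nm.
  have vn0 : (fun _ : nat => q (v n - v n)) @ \oo --> (0 : R).
    by rewrite subrr /sqn -{1}(scale0r (v n)) (sipZ sip)// mul0r; exact: cvg_cst.
  apply/eqP; rewrite -cmodulus_eq0 -sqrf_eq0 eq_le sqr_ge0 andbT.
  have /cvg_lim wlim := sip_cvg sip (fun k => Hf (phi k)) (fun=> Hv n) Hw (Hv n) fw vn0.
  move: wlim; under eq_fun do rewrite (Mf _).2// sub0r cmodulusN.
  by rewrite lim_cst// => ->.
have Tw : q (T w - nu%:C%C *: w) = 0.
  rewrite -gE; apply: (sqn_cvg_uniq sip (fun n => HT (Hf (phi n)))) => //; first exact: HT.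
  apply: (squeeze_cvg0 _ _ fw) => n; first by apply: (sip_ge0 sip); apply: HB; exact: HT.
  exact: TB_le.
(* An index with [lam n = nu] is smaller than [m], because $\nu\ge$ [eps] $>$ [lam m] and [lam] is
   non-increasing. So [w] is orthogonal to all listed eigenvectors of eigenvalue $\nu$ and must be
   null, against [qw1]. *)
have : q w = 0.
  apply: (eig_full _ Hw Tw); first by rewrite gt_eqF.
  move=> n ln; apply: wv; rewrite ltnNge; apply/negP => /lam_noninc.
  by rewrite ln leNgt (lt_le_trans lam_eps).
by rewrite qw1 => /eqP; rewrite oner_eq0.
Qed.

End variational.

(** * Lebesgue measure on R^d *)

Lemma split_length_le (R : realType) (a p q : R) :
  Num.max 0 (Num.min q a - p) + Num.max 0 (q - Num.max p a) <= Num.max 0 (q - p).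
Proof.
have [pa|pa] := ltP p a; have [qa|qa] := ltP q a;
  case: (ltP 0 (q - p)) => ?; case: (ltP 0 (a - p)) => ?; case: (ltP 0 (q - a)) => ?;
  rewrite ?(max_l _ _); lra.
Qed.

Section ereal_series.
Context {R : realType}.
Local Open Scope ereal_scope.

(** The dummy [t], of value 0, fills the indices outside the enumerating set, so that finite and
    empty families also become sequences. *)
Lemma esum_countable_series (T : pointedType) (C : set T) (a : T -> \bar R) (t : T) :
  countable C -> (forall x, 0 <= a x) -> a t = 0 ->
  exists2 I : nat -> T, (forall x, C x -> exists n, I n = x) &
    \sum_(n <oo) a (I n) = \esum_(x in C) a x.
Proof.
move=> /countable_bijP[B CB] a0 at0.
have [f [fBC finj fsurj]] := card_set_bijP (card_esym CB).
exists (fun n => if n \in B then f n else t).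
  by move=> x /fsurj[n Bn <-]; exists n; rewrite mem_set.
rewrite (@reindex_esum _ _ _ B C f)//.
rewrite nneseries_esumT; last by move=> n; exact: a0.
rewrite [RHS]esum_mkcond; apply: eq_esum => n _.
by case: ifPn.
Qed.

End ereal_series.

Section lebesgue_measure_boxes.
Context {R : realType} {d : nat}.
Hypothesis d0 : (0 < d)%N.
Implicit Types (I J Q : 'rV[R]_d * 'rV[R]_d) (X Y : set 'rV[R]_d).
Local Notation outer := (lebesgue_outer R d).
Local Open Scope ereal_scope.

Lemma lebesgue_outer_box_le I : outer (box I) <= (box_volume I)%:E.
Proof.
apply: ereal_inf_lbound; exists [set I]; last first.
  by rewrite esum_set1// lee_fin box_volume_ge0.
by split => // x Ix; exists I.
Qed.

Lemma lebesgue_outer_cover_le X (I : nat -> 'rV[R]_d * 'rV[R]_d) :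
  X `<=` \bigcup_n box (I n) -> outer X <= \sum_(n <oo) (box_volume (I n))%:E.
Proof.
move=> XI; rewrite (le_trans (le_outer_measure _ _ _ XI))//.
rewrite (le_trans (outer_measure_sigma_subadditive _ _))//.
by apply: lee_nneseries => n _; [move=> _; exact: lebesgue_outer_ge0|exact: lebesgue_outer_box_le].
Qed.

Lemma lebesgue_outer_cover X (e : R) : outer X < +oo -> (0 < e)%R ->
  exists2 I : nat -> 'rV[R]_d * 'rV[R]_d, X `<=` \bigcup_n box (I n) &
    \sum_(n <oo) (box_volume (I n))%:E <= outer X + e%:E.
Proof.
move=> Xoo e0.
have Xfin : outer X \is a fin_num by rewrite ge0_fin_numE// lebesgue_outer_ge0.
have [_ [C [cC XC] <-] ltC] := lb_ereal_inf_adherent e0 Xfin.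
(* A box with reversed endpoints has volume 0 when $d>0$. For $d=0$ the volume is an empty product,
   every box has volume 1, and there is no such filler. *)
pose t : 'rV[R]_d * 'rV[R]_d := (const_mx 1%R, const_mx 0%R).
have [| |I CI sumI] := @esum_countable_series R _ C (fun I => (box_volume I)%:E) t cC.
- by move=> I; rewrite lee_fin box_volume_ge0.
- rewrite /box_volume (bigD1 (Ordinal d0))//= !mxE max_l ?mul0r//; lra.
exists I; last by rewrite sumI ltW.
by move=> x /XC[J CJ xJ]; have [n In] := CI _ CJ; exists n => //; rewrite In.
Qed.

(** Interpolates between the indicator of the box ([l = d]) and its volume ([l = 0]): the
    coordinates from [l] on have already been integrated out. *)
Let w (l : nat) J (i : 'I_d) (t : R) : R :=
  (if (i < l)%N then \1_(`[(J.1 ord0 i), (J.2 ord0 i)]) t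
  else Num.max 0 (J.2 ord0 i - J.1 ord0 i))%R.

Let w_ge0 l J i t : (0 <= w l J i t)%R.
Proof. by rewrite /w; case: ifP => _; rewrite ?le_max ?lexx// indicE ler0n. Qed.

(* Integrating a cover inequality of indicators over one coordinate at a time. *)
Lemma box_volume_cover_le Q (I : nat -> 'rV[R]_d * 'rV[R]_d) :
  box Q `<=` \bigcup_n box (I n) ->
  (box_volume Q)%:E <= \sum_(n <oo) (box_volume (I n))%:E.
Proof.
move=> QI.
suff key l : (l <= d)%N -> forall x : 'rV[R]_d,
    (\prod_(i < d) w l Q i (x ord0 i))%:E <=
    \sum_(n <oo) (\prod_(i < d) w l (I n) i (x ord0 i))%:E.
  by have := key 0%N isT 0%R.
move=> ld; rewrite -(subKn ld); elim: (d - l)%N (leq_subr l d) => [_ x|k ih kd x].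
  rewrite subn0; have [xQ|xQ] := pselect (box Q x).
    have [n _ xn] := QI _ xQ.
    have w1 J : box J x -> (\prod_(i < d) w d J i (x ord0 i))%R = 1%R.
      move=> xJ; apply: big1 => i _; rewrite /w ltn_ord indicE mem_set//=.
      by rewrite in_itv/=; exact: xJ.
    rewrite w1//.
    have t0 m : 0 <= (\prod_(i < d) w d (I m) i (x ord0 i))%:E.
      by rewrite lee_fin; apply: prodr_ge0 => i _; exact: w_ge0.
    have := @nneseries_lim_ge _ _ predT 0%N n.+1 (fun m _ _ => t0 m).
    by rewrite big_nat_recr//= w1//; apply: le_trans; rewrite leeDr// sume_ge0.
  have /existsNP[i xi] := xQ.
  rewrite (bigD1 i)//= {1}/w ltn_ord indicE memNset ?mul0r; last by rewrite /= in_itv.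
  by apply: nneseries_ge0 => m _ _; rewrite lee_fin; apply: prodr_ge0 => j _; exact: w_ge0.
have kd' : (d - k.+1 < d)%N by rewrite ltn_subrL d0.
pose i0 := Ordinal kd'.
pose K J := (\prod_(i < d | i != i0) w (d - k.+1) J i (x ord0 i))%R.
have K0 J : (0 <= K J)%R by apply: prodr_ge0 => i _; exact: w_ge0.
pose y t : 'rV[R]_d := (\row_i if i == i0 then t else x ord0 i)%R.
have E1 J t : (\prod_(i < d) w (d - k) J i (y t ord0 i))%R =
    (\1_(`[(J.1 ord0 i0), (J.2 ord0 i0)]) t * K J)%R.
  rewrite (bigD1 i0)//=; congr (_ * _)%R.
    by rewrite /w mxE eqxx ltn_sub2l.
  apply: eq_bigr => i ii0; rewrite mxE (negbTE ii0) /w.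
  congr (if _ then _ else _); rewrite -(subnSK kd) ltnS leq_eqVlt.
  by rewrite (_ : (nat_of_ord i == _) = false)//; apply: negbTE.
have E2 J : (\prod_(i < d) w (d - k.+1) J i (x ord0 i))%:E =
    \int[lebesgue_measure]_t (\1_(`[(J.1 ord0 i0), (J.2 ord0 i0)]) t * K J)%:E.
  under eq_integral do rewrite EFinM.
  rewrite ge0_integralZr ?lee_fin//; last exact/measurable_EFinP/measurable_indic.
  rewrite integral_indic// setIT.
  transitivity (lebesgue_measure (`[J.1 ord0 i0, J.2 ord0 i0]%classic : set R) * (K J)%:E); last by [].
  rewrite lebesgue_measure_itv/= lte_fin.
  rewrite (bigD1 i0)//= EFinM; congr (_ * _).
  rewrite /w ltnn; case: ltP => h; last by rewrite max_l// subr_le0.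
  by rewrite max_r// subr_ge0 ltW.
rewrite E2; under eq_eseriesr do rewrite E2.
rewrite -integral_nneseries//; last 2 first.
- by move=> n; apply/measurable_EFinP; apply: measurable_funM => //; exact: measurable_indic.
- by move=> n t _; rewrite lee_fin mulr_ge0.
apply: ge0_le_integral => //.
- by move=> t _; rewrite lee_fin mulr_ge0.
- by apply/measurable_EFinP; apply: measurable_funM => //; exact: measurable_indic.
- apply: ge0_emeasurable_sum.
  + by move=> n t _ _; rewrite lee_fin mulr_ge0.
  + by move=> n _; apply/measurable_EFinP; apply: measurable_funM => //; exact: measurable_indic.
- by move=> t _; have := ih (ltnW kd) (y t); under eq_eseriesr do rewrite E1; rewrite E1.
Qed.

Lemma lebesgue_outer_box I : outer (box I) = (box_volume I)%:E.
Proof.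
apply/eqP; rewrite eq_le lebesgue_outer_box_le/=.
apply/lee_addgt0Pr => e e0.
have [|J IJ sumJ] := @lebesgue_outer_cover (box I) e _ e0.
  by rewrite (le_lt_trans (lebesgue_outer_box_le _))// ltry.
exact: le_trans (box_volume_cover_le IJ) sumJ.
Qed.

Lemma measurable_halfspace (i : 'I_d) (a : R) :
  outer.-cara.-measurable [set x : 'rV[R]_d | (x ord0 i <= a)%R].
Proof.
apply: le_caratheodory_measurable => X.
set Hs := [set x : 'rV[R]_d | (x ord0 i <= a)%R].
change (outer (X `&` Hs) + outer (X `&` ~` Hs) <= outer X).
have [->|Xoo] := eqVneq (outer X) +oo; first exact: leey.
rewrite -ltey in Xoo.
apply/lee_addgt0Pr => e e0; have [I XI sumI] := lebesgue_outer_cover Xoo e0.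
apply: le_trans sumI.
(* Each box of the cover is cut at the hyperplane. The lower and upper halves cover the two parts of
   [X], and their volumes add up to at most that of the box. *)
pose L J : 'rV[R]_d * 'rV[R]_d :=
  (J.1, \row_j if j == i then Num.min (J.2 ord0 i) a else J.2 ord0 j)%R.
pose U J : 'rV[R]_d * 'rV[R]_d :=
  (\row_j if j == i then Num.max (J.1 ord0 i) a else J.1 ord0 j, J.2)%R.
have LU J : (box_volume (L J) + box_volume (U J) <= box_volume J)%R.
  pose K := (\prod_(j < d | j != i) Num.max 0 (J.2 ord0 j - J.1 ord0 j))%R.
  have LE : (box_volume (L J) = Num.max 0 (Num.min (J.2 ord0 i) a - J.1 ord0 i) * K)%R.
    rewrite /box_volume (bigD1 i)//= !mxE eqxx; congr (_ * _)%R.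
    by apply: eq_bigr => j ji; rewrite mxE (negbTE ji).
  have UE : (box_volume (U J) = Num.max 0 (J.2 ord0 i - Num.max (J.1 ord0 i) a) * K)%R.
    rewrite /box_volume (bigD1 i)//= !mxE eqxx; congr (_ * _)%R.
    by apply: eq_bigr => j ji; rewrite mxE (negbTE ji).
  have JE : (box_volume J = Num.max 0 (J.2 ord0 i - J.1 ord0 i) * K)%R.
    by rewrite /box_volume (bigD1 i).
  rewrite LE UE JE -mulrDl ler_wpM2r//; first by apply: prodr_ge0 => j _; rewrite le_max lexx.
  move: (J.1 ord0 i) (J.2 ord0 i) => p q.
  exact: split_length_le.
apply: (@le_trans _ _ (\sum_(n <oo) (box_volume (L (I n)))%:E +
    \sum_(n <oo) (box_volume (U (I n)))%:E)).
  apply: leeD; apply: lebesgue_outer_cover_le => x [/XI[n _ xn]] /= xa; exists n => // j.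
    rewrite mxE; case: eqP => [->|_]; last exact: xn.
    by have /andP[-> xI] := xn i; rewrite le_min xI xa.
  rewrite mxE; case: eqP => [->|_]; last exact: xn.
  have /andP[xI ->] := xn i; rewrite ge_max xI andbT/= ltW// ltNge; exact/negP.
rewrite -nneseriesD; [|by move=> *; rewrite lee_fin box_volume_ge0..].
apply: lee_nneseries => n _; first by move=> _; rewrite adde_ge0// lee_fin box_volume_ge0.
by rewrite -EFinD lee_fin.
Qed.

Lemma lebesgue_outer_shift_le X (a : 'rV[R]_d) :
  outer [set x | X (x + a)%R] <= outer X.
Proof.
have [->|Xoo] := eqVneq (outer X) +oo; first exact: leey.
rewrite -ltey in Xoo.
apply/lee_addgt0Pr => e e0; have [I XI sumI] := lebesgue_outer_cover Xoo e0.
apply: le_trans sumI.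
pose J n := ((I n).1 - a, (I n).2 - a)%R.
rewrite (_ : \sum_(n <oo) _ = \sum_(n <oo) (box_volume (J n))%:E); last first.
  apply: eq_eseriesr => n _; congr EFin; apply: eq_bigr => i _; rewrite !mxE.
  by congr Num.max; ring.
apply: lebesgue_outer_cover_le => x /= /XI[n _ xn]; exists n => // i.
by have /andP[] := xn i; rewrite !mxE lerBlDr lerBrDr => -> ->.
Qed.

Lemma lebesgue_outer_shift X (a : 'rV[R]_d) : outer [set x | X (x + a)%R] = outer X.
Proof.
apply/eqP; rewrite eq_le lebesgue_outer_shift_le/=.
rewrite -{1}(_ : [set x | [set y | X (y + a)%R] (x - a)%R] = X).
  exact: lebesgue_outer_shift_le.
by apply/seteqP; split => x /=; rewrite subrK.
Qed.

Lemma measurable_shift X (a : 'rV[R]_d) : outer.-cara.-measurable X ->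
  outer.-cara.-measurable [set x | X (x + a)%R].
Proof.
move=> mX; have {}mX : caratheodory_measurable outer X by exact: mX.
change (caratheodory_measurable outer [set x | X (x + a)%R]) => Y.
rewrite -(lebesgue_outer_shift Y (- a)) mX.
rewrite -(lebesgue_outer_shift (_ `&` X) a) -(lebesgue_outer_shift (_ `&` ~` X) a).
by congr (outer _ + outer _); apply/seteqP; split => x /=; rewrite addrK.
Qed.

End lebesgue_measure_boxes.

Section measure_preserving.
Context {dT : measure_display} {T : measurableType dT} {R : realType}.
Variable mu : {measure set T -> \bar R}.

Definition measure_preserving (phi : T -> T) : Prop :=
  measurable_fun setT phi /\
  forall X, measurable X -> mu (phi @^-1` X) = mu X.

Variable phi : T -> T.
Hypothesis mphi : measure_preserving phi.

Lemma ge0_integral_preserving (f : T -> \bar R) : measurable_fun setT f ->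
  (forall x, 0 <= f x)%E -> (\int[mu]_x f (phi x) = \int[mu]_x f x)%E.
Proof.
case: mphi => m1 m2 mf f0.
have := @ge0_integral_pushforward _ _ _ _ _ _ m1 mu setT f measurableT mf.
rewrite preimage_setT => <-//.
by apply: eq_measure_integral => X mX _; exact: m2.
Qed.

Lemma integral_preserving (f : T -> \bar R) : measurable_fun setT f ->
  (\int[mu]_x f (phi x) = \int[mu]_x f x)%E.
Proof.
move=> mf; rewrite [LHS]integralE [RHS]integralE.
have := ge0_integral_preserving (measurable_funepos mf) (fun x => funepos_ge0 f x).
have := ge0_integral_preserving (measurable_funeneg mf) (fun x => funeneg_ge0 f x).
move=> En Ep; rewrite -[in RHS]Ep -[in RHS]En.
by congr (_ - _)%E; apply: eq_integral => x _; rewrite ?funeposE ?funenegE.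
Qed.

Lemma cmeas_preserving (f : T -> R[i]) : cmeas f -> cmeas (fun x => f (phi x)).
Proof.
case: mphi => m1 _ [f1 f2]; split; first exact: (measurableT_comp f1 m1).
exact: (measurableT_comp f2 m1).
Qed.

Lemma cint_preserving (f : T -> R[i]) : cmeas f ->
  cint mu (fun x => f (phi x)) = cint mu f.
Proof.
move=> [f1 f2]; apply: complex_ext => /=; rewrite /Rintegral.
  by rewrite (integral_preserving (f := fun x => (complex.Re (f x))%:E))//; exact/measurable_EFinP.
by rewrite (integral_preserving (f := fun x => (complex.Im (f x))%:E))//; exact/measurable_EFinP.
Qed.

End measure_preserving.

Section boxes.
Context {R : realType} {d : nat}.
Local Notation mu := (lebesgue_Rd R d).
Implicit Types (a b x y : 'rV[R]_d).

Lemma measurable_coord (i : 'I_d) :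
  measurable_fun [set: Rd R d] (fun x : Rd R d => (x : 'rV[R]_d) ord0 i).
Proof.
move=> mT; apply: (measurability _ (RGenOInfty.measurableE R)) => //.
move=> _ [_ [a ->] <-]; rewrite setTI.
have -> : (fun x : Rd R d => (x : 'rV[R]_d) ord0 i) @^-1` `]a, +oo[%classic =
    ~` [set x : 'rV[R]_d | x ord0 i <= a].
  apply/seteqP; split => x /=; rewrite in_itv/= andbT ltNge => /negP//.
apply: measurableC; apply: measurable_halfspace.
by case: i => i id; exact: leq_ltn_trans id.
Qed.

Lemma measurable_coordwise (P : 'I_d -> set R) : (forall i, measurable (P i)) ->
  (lebesgue_outer R d).-cara.-measurable [set x : 'rV[R]_d | forall i, P i (x ord0 i)].
Proof.
move=> mP.
have -> : [set x : 'rV[R]_d | forall i, P i (x ord0 i)] =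
    \bigcap_(i in [set: 'I_d]) [set x : 'rV[R]_d | P i (x ord0 i)].
  by apply/seteqP; split => [x h i _|x h i]; [exact: h|exact: (h i I)].
apply: (@fin_bigcap_measurable _ (Rd R d)); first exact: finite_finset.
move=> i _; have := measurable_coord i measurableT (mP i).
by rewrite setTI.
Qed.

(** Half-open boxes are used because the cells of a grid and the slabs of a period must be disjoint;
    closed boxes remain the ones whose measure is computed from covers. *)
Definition obox a b : set 'rV[R]_d :=
  [set x | forall i, a ord0 i <= x ord0 i < b ord0 i].

Lemma measurable_box I : (lebesgue_outer R d).-cara.-measurable (box I).
Proof.
rewrite (_ : box I = [set x | forall i, `[I.1 ord0 i, I.2 ord0 i]%classic (x ord0 i)]).
  apply: (measurable_coordwise (P := fun i => `[I.1 ord0 i, I.2 ord0 i]%classic)) => i.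
  exact: measurable_itv.
by apply/seteqP; split => x /= h i; have := h i; rewrite in_itv.
Qed.

Lemma measurable_obox a b : (lebesgue_outer R d).-cara.-measurable (obox a b).
Proof.
rewrite (_ : obox a b = [set x | forall i, `[a ord0 i, b ord0 i[%classic (x ord0 i)]).
  apply: (measurable_coordwise (P := fun i => `[a ord0 i, b ord0 i[%classic)) => i.
  exact: measurable_itv.
by apply/seteqP; split => x /= h i; have := h i; rewrite in_itv.
Qed.

Definition cube (r : R) : set 'rV[R]_d := box (const_mx (- r), const_mx r).

Lemma cubeP (r : R) x : cube r x <-> forall i, `|x ord0 i| <= r.
Proof.
by split => h i; have := h i; rewrite !mxE ler_norml.
Qed.

(** Required by Fubini's theorem in the multiplication formula and by the measurability of a Fourier
    integral in its parameter. *)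
Lemma lebesgue_Rd_sigma_finite : sigma_finite setT mu.
Proof.
exists (fun n => cube n%:R).
  apply/seteqP; split => // x _.
  exists (Num.truncn (\sum_i `|x ord0 i|)).+1 => //; apply/cubeP => i.
  apply: (@le_trans _ _ (\sum_i `|x ord0 i|)); last first.
    exact/ltW/truncnS_gt.
  by rewrite (bigD1 i)//= lerDl sumr_ge0.
move=> n; split; first exact: measurable_box.
by rewrite (le_lt_trans (lebesgue_outer_box_le _))// ltry.
Qed.

HB.instance Definition _ := @Measure_isSigmaFinite.Build _ _ _ mu lebesgue_Rd_sigma_finite.

End boxes.

Section boxes_volume.
Context {R : realType} {d : nat}.
Hypothesis d0 : (0 < d)%N.
Local Notation mu := (lebesgue_Rd R d).
Implicit Types (a b x y : 'rV[R]_d).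

Lemma lebesgue_face a b (i : 'I_d) :
  mu [set x | (forall j, a ord0 j <= x ord0 j <= b ord0 j) /\ x ord0 i = b ord0 i] = 0%E.
Proof.
apply/eqP; rewrite eq_le measure_ge0 andbT.
pose I := (\row_j if j == i then b ord0 i else a ord0 j, b) : 'rV[R]_d * 'rV[R]_d.
have -> : (0 = (box_volume I)%:E)%E.
  by rewrite /box_volume (bigD1 i)//= !mxE eqxx subrr max_l// mul0r.
rewrite -(lebesgue_outer_box d0); apply: le_outer_measure => x [xab xi] j.
by rewrite !mxE; case: eqP => [->|_]; [rewrite xi lexx|exact: xab].
Qed.

Lemma lebesgue_obox a b : mu (obox a b) = (\prod_i Num.max 0 (b ord0 i - a ord0 i))%:E.
Proof.
rewrite -(lebesgue_outer_box d0 (a, b)); apply/eqP; rewrite eq_le; apply/andP; split.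
  by apply: le_outer_measure => x xab i; have /andP[-> /ltW] := xab i.
pose F i : set 'rV[R]_d := [set x | (forall j, a ord0 j <= x ord0 j <= b ord0 j) /\ x ord0 i = b ord0 i].
pose N := \big[setU/set0]_(i < d) F i.
have N0 : lebesgue_outer R d N = 0%E.
  apply/eqP; rewrite eq_le lebesgue_outer_ge0 andbT /N.
  elim/big_ind : _ => [|X Y X0 Y0|i _]; first by rewrite lebesgue_outer0.
    rewrite (le_trans (outer_measureU2 _ _ _))//.
    by rewrite -(adde0 0%E); exact: leeD.
  by rewrite -[leLHS]/(mu (F i)) lebesgue_face.
rewrite -[leRHS]adde0 -N0 (le_trans _ (outer_measureU2 _ _ _))//.
apply: le_outer_measure => x xab.
have [h|/existsNP[i xi]] := pselect (obox a b x); [by left|right].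
rewrite /N (bigD1 i)//=; left; split => //.
by have /andP[ax xb] := xab i; apply/eqP; rewrite eq_le xb leNgt; apply/negP => h; apply: xi; rewrite ax.
Qed.

Lemma cube_finite (r : R) : (mu (cube r) < +oo)%E.
Proof. by rewrite (le_lt_trans (lebesgue_outer_box_le _))// ltry. Qed.

Lemma measurable_shift_fun a :
  measurable_fun [set: Rd R d] (fun x : Rd R d => (x : 'rV[R]_d) + a : Rd R d).
Proof. by move=> _ Y mY; rewrite setTI; exact: measurable_shift. Qed.

Lemma measure_preserving_shift a :
  measure_preserving mu (fun x : Rd R d => (x : 'rV[R]_d) + a : Rd R d).
Proof.
split; first exact: measurable_shift_fun.
by move=> X _; exact: (lebesgue_outer_shift d0 X a).
Qed.

End boxes_volume.

(** * The space L^2 *)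

Section L2.
Context {dT : measure_display} {T : measurableType dT} {R : realType}.
Variable mu : {measure set T -> \bar R}.
Implicit Types f g : T -> R[i].

Definition sqL2 f : \bar R := (\int[mu]_x (cmodulus (f x) ^+ 2)%:E)%E.
Definition cL2 : set (T -> R[i]) := [set f | cmeas f /\ (sqL2 f < +oo)%E].
Definition L2ip f g : R[i] := cint mu (fun x => f x * conjc (g x)).
Local Notation q := (sqn L2ip).

Lemma sqL2_ge0 f : (0 <= sqL2 f)%E.
Proof. by apply: integral_ge0 => x _; rewrite lee_fin sqr_ge0. Qed.

Lemma cL2_sqr_integrable f : cL2 f -> integrableR mu (fun x => cmodulus (f x) ^+ 2).
Proof.
move=> [mf foo]; apply/integrableP; split.
  by apply/measurable_EFinP; exact: measurable_sqr_cmodulus.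
by under eq_integral do rewrite gee0_abs ?lee_fin ?sqr_ge0//.
Qed.

Lemma cL2_le f (g : T -> R) : cmeas f -> integrableR mu g ->
  (forall x, cmodulus (f x) ^+ 2 <= g x) -> cL2 f.
Proof.
move=> mf /integrableP[mg goo] fg; split => //.
apply: le_lt_trans goo; apply: ge0_le_integral => //.
- by move=> x _; rewrite lee_fin sqr_ge0.
- by apply/measurable_EFinP; exact: measurable_sqr_cmodulus.
- exact: measurableT_comp.
- by move=> x _ /=; rewrite lee_fin (le_trans (fg x))// ler_norm.
Qed.

Lemma integrableR_D (g h : T -> R) : integrableR mu g -> integrableR mu h ->
  integrableR mu (fun x => g x + h x).
Proof. by move=> ig ih; exact: (integrableD measurableT ig ih). Qed.

Lemma integrableR_Z (c : R) (g : T -> R) : integrableR mu g ->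
  integrableR mu (fun x => c * g x).
Proof. by move=> ig; exact: (integrableZl measurableT c ig). Qed.

Lemma cL2_mul f g : cL2 f -> cL2 g -> cL1 mu (fun x => f x * g x).
Proof.
move=> L2f L2g; apply: (@cL1_le _ _ _ _ _ (fun x => cmodulus (f x) ^+ 2 + cmodulus (g x) ^+ 2)).
- by apply: cmeasM; [case: L2f|case: L2g].
- by apply: integrableR_D; exact: cL2_sqr_integrable.
- by move=> x; exact: cmodulusM_le.
Qed.

Lemma cL2J f : cL2 f -> cL2 (fun x => conjc (f x)).
Proof.
move=> [mf foo]; split; first exact: cmeasJ.
by rewrite /sqL2; under eq_integral do rewrite cmodulusJ.
Qed.

Lemma cL2_ip f g : cL2 f -> cL2 g -> cL1 mu (fun x => f x * conjc (g x)).
Proof. by move=> L2f L2g; apply: cL2_mul => //; exact: cL2J. Qed.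

Lemma cL2D f g : cL2 f -> cL2 g -> cL2 (f + g).
Proof.
move=> L2f L2g; apply: (@cL2_le _ (fun x => 2 * cmodulus (f x) ^+ 2 + 2 * cmodulus (g x) ^+ 2)).
- by apply: cmeasD; [case: L2f|case: L2g].
- by apply: integrableR_D; apply: integrableR_Z; exact: cL2_sqr_integrable.
- by move=> x; exact: sqr_cmodulusD_le.
Qed.

Lemma cL2_bounded f g (K : R) : cmeas g -> cL2 f -> (forall x, cmodulus (g x) <= K) ->
  cL2 (fun x => g x * f x).
Proof.
move=> mg L2f gK; apply: (@cL2_le _ (fun x => K ^+ 2 * cmodulus (f x) ^+ 2)).
- by apply: cmeasM => //; case: L2f.
- by apply: integrableR_Z; exact: cL2_sqr_integrable.
- move=> x; rewrite cmodulusM exprMn ler_wpM2r ?sqr_ge0//.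
  by rewrite ler_pXn2r ?nnegrE ?cmodulus_ge0// (le_trans (cmodulus_ge0 _) (gK x)).
Qed.

Lemma cL2Z (a : R[i]) f : cL2 f -> cL2 (a *: f).
Proof.
by move=> L2f; apply: (@cL2_bounded f (fun=> a) (cmodulus a)) => //; exact: cmeas_cst.
Qed.

Lemma cL2_0 : cL2 0.
Proof.
split; first exact: cmeas_cst.
by rewrite /sqL2; under eq_integral do rewrite cmodulus0 expr0n; rewrite integral0 ltry.
Qed.

Lemma sqnL2 f : q f = \int[mu]_x (cmodulus (f x) ^+ 2).
Proof. by rewrite /sqn /L2ip /=; apply: eq_Rintegral => x _; rewrite mulcJ. Qed.

Lemma sqL2E f : cL2 f -> sqL2 f = (q f)%:E.
Proof.
move=> L2f; rewrite sqnL2 /Rintegral fineK//.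
by case: L2f => _ foo; rewrite ge0_fin_numE//; exact: sqL2_ge0.
Qed.

Lemma L2_semi_ip : semi_ip cL2 L2ip.
Proof.
split.
- exact: cL2D.
- by move=> a f; exact: cL2Z.
- move=> f g h L2f L2g L2h; rewrite /L2ip -cintD; [|exact: cL2_ip..].
  by congr cint; apply/funext => x; rewrite mulrDl.
- move=> a f g L2f L2g; rewrite /L2ip -cintZ; last exact: cL2_ip.
  by congr cint; apply/funext => x; rewrite mulrA.
- move=> f g L2f L2g; rewrite /L2ip -cintJ; last exact: cL2_ip.
  by congr cint; apply/funext => x; rewrite conjcM conjcK mulrC.
- by move=> f L2f; rewrite -/(sqn _ f) sqnL2; apply: Rintegral_ge0 => x _; exact: sqr_ge0.
Qed.

Lemma sqn_ae_eq0 f : cL2 f -> q f = 0 -> {ae mu, forall x, f x = 0}.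
Proof.
move=> L2f qf0.
have := sqL2E L2f; rewrite qf0 /sqL2 => h.
have mf2 : measurable_fun setT (fun x => (cmodulus (f x) ^+ 2)%:E).
  by apply/measurable_EFinP; apply: measurable_sqr_cmodulus; case: L2f.
have := (ae_eq_integral_abs mu measurableT mf2).1.
have -> : (\int[mu]_x `|(cmodulus (f x) ^+ 2)%:E|)%E = 0%E.
  by under eq_integral do rewrite gee0_abs ?lee_fin ?sqr_ge0//.
move=> /(_ erefl); apply: filterS => x /(_ I) [] /eqP.
by rewrite sqrf_eq0 cmodulus_eq0 => /eqP.
Qed.

Lemma ae_eq0_sqn f : {ae mu, forall x, f x = 0} -> cmeas f -> cL2 f /\ q f = 0.
Proof.
move=> f0 mf; have E : sqL2 f = 0%E.
  rewrite /sqL2 (ae_eq_integral (cst 0%E))//; first by rewrite integral0.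
    by apply/measurable_EFinP; exact: measurable_sqr_cmodulus.
  by apply: filterS f0 => x -> _; rewrite cmodulus0 expr0n.
have L2f : cL2 f by split => //; rewrite E ltry.
by split => //; have [] := etrans (esym (sqL2E L2f)) E.
Qed.

Lemma ae_eq_cL2 f g : {ae mu, forall x, f x = g x} -> cmeas f -> cL2 g ->
  cL2 f /\ q (f - g) = 0.
Proof.
move=> fg mf L2g.
have [L2fg q0] : cL2 (f - g) /\ q (f - g) = 0.
  apply: ae_eq0_sqn; last by apply: cmeasB => //; case: L2g.
  by apply: filterS fg => x e; rewrite /GRing.add/= /GRing.opp/= e subrr.
split => //; rewrite -(subrK g f); exact: cL2D.
Qed.

Lemma sqn_ae_eq f g : cL2 f -> cL2 g -> q (f - g) = 0 -> {ae mu, forall x, f x = g x}.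
Proof.
move=> L2f L2g q0.
have := sqn_ae_eq0 (sipHB L2_semi_ip L2f L2g) q0.
by apply: filterS => x /eqP; rewrite /GRing.add/= /GRing.opp/= subr_eq0 => /eqP.
Qed.

Lemma cvg_sqL2 (u : nat -> T -> R[i]) f : (forall n, cL2 (u n)) -> cL2 f ->
  ((fun n => sqL2 (u n - f)) @ \oo --> 0%E <-> (fun n => q (u n - f)) @ \oo --> (0 : R)).
Proof.
move=> L2u L2f.
have E n : sqL2 (u n - f) = (q (u n - f))%:E by rewrite sqL2E//; exact: (sipHB L2_semi_ip).
have -> : (fun n => sqL2 (u n - f)) = (fun n => (q (u n - f))%:E) by apply/funext => n.
split => [/fine_cvgP[]//|h]; apply: cvg_EFin => //; exact: nearW.
Qed.

End L2.

Lemma cvg_of_geometric_increments (R : realType) (u : nat -> R) (C : R) : 0 <= C ->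
  (forall k, `|u k.+1 - u k| <= C * 2^-1 ^+ k) -> cvgn u.
Proof.
move=> C0 uC.
have -> : u = (fun n => u 0%N + series (fun k => u k.+1 - u k) n).
  apply/funext => n; rewrite /series/=.
  by have := telescope_sumr u (leq0n n) => ->; rewrite subrKC.
apply: is_cvgD; first exact: is_cvg_cst.
apply: normed_cvg; apply: (@series_le_cvg _ _ (geometric C 2^-1)).
- by move=> n; exact: normr_ge0.
- by move=> n; rewrite /geometric/= mulr_ge0// exprn_ge0.
- by move=> n; exact: uC.
- by apply: is_cvg_geometric_series; rewrite ger0_norm// invf_lt1// ltr1n.
Qed.

Lemma indicC1 (R : realType) (T : Type) (E : set T) x : E x ->
  ((\1_E x : R)%:C)%C = 1 :> R[i].
Proof. by move=> Ex; rewrite indicE mem_set. Qed.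

Lemma indicC0 (R : realType) (T : Type) (E : set T) x : ~ E x ->
  ((\1_E x : R)%:C)%C = 0 :> R[i].
Proof. by move=> Ex; rewrite indicE memNset. Qed.

Section L2_complete.
Context {dT : measure_display} {T : measurableType dT} {R : realType}.
Variable mu : {measure set T -> \bar R}.
Local Notation q := (sqn (L2ip mu)).
Let sip := @L2_semi_ip _ _ _ mu.

Lemma L2_complete_subseq (g : nat -> T -> R[i]) : (forall k, cL2 mu (g k)) ->
  (forall k m, (k <= m)%N -> q (g m - g k) <= 8^-1 ^+ k) ->
  exists2 f, cL2 mu f & forall k, q (f - g k) <= 8^-1 ^+ k.
Proof.
move=> L2g qg.
have L2B k m : cL2 mu (g m - g k) by exact: (sipHB sip).
(* The weight $4^k$ splits the rate $8^{-k}$ in two. The integrals of [D k] are at most $2^{-k}$,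
   hence summable, and finiteness of the sum $S$ at $x$ still gives
   $|g_{k+1}-g_k|\le\sqrt{S}\,2^{-k}$ there. *)
pose D k x := (4 ^+ k * cmodulus (g k.+1 x - g k x) ^+ 2)%:E.
have mD k : measurable_fun setT (D k).
  apply/measurable_EFinP; apply: measurable_funM; first exact: measurable_cst.
  apply: measurable_sqr_cmodulus; apply: cmeasB; first by case: (L2g k.+1).
  by case: (L2g k).
have D0 k x : (0 <= D k x)%E by rewrite lee_fin mulr_ge0 ?sqr_ge0// exprn_ge0.
pose S x := (\sum_(k <oo) D k x)%E.
have mS : measurable_fun setT S.
  by apply: ge0_emeasurable_sum => // k x _ _; exact: D0.
have S0 x : (0 <= S x)%E by apply: nneseries_ge0 => k _ _; exact: D0.
have intD k : (\int[mu]_x D k x <= (2^-1 ^+ k)%:E)%E.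
  under eq_integral do rewrite /D EFinM.
  have mk : measurable_fun setT (fun x => (cmodulus (g k.+1 x - g k x) ^+ 2)%:E).
    by apply/measurable_EFinP; apply: measurable_sqr_cmodulus; exact: (L2B k k.+1).1.
  have -> : (\int[mu]_x ((4 ^+ k)%:E * (cmodulus (g k.+1 x - g k x) ^+ 2)%:E) =
      (4 ^+ k)%:E * sqL2 mu (g k.+1 - g k)%R)%E.
    by apply: ge0_integralZl => // x _; rewrite lee_fin sqr_ge0.
  rewrite sqL2E// -EFinM lee_fin.
  rewrite (le_trans (ler_wpM2l _ (qg k k.+1 (leqnSn k))))// ?exprn_ge0//.
  by rewrite -exprMn (_ : 4 / 8 = 2^-1)//; lra.
have intS : (\int[mu]_x S x < +oo)%E.
  rewrite integral_nneseries//.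
  apply: (@le_lt_trans _ _ (\sum_(k <oo) (2^-1 ^+ k)%:E)%E).
    by apply: lee_nneseries => k _; [move=> _; apply: integral_ge0|exact: intD].
  have := @epsilon_trick0 R 2 predT (ltW (ltr0Sn R 1)).
  under eq_eseriesr do rewrite expnS natrM invfM mulVKf ?pnatr_eq0// natrX -exprVn.
  by move=> /le_lt_trans; apply; rewrite ltry.
pose E : set T := [set x | (S x < +oo)%E].
have mE : measurable E by rewrite -[E]setTI; exact: emeasurable_fun_infty_o.
have aeE : {ae mu, forall x, E x}.
  have /integrable_ae : mu.-integrable setT S.
    by apply/integrableP; split => //; under eq_integral do rewrite gee0_abs//.
  move=> /(_ measurableT); apply: filterS => x /(_ I).
  by rewrite ge0_fin_numE.
(* Setting the sequence to 0 off [E] makes it converge at every point, so the limit is measurable as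
   it stands and needs no correction on a null set. *)
pose h k x := ((\1_E x : R)%:C)%C * g k x.
have mh k : cmeas (h k).
  apply: cmeasM; last by case: (L2g k).
  by apply: cmeasR; exact: measurable_indic.
have inc x : exists2 C : R, 0 <= C &
    forall k, cmodulus (h k.+1 x - h k x) <= C * 2^-1 ^+ k.
  have [xE|xE] := pselect (E x); last first.
    exists 0 => // k; by rewrite /h indicC0// !mul0r subrr cmodulus0.
  exists (Num.sqrt (fine (S x))); first exact: sqrtr_ge0.
  move=> k; rewrite /h indicC1// !mul1r.
  rewrite -(@ler_pXn2r _ 2)// ?nnegrE ?cmodulus_ge0 ?mulr_ge0 ?sqrtr_ge0 ?exprn_ge0//.
  rewrite exprMn (sqr_sqrtr (fine_ge0 (S0 x))).
  have Sfin : S x \is a fin_num by rewrite ge0_fin_numE.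
  rewrite -lee_fin [leRHS]EFinM (fineK Sfin).
  have : (D k x <= S x)%E.
    rewrite /S; have := @nneseries_lim_ge _ (fun k => D k x) predT 0%N k.+1 (fun m _ _ => D0 m x).
    by apply: le_trans; rewrite big_nat_recr//= leeDr// sume_ge0.
  rewrite /D => Dk.
  have -> : (cmodulus (g k.+1 x - g k x) ^+ 2)%:E =
     ((4 ^+ k * cmodulus (g k.+1 x - g k x) ^+ 2)%:E * ((2^-1 ^+ k) ^+ 2)%:E)%E.
    rewrite -EFinM; congr EFin.
    rewrite mulrAC -exprM mulnC exprM -exprMn.
    rewrite (_ : 4 * 2^-1 ^+ 2 = 1) ?expr1n ?mul1r//.
    by rewrite expr2; lra.
  by apply: lee_wpmul2r => //; rewrite lee_fin sqr_ge0.
have cvRe x : cvgn (fun k => complex.Re (h k x)).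
  have [C C0 hC] := inc x; apply: (cvg_of_geometric_increments C0) => k.
  by rewrite (le_trans _ (hC k))// (le_trans _ (Re_le_cmodulus _))// !ReIm.
have cvIm x : cvgn (fun k => complex.Im (h k x)).
  have [C C0 hC] := inc x; apply: (cvg_of_geometric_increments C0) => k.
  by rewrite (le_trans _ (hC k))// (le_trans _ (Im_le_cmodulus _))// !ReIm.
pose f x := Complex (limn (fun k => complex.Re (h k x))) (limn (fun k => complex.Im (h k x))).
have mf : cmeas f.
  split; [apply: (measurable_fun_cvg (h := fun k x => complex.Re (h k x)))|
          apply: (measurable_fun_cvg (h := fun k x => complex.Im (h k x)))] => //.
  - by move=> k; exact: (mh k).1.
  - by move=> k; exact: (mh k).2.
have hf x k : (fun m => (cmodulus (h m x - g k x) ^+ 2)%:E) @ \oo --> (cmodulus (f x - g k x) ^+ 2)%:E.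
  apply: cvg_EFin; first exact: nearW.
  rewrite /comp sqr_cmodulus ReD ReN ImD ImN.
  under eq_fun do rewrite sqr_cmodulus ReD ReN ImD ImN.
  by apply: cvgD; apply: cvgM; apply: cvgB; (try exact: cvg_cst); [exact: cvRe|exact: cvRe|exact: cvIm|exact: cvIm].
have qf k : (sqL2 mu (fun x => f x - g k x)%R <= (8^-1 ^+ k)%:E)%E.
  have mF m : measurable_fun setT (fun x => (cmodulus (h m x - g k x) ^+ 2)%:E).
    apply/measurable_EFinP; apply: measurable_sqr_cmodulus; apply: cmeasB => //.
    by case: (L2g k).
  (* Fatou's lemma bounds the distance from [f] to [g k] by the lower limit of the distances from
     [g m] to [g k]; in the integrals [h m] may be replaced by [g m], as [E] has full measure. *)
  have := @fatou _ _ _ mu setT measurableT (fun m x => (cmodulus (h m x - g k x) ^+ 2)%:E) mF.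
  rewrite (_ : (\int[mu]_x limn_einf _)%E = sqL2 mu (fun x => f x - g k x)%R); last first.
    apply: eq_integral => x _; rewrite is_cvg_limn_einfE; last by apply/cvg_ex; eexists; exact: hf.
    exact/cvg_lim.
  move=> /(_ _)/le_trans; apply; first by move=> m x _; rewrite lee_fin sqr_ge0.
  rewrite limn_einf_lim; apply: lime_le; first exact: is_cvg_einfs.
  apply: nearW => n; pose m := maxn n k; have km : (k <= m)%N by exact: leq_maxr.
  apply: (@le_trans _ _ (\int[mu]_x (cmodulus (h m x - g k x) ^+ 2)%:E)%E).
    by apply: ereal_inf_lbound; exists m => //; exact: leq_maxl.
  rewrite (_ : (\int[mu]_x _)%E = sqL2 mu (g m - g k)); last first.
    apply: ae_eq_integral => //; first by apply/measurable_EFinP; apply: measurable_sqr_cmodulus; exact: (L2B k m).1.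
    apply: filterS aeE => x Ex _; by rewrite /h indicC1// mul1r.
  by rewrite sqL2E// lee_fin; exact: qg.
have L2fg k : cL2 mu (f - g k).
  split; first by apply: cmeasB => //; case: (L2g k).
  by rewrite (le_lt_trans (qf k))// ltry.
exists f; first by rewrite -(subrK (g 0%N) f); exact: cL2D.
by move=> k; rewrite -lee_fin -sqL2E//; exact: qf.
Qed.

Lemma L2_complete (u : nat -> T -> R[i]) : (forall n, cL2 mu (u n)) ->
  (forall e, 0 < e -> exists N, forall m n, (N <= m)%N -> (N <= n)%N -> q (u m - u n) <= e) ->
  exists2 f, cL2 mu f & (fun n => q (u n - f)) @ \oo --> (0 : R).
Proof.
move=> L2u cu.
have /choice[N NP] k : exists N, forall m n, (N <= m)%N -> (N <= n)%N -> q (u m - u n) <= 8^-1 ^+ k.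
  by apply: cu; rewrite exprn_gt0// invr_gt0.
(* Partial sums dominate every earlier [N k], so [N] itself need not be monotone. *)
pose phi k := (\sum_(0 <= j < k.+1) N j)%N.
have phiN k m : (k <= m)%N -> (N k <= phi m)%N.
  move=> km; rewrite /phi (big_cat_nat (n := k.+1))//= big_nat_recr//= -addnA addnCA.
  exact: leq_addr.
have [|k m km|f L2f qf] := @L2_complete_subseq (fun k => u (phi k)).
- by move=> k.
- by apply: NP; exact: phiN.
exists f => //; apply/cvgrPdist_le => e e0.
have e4 : 0 < e / 4 by rewrite divr_gt0.
have [k ke] : exists k, (8^-1 ^+ k : R) <= e / 4.
  have : (fun k => 8^-1 ^+ k : R) @ \oo --> (0 : R).
    by apply: cvg_expr; rewrite ger0_norm// invf_lt1// ltr1n.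
  move=> /cvgrPdist_le/(_ _ e4)[k _ /(_ k (leqnn k))/=].
  by rewrite sub0r normrN ger0_norm ?exprn_ge0// => ?; exists k.
exists (N k) => // n /= Nn.
rewrite sub0r normrN ger0_norm; last by apply: (sip_ge0 sip); exact: (sipHB sip).
rewrite (le_trans (sqn_triangle sip (L2u n) (L2u (phi k)) L2f))//.
have h1 : q (u n - u (phi k)) <= 8^-1 ^+ k by apply: NP => //; exact: phiN.
have h2 := qf k; rewrite (sqnBC sip L2f (L2u _)) in h2.
lra.
Qed.

End L2_complete.

(** * The unit circle *)

Section unit_circle.
Variable R : realType.
Implicit Types s t x : R.

Lemma expNiD s t : expNi (s + t) = expNi s * expNi t.
Proof. by apply: complex_ext; rewrite ?ReM ?ImM /= ?cosD ?sinD; ring. Qed.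

Lemma expNi0 : expNi (0 : R) = 1.
Proof. by apply: complex_ext => /=; rewrite ?cos0 ?sin0 ?oppr0. Qed.

Lemma expNiN t : expNi (- t) = conjc (expNi t).
Proof. by apply: complex_ext => /=; rewrite ?cosN ?sinN. Qed.

Lemma cmodulus_expNi t : cmodulus (expNi t) = 1.
Proof. by rewrite /cmodulus /= sqrrN cos2Dsin2 sqrtr1. Qed.

Lemma expNi_pi : expNi (pi : R) = -1.
Proof. by apply: complex_ext => /=; rewrite ?cospi ?sinpi. Qed.

Lemma expNi_2pi : expNi (2 * pi : R) = 1.
Proof. by rewrite mulr_natl mulr2n expNiD expNi_pi mulrNN mulr1. Qed.

Lemma expNiX t n : expNi (t * n%:R) = expNi t ^+ n.
Proof.
elim: n => [|n ih]; first by rewrite mulr0 expNi0.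
by rewrite exprS -ih -natr1 mulrDr mulr1 addrC expNiD.
Qed.

Lemma expNi_2piz (z : int) : expNi (2 * pi * z%:~R : R) = 1.
Proof.
case: z => n; first by rewrite expNiX expNi_2pi expr1n.
rewrite NegzE mulrNz mulrN expNiN expNiX expNi_2pi expr1n.
by apply: complex_ext => //=; rewrite oppr0.
Qed.

Lemma cmodulus_1B_expNi t : cmodulus (1 - expNi t) = 2 * `|sin (t / 2)|.
Proof.
apply: (@pexpIrn _ 2) => //; rewrite ?nnegrE ?cmodulus_ge0 ?mulr_ge0//.
rewrite [RHS]exprMn real_normK ?num_real//.
rewrite sqr_cmodulus (_ : complex.Re _ = 1 - cos t)// (_ : complex.Im _ = sin t); last first.
  by rewrite ImD ImN /= opprK add0r.
have ct : cos t = cos (t / 2) ^+ 2 *+ 2 - 1.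
  by rewrite -cos_mulr2n -(mulr_natr (t / 2)) divfK ?pnatr_eq0.
rewrite !sin2cos2 ct; ring.
Qed.

Lemma sin_le_id x : `|sin x| <= `|x|.
Proof.
wlog x0 : x / 0 <= x => [h|].
  by have [/h//|/ltW x0] := leP 0 x; rewrite -normrN -sinN -[leRHS]normrN h// oppr_ge0.
have [|x' _] := @MVT_segment R sin cos 0 x x0 (fun y _ => is_derive_sin y).
  by apply: continuous_subspaceT => y; exact: continuous_sin.
by rewrite sin0 !subr0 => ->; rewrite normrM ler_piMl// cos_max.
Qed.

(** Any positive slope would do. On $[0,1]$ the mean value theorem gives $\sin y\ge y\cos 1$, and on
    $[1,\pi/2]$ one has $\sin x\ge\sin 1\ge\cos 1\ge x\cos(1)/2$ since $x<2$. *)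
Definition sine_slope : R := cos 1 / 2.

Lemma sine_slope_gt0 : 0 < sine_slope.
Proof. by rewrite divr_gt0// cos1_gt0. Qed.

Lemma sin_ge_slope x : `|x| <= pi / 2 -> sine_slope * `|x| <= `|sin x|.
Proof.
have pi2 := @pihalf_lt2 R; have pi1 := @pihalf_ge1 R; have c1 := @cos1_gt0 R.
wlog x0 : x / 0 <= x => [h|].
  have [/h//|/ltW x0] := leP 0 x.
  by have := h (- x); rewrite oppr_ge0 sinN !normrN; apply.
rewrite ger0_norm// /sine_slope => xpi.
have small (y : R) : 0 <= y -> y <= 1 -> cos 1 * y <= sin y.
  move=> y0 y1.
  have [|c cy] := @MVT_segment R sin cos 0 y y0 (fun y _ => is_derive_sin y).
    by apply: continuous_subspaceT => z; exact: continuous_sin.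
  rewrite sin0 !subr0 => ->; rewrite ler_wpM2r//.
  move: cy; rewrite in_itv/= => /andP[c0 cy].
  have c1' := le_trans cy y1.
  have [->//|cn1] := eqVneq c 1.
  by rewrite ltW// ltr_cos ?in_itv/= ?ler01 ?c0 ?lt_neqAle ?cn1//=; lra.
have [x1|x1] := leP x 1.
  by rewrite (le_trans _ (ler_norm _))// (le_trans _ (small _ x0 x1))//; nra.
rewrite (le_trans _ (ler_norm _))//.
have s1 : cos 1 <= sin 1 :> R by have := small 1 ler01 (lexx _); rewrite mulr1.
have : sin 1 < sin x by rewrite ltr_sin ?in_itv//=; apply/andP; split; lra.
nra.
Qed.

Lemma cmodulus_1B_expNi_le t : cmodulus (1 - expNi t) <= `|t|.
Proof.
rewrite cmodulus_1B_expNi; have := sin_le_id (t / 2).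
by rewrite normrM (ger0_norm (_ : 0 <= 2^-1))//; lra.
Qed.

Lemma cmodulus_expNiB_le s t : cmodulus (expNi s - expNi t) <= `|s - t|.
Proof.
rewrite -[s in expNi s](subrK t) expNiD -{2}(mul1r (expNi t)) -mulrBl.
by rewrite cmodulusM cmodulus_expNi mulr1 cmodulusB cmodulus_1B_expNi_le.
Qed.

Lemma cmodulus_1B_expNi_ge t : `|t| <= pi ->
  sine_slope * `|t| <= cmodulus (1 - expNi t).
Proof.
move=> tpi; rewrite cmodulus_1B_expNi; have := @sin_ge_slope (t / 2).
by rewrite normrM (ger0_norm (_ : 0 <= 2^-1))//; lra.
Qed.

End unit_circle.

(** * Grid sums and Parseval on period cubes *)

Lemma indicCE (R : realType) (T : Type) (E : set T) x :
  (\1_E x : R[i]) = ((\1_E x : R)%:C)%C.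
Proof. by rewrite !indicE; case: (x \in E). Qed.

Section bounded_support.
Context {dT : measure_display} {T : measurableType dT} {R : realType}.
Variable mu : {measure set T -> \bar R}.
Implicit Types (f : T -> R[i]) (E : set T).

Lemma cmeas_indic E : measurable E -> cmeas (\1_E : T -> R[i]).
Proof.
move=> mE; rewrite (_ : \1_E = fun x => ((\1_E x : R)%:C)%C); last first.
  by apply/funext => x; exact: indicCE.
by apply: cmeasR; exact: measurable_indic.
Qed.

Lemma integrableR_indic E (K : R) : measurable E -> (mu E < +oo)%E ->
  integrableR mu (fun x => K * \1_E x).
Proof.
move=> mE Eoo; apply: integrableR_Z; apply/integrableP; split.
  by apply/measurable_EFinP; exact: measurable_indic.
under eq_integral do rewrite gee0_abs ?lee_fin//.
by rewrite integral_indic// setIT.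
Qed.

Lemma cL1_bounded_support f E (K : R) : measurable E -> (mu E < +oo)%E -> cmeas f ->
  (forall x, cmodulus (f x) <= K * \1_E x) -> cL1 mu f.
Proof. by move=> mE Eoo mf fK; apply: (cL1_le mf _ fK); exact: integrableR_indic. Qed.

Lemma cL2_bounded_support f E (K : R) : measurable E -> (mu E < +oo)%E -> cmeas f ->
  (forall x, cmodulus (f x) <= K * \1_E x) -> cL2 mu f.
Proof.
move=> mE Eoo mf fK; apply: (cL2_le (g := fun x => K ^+ 2 * \1_E x) mf).
  exact: integrableR_indic.
move=> x; have := fK x; rewrite indicE; case: (x \in E) => /=.
  rewrite !mulr1 => h; rewrite ler_pXn2r ?nnegrE ?cmodulus_ge0//.
  exact: le_trans (cmodulus_ge0 _) h.
rewrite !mulr0 => h; rewrite (_ : cmodulus (f x) = 0) ?expr0n//.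
by apply/eqP; rewrite eq_le h cmodulus_ge0.
Qed.

Lemma cL1_indicM E (c : R[i]) : measurable E -> (mu E < +oo)%E ->
  cL1 mu (fun x => \1_E x * c).
Proof.
move=> mE Eoo; apply: (@cL1_bounded_support _ E (cmodulus c)) => //.
  by apply: cmeasM; [exact: cmeas_indic|exact: cmeas_cst].
by move=> x; rewrite cmodulusM mulrC indicCE cmodulusR ger0_norm.
Qed.

Lemma cint_indic E (c : R[i]) : measurable E -> (mu E < +oo)%E ->
  cint mu (fun x => \1_E x * c) = c * ((fine (mu E))%:C)%C.
Proof.
move=> mE Eoo.
under eq_fun do rewrite mulrC.
rewrite cintZ; last first.
  apply: (@cL1_bounded_support _ E 1) => //; first exact: cmeas_indic.
  by move=> x; rewrite mul1r indicCE cmodulusR ger0_norm.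
congr (_ * _); apply: complex_ext => /=.
  under eq_Rintegral do rewrite indicCE /=.
  by rewrite /Rintegral integral_indic// setIT.
under eq_Rintegral do rewrite indicCE /=.
by rewrite Rintegral_cst// mul0r.
Qed.

End bounded_support.

Section grid.
Context {R : realType} {d : nat}.
Hypothesis d0 : (0 < d)%N.
Local Notation mu := (lebesgue_Rd R d).
Implicit Types (x y xi : 'rV[R]_d) (n M : nat).

Definition ei (i : 'I_d) (s : R) : 'rV[R]_d := s *: delta_mx ord0 i.

Lemma eiE i s j : ei i s ord0 j = if j == i then s else 0.
Proof. by rewrite !mxE eqxx/=; case: eqP => _; rewrite ?mulr1 ?mulr0. Qed.

Definition grid n x : 'rV[R]_d :=
  \row_i ((Num.floor (n%:R * x ord0 i))%:~R / n%:R).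

Lemma grid_dist n x i : (0 < n)%N -> `|x ord0 i - grid n x ord0 i| <= n%:R^-1.
Proof.
move=> n0; rewrite mxE; have n0R : 0 < n%:R :> R by rewrite ltr0n.
have h1 := floor_le_tmp (n%:R * x ord0 i).
have h2 := floorD1_gt (n%:R * x ord0 i).
move: h1 h2; rewrite rmorphD/=; set F := (Num.floor _)%:~R => h1 h2.
have -> : x ord0 i - F / n%:R = (n%:R * x ord0 i - F) / n%:R by field; rewrite gt_eqF.
rewrite normrM normfV (gtr0_norm n0R) -[leRHS]mul1r ler_pM2r ?invr_gt0//.
by rewrite ger0_norm; lra.
Qed.

Lemma grid_shift n x i : (0 < n)%N ->
  grid n (x + ei i n%:R^-1) = grid n x + ei i n%:R^-1.
Proof.
move=> n0; have n0R : n%:R != 0 :> R by rewrite pnatr_eq0 -lt0n.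
apply/rowP => j; rewrite mxE [RHS]mxE [in RHS]mxE eiE [in LHS]mxE eiE.
case: eqP => _; last by rewrite !addr0.
rewrite mulrDr mulfV// floorDrz ?rpred1// rmorphD/= floor1 mulrDl mul1r//.
Qed.

(** The nodes of the lattice of mesh $1/n$ in $[-M,M)^d$; there are $2Mn$ of them in each direction,
    counted from the corner $-M$. *)
Definition pt n M (k : {ffun 'I_d -> 'I_(2 * M * n)}) : 'rV[R]_d :=
  \row_i ((k i : nat)%:R / n%:R - M%:R).

Definition cell n M (k : {ffun 'I_d -> 'I_(2 * M * n)}) : set 'rV[R]_d :=
  obox (pt k) (pt k + const_mx n%:R^-1).

Lemma cellP n M (k : {ffun 'I_d -> 'I_(2 * M * n)}) x : (0 < n)%N ->
  cell k x <-> grid n x = pt k.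
Proof.
move=> n0; have n0R : 0 < n%:R :> R by rewrite ltr0n.
have E i : (pt k ord0 i <= x ord0 i < (pt k + const_mx n%:R^-1) ord0 i) =
    (((k i : nat)%:Z - (M * n)%:Z)%:~R <= n%:R * x ord0 i
      < ((k i : nat)%:Z - (M * n)%:Z + 1)%:~R).
  have zE : ((k i : nat)%:Z - (M * n)%:Z)%:~R = n%:R * pt k ord0 i :> R.
    by rewrite rmorphB/= -!pmulrn natrM mxE mulrBr [n%:R * (_ / _)]mulrC divfK ?gt_eqF// (mulrC M%:R).
  have zE1 : ((k i : nat)%:Z - (M * n)%:Z + 1)%:~R = n%:R * pt k ord0 i + 1 :> R.
    by rewrite intrD zE.
  rewrite zE zE1 ler_pM2l//; congr (_ && _).
  rewrite -(ltr_pM2l n0R) 2!mxE mulrDr; congr (_ < _ + _).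
  by rewrite mxE mulfV ?gt_eqF.
split => [xk|/rowP xk i].
  apply/rowP => i; have := xk i; rewrite E => /floor_def fE; rewrite !mxE fE.
  by rewrite rmorphB/= -!pmulrn natrM mulrBl mulfK// gt_eqF.
rewrite E; have := xk i; rewrite !mxE.
move=> /(congr1 (fun z => z * n%:R)); rewrite mulrBl !mulfVK ?gt_eqF// => h.
have fE : Num.floor (n%:R * x ord0 i) = (k i : nat)%:Z - (M * n)%:Z.
  by apply: (@intr_inj R); rewrite h rmorphB/= -!pmulrn natrM.
by rewrite -fE floor_itv.
Qed.

Lemma pt_inj n M : (0 < n)%N -> injective (@pt n M).
Proof.
move=> n0 k l /rowP kl; apply/ffunP => i; have := kl i; rewrite !mxE.
have n0R : n%:R != 0 :> R by rewrite pnatr_eq0 -lt0n.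
move=> /addIr /(mulIf (invr_neq0 n0R)) /eqP.
by rewrite eqr_nat => /eqP/val_inj.
Qed.

Lemma lebesgue_cell n M (k : {ffun 'I_d -> 'I_(2 * M * n)}) : (0 < n)%N ->
  mu (cell k) = (n%:R^-1 ^+ d)%:E.
Proof.
move=> n0; rewrite lebesgue_obox//; congr EFin.
rewrite (eq_bigr (fun=> n%:R^-1)) ?prodr_const ?card_ord// => i _.
by rewrite !mxE addrAC subrr add0r max_r// invr_ge0.
Qed.

(** The strict bound excludes nodes with a coordinate equal to $M$, which [pt] does not
    enumerate. *)
Definition supported M (G : 'rV[R]_d -> R[i]) :=
  forall x, G x != 0 -> forall i, `|x ord0 i| < M%:R.

Lemma grid_sum n M (G : 'rV[R]_d -> R[i]) x : (0 < n)%N -> supported M G ->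
  G (grid n x) = \sum_(k : {ffun 'I_d -> 'I_(2 * M * n)}) \1_(cell k) x * G (pt k).
Proof.
move=> n0 sG; have n0R : 0 < n%:R :> R by rewrite ltr0n.
have [[k xk]|nk] := pselect (exists k : {ffun 'I_d -> 'I_(2 * M * n)}, grid n x = pt k).
  rewrite (bigD1 k)//= big1 => [|l lk].
    by rewrite indicE mem_set ?mul1r ?addr0 ?xk//; apply/cellP.
  rewrite indicE memNset ?mul0r// => /(cellP _ _ n0).
  by rewrite xk => /(pt_inj n0) kl; rewrite kl eqxx in lk.
rewrite big1 => [|l _]; last first.
  rewrite indicE memNset ?mul0r// => /(cellP _ _ n0) h; apply: nk; by exists l.
apply: contrapT => /eqP G0; apply: nk.
pose z i := Num.floor (n%:R * x ord0 i) + (M * n)%:Z.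
have zb i : (0 <= z i) && (z i < (2 * M * n)%:Z).
  have := sG _ G0 i; rewrite mxE ltr_norml.
  rewrite ltr_pdivrMr// ltr_pdivlMr// mulNr -!natrM => /andP[].
  rewrite /z; set F := Num.floor _ => h1 h2.
  have {}h1 : - (M * n)%:Z < F by rewrite -(ltr_int R) rmorphN/= -pmulrn.
  have {}h2 : F < (M * n)%:Z by rewrite -(ltr_int R) -pmulrn.
  have -> : (2 * M * n)%:Z = (M * n)%:Z + (M * n)%:Z by rewrite -PoszD -mulnA mul2n addnn.
  by rewrite ltrD2r h2 -(lerBlDr) sub0r ltW.
have kz i : (`|z i|%N < 2 * M * n)%N.
  by case/andP: (zb i) => z0 zlt; rewrite -ltz_nat gez0_abs.
exists [ffun i => Ordinal (kz i)]; apply/rowP => i; rewrite !mxE ffunE/=.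
case/andP: (zb i) => z0 _.
have -> : (`|z i|%N)%:R = (z i)%:~R :> R by rewrite pmulrn gez0_abs.
by rewrite /z intrD mulrDl -pmulrn natrM mulfK ?gt_eqF// addrK.
Qed.

Lemma cmeas_grid n M (G : 'rV[R]_d -> R[i]) : (0 < n)%N -> supported M G ->
  cmeas (fun x : Rd R d => G (grid n x)).
Proof.
move=> n0 sG; under eq_fun do rewrite (grid_sum _ n0 sG).
apply: cmeas_sum => k; apply: cmeasM; last exact: cmeas_cst.
by apply: cmeas_indic; exact: measurable_obox.
Qed.

Lemma cint_grid n M (G : 'rV[R]_d -> R[i]) : (0 < n)%N -> supported M G ->
  cint mu (fun x => G (grid n x)) =
  ((n%:R^-1 ^+ d)%:C)%C * \sum_(k : {ffun 'I_d -> 'I_(2 * M * n)}) G (pt k).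
Proof.
move=> n0 sG.
transitivity (cint mu (fun x => \sum_(k : {ffun 'I_d -> 'I_(2 * M * n)}) \1_(cell k) x * G (pt k))).
  by congr cint; apply/funext => x; exact: grid_sum.
have mc k : (lebesgue_outer R d).-cara.-measurable (@cell n M k) by exact: measurable_obox.
have coo k : (mu (@cell n M k) < +oo)%E by rewrite lebesgue_cell// ltry.
rewrite cint_sum => [|k]; last exact: (cL1_indicM (G (pt k)) (mc k) (coo k)).
rewrite mulr_sumr; apply: eq_bigr => k _.
rewrite (cint_indic (G (pt k)) (mc k) (coo k)) mulrC; congr (_ * _).
by congr ((_)%:C)%C; exact: (congr1 fine (lebesgue_cell k n0)).
Qed.

End grid.

Section bounded_support_products.
Context {dT : measure_display} {T : measurableType dT} {R : realType}.
Variable mu : {measure set T -> \bar R}.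
Implicit Types (f : T -> R[i]) (E : set T).

Lemma cmodulus_indicM E f (K : R) x : (forall x, cmodulus (f x) <= K) ->
  cmodulus (\1_E x * f x) <= K * \1_E x.
Proof.
move=> fK; rewrite cmodulusM mulrC indicCE cmodulusR ger0_norm//.
by rewrite ler_wpM2r.
Qed.

Lemma cL1_indic_bounded E f (K : R) : measurable E -> (mu E < +oo)%E -> cmeas f ->
  (forall x, cmodulus (f x) <= K) -> cL1 mu (fun x => \1_E x * f x).
Proof.
move=> mE Eoo mf fK; apply: (@cL1_bounded_support _ _ _ mu _ E K) => //.
  by apply: cmeasM => //; exact: cmeas_indic.
by move=> x; exact: cmodulus_indicM.
Qed.

Lemma cL2_indic_bounded E f (K : R) : measurable E -> (mu E < +oo)%E -> cmeas f ->
  (forall x, cmodulus (f x) <= K) -> cL2 mu (fun x => \1_E x * f x).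
Proof.
move=> mE Eoo mf fK; apply: (@cL2_bounded_support _ _ _ mu _ E K) => //.
  by apply: cmeasM => //; exact: cmeas_indic.
by move=> x; exact: cmodulus_indicM.
Qed.

End bounded_support_products.

Section characters.
Context {R : realType} {d : nat}.
Hypothesis d0 : (0 < d)%N.
Local Notation mu := (lebesgue_Rd R d).
Implicit Types (x y xi : 'rV[R]_d) (n M : nat).

Lemma dotC x y : dot x y = dot y x.
Proof. by apply: eq_bigr => i _; rewrite mulrC. Qed.

Lemma dotDl x y z : dot (x + y) z = dot x z + dot y z.
Proof. by rewrite -big_split; apply: eq_bigr => i _; rewrite mxE mulrDl. Qed.

Lemma dotDr x y z : dot x (y + z) = dot x y + dot x z.
Proof. by rewrite !(dotC x) dotDl. Qed.

Lemma dotNl x y : dot (- x) y = - dot x y.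
Proof. by rewrite -sumrN; apply: eq_bigr => i _; rewrite mxE mulNr. Qed.

Lemma dot_eil i (s : R) y : dot (ei i s) y = s * y ord0 i.
Proof.
rewrite /dot (bigD1 i)//= eiE eqxx big1 ?addr0// => j ji.
by rewrite eiE (negbTE ji) mul0r.
Qed.

Definition ch x xi : R[i] := expNi (2 * pi * dot x xi).

Lemma chDl x y xi : ch (x + y) xi = ch x xi * ch y xi.
Proof. by rewrite /ch dotDl mulrDr expNiD. Qed.

Lemma chDr x y xi : ch xi (x + y) = ch xi x * ch xi y.
Proof. by rewrite /ch dotDr mulrDr expNiD. Qed.

Lemma chNl x xi : ch (- x) xi = conjc (ch x xi).
Proof. by rewrite /ch dotNl mulrN expNiN. Qed.

Lemma chC x xi : ch x xi = ch xi x.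
Proof. by rewrite /ch dotC. Qed.

Lemma cmodulus_ch x xi : cmodulus (ch x xi) = 1.
Proof. exact: cmodulus_expNi. Qed.

Lemma measurable_dot x : measurable_fun [set: Rd R d] (fun xi : Rd R d => dot x xi).
Proof.
apply: measurable_sum => i; apply: measurable_funM; first exact: measurable_cst.
exact: measurable_coord.
Qed.

Lemma cmeas_expNi {dT} {T : measurableType dT} (g : T -> R) :
  measurable_fun setT g -> cmeas (fun t => expNi (g t)).
Proof.
move=> mg; split => /=.
  by apply: (measurableT_comp _ mg); apply: continuous_measurable_fun; exact: continuous_cos.
apply: measurableT_comp; first exact: oppr_measurable.
by apply: (measurableT_comp _ mg); apply: continuous_measurable_fun; exact: continuous_sin.
Qed.

Lemma cmeas_ch x : cmeas (fun xi : Rd R d => ch x xi).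
Proof.
apply: cmeas_expNi; apply: measurable_funM; first exact: measurable_cst.
exact: measurable_dot.
Qed.

Lemma cmeas_chl xi : cmeas (fun x : Rd R d => ch x xi).
Proof. by under eq_fun do rewrite chC; exact: cmeas_ch. Qed.

Lemma lebesgue_obox_lty (a b : 'rV[R]_d) : (mu (obox a b) < +oo)%E.
Proof. by rewrite (lebesgue_obox d0) ltry. Qed.

Lemma add_eiE x i (r : R) j :
  (x + ei i r) ord0 j = x ord0 j + (if j == i then r else 0).
Proof. by rewrite mxE eiE. Qed.

Section periodic.
Variables (h : R) (i : 'I_d).

Let slab (s t : R) : set 'rV[R]_d :=
  obox (\row_j if j == i then s else - h) (\row_j if j == i then t else h).

Let slab_shift s t r x : \1_(slab s t) (x + ei i r) = \1_(slab (s - r) (t - r)) x :> R[i].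
Proof.
rewrite !indicE; congr ((nat_of_bool _)%:R); apply/idP/idP; rewrite !inE => xs j;
  have := xs j; rewrite add_eiE !mxE; case: eqP => _; rewrite ?addr0//.
  by rewrite lerBlDr ltrBrDr.
by rewrite lerBlDr ltrBrDr.
Qed.

Let slab_split s t r x : s <= t -> t <= r ->
  \1_(slab s r) x = \1_(slab s t) x + \1_(slab t r) x :> R[i].
Proof.
move=> st tr; rewrite !indicE.
have E a b : (x \in slab a b) = (a <= x ord0 i < b) &&
    [forall j, (j != i) ==> (- h <= x ord0 j < h)].
  apply/idP/andP; rewrite inE.
    move=> xs; split; first by have := xs i; rewrite !mxE eqxx.
    by apply/forallP => j; apply/implyP => ji; have := xs j; rewrite !mxE (negbTE ji).
  move=> [xi /forallP xs] j; rewrite !mxE; case: eqP => [->//|/eqP ji].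
  exact: (implyP (xs j)).
rewrite !E; case: [forall j, _]; rewrite ?andbF ?addr0// !andbT.
have [x1|x1] := ltP (x ord0 i) t.
  by rewrite (lt_le_trans x1 tr) /= andbT addr0.
by rewrite (le_trans st x1) /= add0r.
Qed.

Let slab_full : slab (- h) h = obox (const_mx (- h)) (const_mx h).
Proof.
by apply/seteqP; split => x xs j; have := xs j; rewrite !mxE; case: eqP.
Qed.

(** Integration over a period is translation invariant: the part of the period that leaves on one
    side is a translate, by one full period, of the part that enters on the other. *)
Lemma cint_periodic_shift (f : Rd R d -> R[i]) (K : R) (s : R) : cmeas f ->
  (forall x, cmodulus (f x) <= K) -> 0 <= s -> s <= 2 * h ->
  (forall x : 'rV[R]_d, f (x + ei i (2 * h)) = f x) ->
  cint mu (fun x => \1_(obox (const_mx (- h)) (const_mx h)) x * f ((x : 'rV[R]_d) + ei i s)) =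
  cint mu (fun x => \1_(obox (const_mx (- h)) (const_mx h)) x * f x).
Proof.
move=> mf fK s0 sh per; rewrite -slab_full.
have ms a b : (lebesgue_outer R d).-cara.-measurable (slab a b) by exact: measurable_obox.
have L1 a b : cL1 mu (fun x => \1_(slab a b) x * f x).
  exact: (cL1_indic_bounded (ms a b) (lebesgue_obox_lty _ _) mf fK).
have sh_ r a b : cint mu (fun x => \1_(slab a b) x * f x) =
    cint mu (fun x => \1_(slab (a - r) (b - r)) x * f ((x : 'rV[R]_d) + ei i r)).
  rewrite -(cint_preserving (measure_preserving_shift d0 (ei i r)) (L1 a b).1).
  by congr cint; apply/funext => x; rewrite slab_shift.
have -> : cint mu (fun x => \1_(slab (- h) h) x * f ((x : 'rV[R]_d) + ei i s)) =
    cint mu (fun x => \1_(slab (s - h) (s + h)) x * f x).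
  by rewrite (sh_ s); congr cint; apply/funext => x; congr (\1_(slab _ _) x * _); ring.
(* Both sides are the integral over the slab from $-h$ to $s+h$, cut once at $s-h$ and once at
   $h$. *)
have key : cint mu (fun x => \1_(slab (s - h) (s + h)) x * f x) +
    cint mu (fun x => \1_(slab (- h) (s - h)) x * f x) =
    cint mu (fun x => \1_(slab (- h) h) x * f x) +
    cint mu (fun x => \1_(slab h (s + h)) x * f x).
  rewrite -(cintD (L1 _ _) (L1 _ _)) -(cintD (L1 _ _) (L1 _ _)).
  congr cint; apply/funext => x; rewrite -!mulrDl; congr (_ * _).
  by rewrite [LHS]addrC -!slab_split//; lra.
have perE : cint mu (fun x => \1_(slab h (s + h)) x * f x) =
    cint mu (fun x => \1_(slab (- h) (s - h)) x * f x).
  rewrite (sh_ (2 * h) h); congr cint; apply/funext => x; rewrite per.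
  by congr (\1_(slab _ _) x * _); ring.
by rewrite perE in key; exact: addIr key.
Qed.

End periodic.

(** A cube of side $n$, a common period of the characters whose frequencies lie in the lattice of
    mesh $1/n$. *)
Definition ncube n : set 'rV[R]_d := obox (const_mx (- (n%:R / 2))) (const_mx (n%:R / 2)).

Lemma measurable_ncube n : (lebesgue_outer R d).-cara.-measurable (ncube n).
Proof. exact: measurable_obox. Qed.

Lemma lebesgue_ncube n : mu (ncube n) = (n%:R ^+ d)%:E.
Proof.
rewrite lebesgue_obox//; congr EFin.
rewrite (eq_bigr (fun=> n%:R)) ?prodr_const ?card_ord// => i _.
rewrite !mxE opprK -splitr max_r//.
Qed.

Lemma ch_orthogonal n y (z : 'I_d -> int) i : (0 < n)%N ->
  (forall j, y ord0 j = (z j)%:~R / n%:R) -> z i != 0 ->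
  cint mu (fun xi => \1_(ncube n) xi * ch y xi) = 0.
Proof.
move=> n0 yz zi0; have n0R : 0 < n%:R :> R by rewrite ltr0n.
have n0R' : n%:R != 0 :> R by rewrite gt_eqF.
have az0 : 0 < `|(z i)%:~R| :> R by rewrite normr_gt0 intr_eq0.
have az1 : 1 <= `|(z i)%:~R| :> R by rewrite -intr_norm ler1z -gtz0_ge1 normr_gt0.
(* Half a wavelength of the character in direction [i]. The shift by [s] multiplies the character by
   $-1$ and preserves the integral, which is therefore its own opposite; $|z_i|\ge 1$ keeps [s]
   within one period. *)
pose s : R := n%:R / 2 / `|(z i)%:~R|.
have chs xi r : ch y (xi + ei i r) = ch y xi * expNi (2 * pi * (y ord0 i * r)).
  by rewrite chDr; congr (_ * _); rewrite /ch dotC dot_eil (mulrC r).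
have n2 : 2 * (n%:R / 2) = n%:R :> R by field.
have s0 : 0 <= s by rewrite divr_ge0// divr_ge0.
have sn : s <= 2 * (n%:R / 2) by rewrite /s ler_pdivrMr//; nra.
have per (x : 'rV[R]_d) : ch y (x + ei i (2 * (n%:R / 2))) = ch y x.
  by rewrite chs n2 yz divfK// expNi_2piz mulr1.
have ch1 (x : Rd R d) : cmodulus (ch y x) <= 1 by rewrite cmodulus_ch.
have := @cint_periodic_shift (n%:R / 2) i (fun xi => ch y xi) 1 s (cmeas_ch y) ch1 s0 sn per.
have es : expNi (2 * pi * (y ord0 i * s)) = -1.
  rewrite yz /s.
  have [zp|zn] := ltP 0 ((z i)%:~R : R).
    rewrite gtr0_norm// -expNi_pi; congr expNi; field.
    by rewrite n0R' gt_eqF.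
  rewrite ler0_norm// (_ : 2 * pi * _ = - pi); last first.
    rewrite invrN !mulrN; congr (- _); field.
    by rewrite n0R' andbT intr_eq0; exact: zi0.
  by rewrite expNiN expNi_pi; apply: complex_ext => //=; rewrite !oppr0.
rewrite (_ : (fun x : Rd R d => _ * ch y (_ + _)) = fun x => - (\1_(ncube n) x * ch y x)); last first.
  by apply/funext => x; rewrite chs es mulrN1 mulrN.
rewrite cintN; last first.
  apply: (cL1_indic_bounded (measurable_ncube n) _ (cmeas_ch y) (K := 1)).
    exact: lebesgue_obox_lty.
  by move=> x; rewrite cmodulus_ch.
set c := cint _ _ => h.
have := congr1 (@complex.Re R) h; have := congr1 (@complex.Im R) h.
rewrite ReN ImN => him hre; apply: complex_ext; rewrite [RHS]/=; lra.
Qed.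

Lemma ncube_parseval n (K : finType) (a : K -> R[i]) (p : K -> 'rV[R]_d)
    (z : K -> 'I_d -> int) : (0 < n)%N ->
  (forall k j, p k ord0 j = (z k j)%:~R / n%:R) ->
  (forall k l, k != l -> exists i, z k i != z l i) ->
  sqn (L2ip mu) (fun xi => \1_(ncube n) xi * \sum_k a k * ch (p k) xi) =
  n%:R ^+ d * \sum_k cmodulus (a k) ^+ 2.
Proof.
move=> n0 pz zinj; have n0R : 0 < n%:R :> R by rewrite ltr0n.
have L1 y : cL1 mu (fun xi => \1_(ncube n) xi * ch y xi).
  apply: (cL1_indic_bounded (measurable_ncube n) _ (cmeas_ch y) (K := 1)).
    exact: lebesgue_obox_lty.
  by move=> x; rewrite cmodulus_ch.
rewrite /sqn /L2ip.
have -> : (fun x : Rd R d => \1_(ncube n) x * (\sum_k a k * ch (p k) x) *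
    conjc (\1_(ncube n) x * (\sum_k a k * ch (p k) x))) =
  (fun x => \sum_k \sum_l a k * conjc (a l) * (\1_(ncube n) x * ch (p k - p l) x)).
  apply/funext => x; rewrite conjcM.
  have -> : conjc (\1_(ncube n) x : R[i]) = \1_(ncube n) x by rewrite indicCE conjc_real.
  have -> : conjc (\sum_k a k * ch (p k) x) = \sum_k conjc (a k) * conjc (ch (p k) x).
    by rewrite (big_morph _ (@conjcD R) (conjc0 R)); apply: eq_bigr => k _; rewrite conjcM.
  rewrite mulrACA -{1}(mulr1 (\1_(ncube n) x * _)).
  have -> : (\1_(ncube n) x * \1_(ncube n) x : R[i]) = \1_(ncube n) x.
    by rewrite indicE; case: (_ \in _); rewrite ?mulr1 ?mulr0.
  rewrite mulr1 mulr_suml mulr_sumr; apply: eq_bigr => k _.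
  rewrite mulr_sumr mulr_sumr; apply: eq_bigr => l _.
  by rewrite chDl chNl; ring.
rewrite cint_sum => [|k]; last by apply: cL1_sum => l; exact: cL1Z.
have E k : cint mu (fun x => \sum_l a k * conjc (a l) * (\1_(ncube n) x * ch (p k - p l) x)) =
    ((n%:R ^+ d * cmodulus (a k) ^+ 2)%:C)%C.
  rewrite cint_sum => [|l]; last exact: cL1Z.
  rewrite (bigD1 k)//= big1 ?addr0 => [|l lk]; rewrite cintZ//.
    have hI : cint mu (fun x => \1_(ncube n) x * ch (p k - p k) x) = ((n%:R ^+ d)%:C)%C.
      have := cint_indic 1 (measurable_ncube n) (lebesgue_obox_lty _ _); rewrite mul1r => h.
      transitivity (((fine (mu (ncube n)))%:C)%C : R[i]); last by rewrite lebesgue_ncube.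
      rewrite -h; congr cint; apply/funext => x.
      by rewrite subrr /ch /dot big1 ?mulr0 ?expNi0// => i _; rewrite mxE mul0r.
    by rewrite hI mulcJ -rmorphM mulrC.
  have [i zi] : exists i, z k i != z l i by apply: zinj; rewrite eq_sym.
  rewrite (@ch_orthogonal n _ (fun j => z k j - z l j) i)// ?mulr0 ?subr_eq0//.
  by move=> j; rewrite !mxE !pz intrB mulrBl.
under eq_bigr do rewrite E.
by rewrite Re_sum mulr_sumr.
Qed.

End characters.

Section sqn_bounds.
Context {dT : measure_display} {T : measurableType dT} {R : realType}.
Variable mu : {measure set T -> \bar R}.
Local Notation q := (sqn (L2ip mu)).
Implicit Types (f g : T -> R[i]) (E : set T).

Lemma sqn_le_sum (I : Type) (s : seq I) (c : R) f (g : I -> T -> R[i]) : 0 <= c ->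
  cL2 mu f -> (forall i, cL2 mu (g i)) ->
  (forall x, cmodulus (f x) ^+ 2 <= c * \sum_(i <- s) cmodulus (g i x) ^+ 2) ->
  q f <= c * \sum_(i <- s) q (g i).
Proof.
move=> c0 L2f L2g fg.
have L1 : integrableR mu (fun x => \sum_(i <- s) cmodulus (g i x) ^+ 2) /\
    \int[mu]_x (\sum_(i <- s) cmodulus (g i x) ^+ 2) = \sum_(i <- s) q (g i).
  elim: s {fg} => [|i s [ih1 ih2]].
    under eq_fun do rewrite big_nil.
    split; first exact: integrable0.
    by rewrite big_nil Rintegral_cst// mul0r.
  under eq_fun do rewrite big_cons.
  split; first by apply: integrableR_D => //; exact: cL2_sqr_integrable.
  rewrite RintegralD//; last exact: cL2_sqr_integrable.
  by rewrite big_cons ih2 sqnL2.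
case: L1 => L1 <-; rewrite sqnL2 -RintegralZl//; apply: le_Rintegral => //.
- exact: cL2_sqr_integrable.
- exact: integrableR_Z.
Qed.

Lemma sqn_bounded_support f E (K : R) : measurable E -> (mu E < +oo)%E -> cmeas f ->
  (forall x, cmodulus (f x) <= K * \1_E x) -> q f <= K ^+ 2 * fine (mu E).
Proof.
move=> mE Eoo mf fK; have L2f := cL2_bounded_support mE Eoo mf fK.
have -> : K ^+ 2 * fine (mu E) = \int[mu]_x (K ^+ 2 * \1_E x).
  have := integrableR_indic 1 mE Eoo.
  under eq_fun do rewrite mul1r; move=> i1.
  by rewrite RintegralZl// /Rintegral integral_indic// setIT.
rewrite sqnL2; apply: le_Rintegral => //.
- exact: cL2_sqr_integrable.
- exact: integrableR_indic.
- move=> x _; have := fK x; rewrite indicE; case: (x \in E) => /=.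
    rewrite !mulr1 => h; rewrite ler_pXn2r ?nnegrE ?cmodulus_ge0//.
    exact: le_trans (cmodulus_ge0 _) h.
  rewrite !mulr0 => h; rewrite (_ : cmodulus (f x) = 0) ?expr0n//.
  by apply/eqP; rewrite eq_le h cmodulus_ge0.
Qed.

Lemma sqn_split_sqr f g h : cL2 mu f -> cL2 mu g -> cL2 mu h ->
  (forall x, cmodulus (f x) ^+ 2 = cmodulus (g x) ^+ 2 + cmodulus (h x) ^+ 2) ->
  q f = q g + q h.
Proof.
move=> L2f L2g L2h fgh; rewrite !sqnL2 -RintegralD//; [|exact: cL2_sqr_integrable..].
by apply: eq_Rintegral => x _.
Qed.

Lemma cmodulus_indicM_sqr E f x :
  cmodulus (\1_E x * f x) ^+ 2 = \1_E x * cmodulus (f x) ^+ 2.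
Proof.
rewrite cmodulusM exprMn indicCE cmodulusR real_normK ?num_real//; congr (_ * _).
by rewrite indicE; case: (_ \in _); rewrite ?expr1n ?expr0n.
Qed.

End sqn_bounds.

Section measurable_integral.
Context {d1 d2 : measure_display} {X : measurableType d1} {Y : measurableType d2} {R : realType}.
Variables (m1 : {sigma_finite_measure set X -> \bar R}).

Lemma measurable_fun_Rintegral (f : X * Y -> R) : measurable_fun setT f ->
  measurable_fun setT (fun y => \int[m1]_x f (x, y)).
Proof.
move=> mf; apply: measurableT_comp; first exact: fine_measurable.
rewrite (_ : (fun y => _) = (fun y => \int[m1]_x (fun z => (f z)%:E)^\+ (x, y)
   - \int[m1]_x (fun z => (f z)%:E)^\- (x, y))%E); last first.
  apply/funext => y; rewrite integralE.
  by congr (_ - _)%E; apply: eq_integral => x _; rewrite ?funeposE ?funenegE.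
have mfE : measurable_fun setT (fun z => (f z)%:E) by exact/measurable_EFinP.
apply: emeasurable_funB.
  apply: (@measurable_fun_fubini_tonelli_G _ _ _ _ _ m1) => //; exact: measurable_funepos.
apply: (@measurable_fun_fubini_tonelli_G _ _ _ _ _ m1) => //; exact: measurable_funeneg.
Qed.

Lemma cmeas_cint (f : X * Y -> R[i]) : cmeas f -> cmeas (fun y => cint m1 (fun x => f (x, y))).
Proof.
move=> [f1 f2]; split => /=.
  exact: (measurable_fun_Rintegral f1).
exact: (measurable_fun_Rintegral f2).
Qed.

End measurable_integral.

(** * Fourier transforms of step functions on a grid *)

Section fourier_grid.
Context {R : realType} {d : nat}.
Hypothesis d0 : (0 < d)%N.
Local Notation mu := (lebesgue_Rd R d).
Local Notation q := (sqn (L2ip mu)).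
Implicit Types (x y xi : 'rV[R]_d) (n M : nat) (G u : 'rV[R]_d -> R[i]).
Let sip := @L2_semi_ip _ _ _ mu.

(** The character is rounded to the grid as well as the function. This makes the result exactly a
    trigonometric polynomial of period $n$, to which Parseval's identity applies. *)
Definition gridft n G xi : R[i] := cint mu (fun x => ch (grid n x) xi * G (grid n x)).

Lemma supported_ch M G xi : supported M G -> supported M (fun x => ch x xi * G x).
Proof.
by move=> sG x; rewrite mulf_eq0 negb_or => /andP[_]; exact: sG.
Qed.

Lemma supportedW M N G : (M <= N)%N -> supported M G -> supported N G.
Proof. by move=> MN sG x Gx i; rewrite (lt_le_trans (sG _ Gx i))// ler_nat. Qed.

Let mcell n M k : (lebesgue_outer R d).-cara.-measurable (@cell R d n M k).
Proof. exact: measurable_obox. Qed.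

Lemma cL1_grid n M G : (0 < n)%N -> supported M G ->
  cL1 mu (fun x => G (grid n x)).
Proof.
move=> n0 sG; rewrite (_ : (fun x => _) = (fun x : Rd R d =>
    \sum_(k : {ffun 'I_d -> 'I_(2 * M * n)}) \1_(cell k) x * G (pt k))); last first.
  by apply/funext => x; exact: grid_sum.
apply: cL1_sum => k; apply: (cL1_indicM _ (mcell k)).
exact: lebesgue_obox_lty.
Qed.

Lemma gridft_sum n M G xi : (0 < n)%N -> supported M G ->
  gridft n G xi = ((n%:R^-1 ^+ d)%:C)%C *
    \sum_(k : {ffun 'I_d -> 'I_(2 * M * n)}) G (pt k) * ch (pt k) xi.
Proof.
move=> n0 sG; rewrite /gridft (cint_grid d0 n0 (supported_ch (xi := xi) sG)).
by congr (_ * _); apply: eq_bigr => k _; rewrite mulrC.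
Qed.

Lemma cmeas_gridft n M G : (0 < n)%N -> supported M G ->
  cmeas (fun xi : Rd R d => gridft n G xi).
Proof.
move=> n0 sG; under eq_fun do rewrite (gridft_sum _ n0 sG).
apply: cmeasZ; apply: cmeas_sum => k; apply: cmeasZ; exact: cmeas_ch.
Qed.

(** The coefficients carry a factor $n^{-d}$, which enters squared, and the period cube has volume
    $n^d$; what remains is $n^{-d}$, the volume of a cell. *)
Lemma gridft_parseval n M G : (0 < n)%N -> supported M G ->
  q (fun xi => \1_(ncube n) xi * gridft n G xi) = q (fun x => G (grid n x)).
Proof.
move=> n0 sG; have n0R : n%:R != 0 :> R by rewrite pnatr_eq0 -lt0n.
have -> : q (fun x => G (grid n x)) =
    n%:R^-1 ^+ d * \sum_(k : {ffun 'I_d -> 'I_(2 * M * n)}) cmodulus (G (pt k)) ^+ 2.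
  have sGG : supported M (fun x => G x * conjc (G x)).
    by move=> x; rewrite mulf_eq0 negb_or => /andP[+ _]; exact: sG.
  rewrite /sqn /L2ip (cint_grid d0 n0 sGG) ReM /= mul0r subr0 Re_sum; congr (_ * _).
  by apply: eq_bigr => k _; rewrite mulcJ.
rewrite (_ : (fun xi => _) = (fun xi => \1_(ncube n) xi *
    \sum_(k : {ffun 'I_d -> 'I_(2 * M * n)}) ((n%:R^-1 ^+ d)%:C)%C * G (pt k) * ch (pt k) xi)); last first.
  apply/funext => xi; rewrite (gridft_sum _ n0 sG); congr (_ * _).
  by rewrite mulr_sumr; apply: eq_bigr => k _; rewrite mulrA.
rewrite (ncube_parseval d0 _ (z := fun (k : {ffun 'I_d -> 'I_(2 * M * n)}) i => (k i : nat)%:Z - (M * n)%:Z)) //; last 2 first.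
- move=> k i; rewrite mxE intrB -!pmulrn natrM mulrBl mulfK//.
- move=> k l kl; apply: contrapT => h.
  move/eqP: kl; apply; apply/ffunP => i; apply/val_inj/eqP.
  apply: contrapT => /negP ki; apply: h; exists i; apply: contra ki => /eqP.
  by move=> /addIr/eqP; rewrite eqz_nat.
rewrite mulr_sumr mulr_sumr; apply: eq_bigr => k _.
rewrite cmodulusM cmodulusR exprMn real_normK ?num_real// mulrA; congr (_ * _).
by rewrite expr2 mulrA -exprMn mulfV// expr1n mul1r.
Qed.

(** A shift by one mesh commutes with rounding and preserves the measure. The identity turns
    regularity of [G] into decay of its transform. *)
Lemma gridft_diff n M G i xi : (0 < n)%N -> supported M G ->
  gridft n (fun x => G x - G (x - ei i n%:R^-1)) xi =
  (1 - ch (ei i n%:R^-1) xi) * gridft n G xi.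
Proof.
move=> n0 sG; set e := ei i n%:R^-1.
have n1 : n%:R^-1 <= 1 :> R by rewrite invf_le1 ?ltr0n// ler1n.
have sGe : supported M.+1 (fun x => G (x - e)).
  move=> x /sG h j; have := h j; rewrite 2!mxE /e eiE.
  have e1 : `|(if j == i then n%:R^-1 else 0) : R| <= 1.
    by case: eqP => _; rewrite ?normr0// ger0_norm// invr_ge0.
  rewrite -natr1 => h1.
  rewrite -(subrK (if j == i then n%:R^-1 else 0) (x ord0 j)).
  by rewrite (le_lt_trans (ler_normD _ _))// ltr_leD.
have L1 := cL1_grid n0 (supported_ch (xi := xi) sG).
have L1e := cL1_grid n0 (supported_ch (xi := xi) sGe).
transitivity (cint mu (fun x => ch (grid n x) xi * G (grid n x) - ch (grid n x) xi * G (grid n x - e))).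
  by congr cint; apply/funext => x; rewrite mulrBr.
rewrite cintB//.
have -> : cint mu (fun x => ch (grid n x) xi * G (grid n x - e)) = ch e xi * gridft n G xi.
  rewrite -(cint_preserving (measure_preserving_shift d0 e) L1e.1) -cintZ//.
  by congr cint; apply/funext => x; rewrite grid_shift// addrK chDl; ring.
by rewrite mulrBl mul1r.
Qed.

End fourier_grid.

Lemma cmeas_comp {d1 d2 : measure_display} {X : measurableType d1} {Y : measurableType d2}
    {R : realType} (u : Y -> R[i]) (phi : X -> Y) :
  cmeas u -> measurable_fun setT phi -> cmeas (fun x => u (phi x)).
Proof.
by case=> u1 u2 mphi; split; [exact: (measurableT_comp u1 mphi)|exact: (measurableT_comp u2 mphi)].
Qed.

Lemma cmeas_cvg {dT : measure_display} {T : measurableType dT} {R : realType}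
    (f : nat -> T -> R[i]) (g : T -> R[i]) : (forall n, cmeas (f n)) ->
  (forall x, (fun n => cmodulus (f n x - g x)) @ \oo --> (0 : R)) -> cmeas g.
Proof.
move=> mf fg; split.
  apply: (measurable_fun_cvg (h := fun n x => complex.Re (f n x))).
    by move=> n; exact: (mf n).1.
  move=> x _; apply/cvgrPdist_lt => e e0.
  have /cvgrPdist_lt/(_ _ e0) := fg x; apply: filterS => n.
  rewrite sub0r normrN ger0_norm ?cmodulus_ge0// => h.
  rewrite (le_lt_trans _ h)// (le_trans _ (Re_le_cmodulus _))// distrC.
  by rewrite ReD ReN.
apply: (measurable_fun_cvg (h := fun n x => complex.Im (f n x))).
  by move=> n; exact: (mf n).2.
move=> x _; apply/cvgrPdist_lt => e e0.
have /cvgrPdist_lt/(_ _ e0) := fg x; apply: filterS => n.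
rewrite sub0r normrN ger0_norm ?cmodulus_ge0// => h.
rewrite (le_lt_trans _ h)// (le_trans _ (Im_le_cmodulus _))// distrC.
by rewrite ImD ImN.
Qed.

(** * Lipschitz functions of compact support *)

Section lipschitz_compact_support.
Context {R : realType} {d : nat}.
Hypothesis d0 : (0 < d)%N.
Local Notation mu := (lebesgue_Rd R d).
Local Notation q := (sqn (L2ip mu)).
Implicit Types (x y xi : 'rV[R]_d) (n M : nat) (u : 'rV[R]_d -> R[i]).
Let sip := @L2_semi_ip _ _ _ mu.

(** Lipschitz for the sup norm, phrased with a bound [h] on all coordinate differences, the form in
    which the rounding error of the grid appears. *)
Definition lipc M (L : R) u : Prop :=
  [/\ 0 <= L, supported M u &
      forall x y (h : R), 0 <= h -> (forall i, `|x ord0 i - y ord0 i| <= h) ->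
        cmodulus (u x - u y) <= L * h].

Definition ft u xi : R[i] := cint mu (fun x => ch x xi * u x).

Let cubeR n : set 'rV[R]_d := cube n%:R.
Let mcube n : (lebesgue_outer R d).-cara.-measurable (cubeR n).
Proof. exact: measurable_box. Qed.
Let cube_oo n : (mu (cubeR n) < +oo)%E.
Proof. exact: cube_finite. Qed.

Lemma indic_cube1 n x : (forall i, `|x ord0 i| <= n%:R) -> \1_(cubeR n) x = 1 :> R.
Proof. by move=> h; rewrite indicE mem_set//; apply/cubeP. Qed.

Lemma supported_cube_bound M (K : R) u x : 0 <= K -> (u x != 0 -> forall i, `|x ord0 i| <= M%:R) ->
  cmodulus (u x) <= K -> cmodulus (u x) <= K * \1_(cubeR M) x.
Proof.
move=> K0 sx ux; have [->|u0] := eqVneq (u x) 0.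
  by rewrite cmodulus0 mulr_ge0.
by rewrite indic_cube1 ?mulr1//; exact: sx.
Qed.

Lemma sub_eiE x i (r : R) j :
  (x - ei i r) ord0 j = x ord0 j - (if j == i then r else 0).
Proof.
have -> : x - ei i r = x + ei i (- r) by rewrite /ei scaleNr.
by rewrite add_eiE; case: eqP => _ //; rewrite oppr0.
Qed.

Section one_function.
Variables (M : nat) (L : R) (u : 'rV[R]_d -> R[i]).
Hypothesis uL : lipc M L u.
Let L0 : 0 <= L. Proof. by case: uL. Qed.
Let su : supported M u. Proof. by case: uL. Qed.
Let lu x y (h : R) : 0 <= h -> (forall i, `|x ord0 i - y ord0 i| <= h) ->
  cmodulus (u x - u y) <= L * h. Proof. by case: uL => _ _; exact. Qed.
Let Ku : R := L * (2 * M%:R).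
Let Ku0 : 0 <= Ku. Proof. by rewrite mulr_ge0// mulr_ge0. Qed.

(** A translation by $2M$ along one axis leaves the support, so [u x] is itself a difference of two
    values of [u]. *)
Lemma lipc_bounded x : cmodulus (u x) <= Ku.
Proof.
have [->|u0] := eqVneq (u x) 0; first by rewrite cmodulus0.
pose i0 := Ordinal d0; pose y := x + ei i0 (2 * M%:R).
have uy : u y = 0.
  apply/eqP; apply: contrapT => /negP uy.
  have := su uy i0; have := su u0 i0; rewrite /y add_eiE eqxx !ltr_norml; lra.
have h := @lu x y (2 * M%:R); rewrite uy subr0 in h; apply: h.
  by rewrite mulr_ge0.
move=> i; rewrite /y add_eiE opprD addNKr normrN; case: eqP => _; rewrite ?normr0 ?mulr_ge0//.
by rewrite ger0_norm// mulr_ge0.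
Qed.

Lemma lipc_cube_bound x : cmodulus (u x) <= Ku * \1_(cubeR M) x.
Proof.
by apply: supported_cube_bound => //; [move=> u0 i; exact/ltW/su|exact: lipc_bounded].
Qed.

Let n1_ge0 n : 0 <= n.+1%:R^-1 :> R. Proof. by rewrite invr_ge0. Qed.
Let n1_le1 n : n.+1%:R^-1 <= 1 :> R. Proof. by rewrite invf_le1// ler1n. Qed.

(** Rounding moves a coordinate by at most $1/(n+1)\le 1$, whence the cube of radius $M+1$; the
    further shift by one mesh in the next lemma costs another unit. *)
Lemma lipc_grid_diff n x :
  cmodulus (u (grid n.+1 x) - u x) <= (L / n.+1%:R) * \1_(cubeR M.+1) x.
Proof.
apply: (@supported_cube_bound _ _ (fun x => u (grid n.+1 x) - u x)).
- by rewrite mulr_ge0.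
- move=> h i; rewrite -natr1.
  have g := le_trans (@grid_dist R d n.+1 x i isT) (n1_le1 n).
  have [ux|ux] := eqVneq (u x) 0; last first.
    by have := su ux i; lra.
  have ug : u (grid n.+1 x) != 0 by move: h; rewrite ux subr0.
  have := su ug i.
  rewrite -(subrK (grid n.+1 x ord0 i) (x ord0 i)) => h1.
  by rewrite (le_trans (ler_normD _ _))//; lra.
- by apply: lu => // i; rewrite distrC; exact: grid_dist.
Qed.

Lemma lipc_grid_shift_diff n i x :
  cmodulus (u (grid n.+1 x) - u (grid n.+1 x - ei i n.+1%:R^-1)) <=
  (L / n.+1%:R) * \1_(cubeR M.+2) x.
Proof.
apply: (@supported_cube_bound _ _ (fun x => u (grid n.+1 x) - u (grid n.+1 x - ei i n.+1%:R^-1))).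
- by rewrite mulr_ge0.
- move=> h j; rewrite -natr1 -natr1.
  have g := le_trans (@grid_dist R d n.+1 x j isT) (n1_le1 n).
  have [ux|ux] := eqVneq (u (grid n.+1 x)) 0; last first.
    have := su ux j; rewrite -(subrK (grid n.+1 x ord0 j) (x ord0 j)) => h1.
    by rewrite (le_trans (ler_normD _ _))//; lra.
  have ug : u (grid n.+1 x - ei i n.+1%:R^-1) != 0.
    by move: h; rewrite ux sub0r oppr_eq0.
  have := su ug j; rewrite -scaleN1r; set e := _ *: _.
  have -> : e = ei i (- n.+1%:R^-1) by rewrite /e /ei scalerA mulN1r.
  rewrite add_eiE => h1.
  rewrite -(subrK (grid n.+1 x ord0 j) (x ord0 j)) (le_trans (ler_normD _ _))//.
  set a := grid n.+1 x ord0 j in h1 *; set c := if _ then _ else _ in h1.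
  have c1 : `|c| <= 1 by rewrite /c; case: eqP => _; rewrite ?normr0// normrN ger0_norm.
  have := ler_normB (a + c) c; rewrite addrK; lra.
- apply: lu => // j; rewrite sub_eiE opprB addrC subrK.
  by case: eqP => _; rewrite ?normr0// ger0_norm.
Qed.

Lemma cmeas_lipc : cmeas (u : Rd R d -> R[i]).
Proof.
have cvu x : (fun n => cmodulus (u (grid n.+1 x) - u x)) @ \oo --> (0 : R).
  apply: (@squeeze_cvg0 _ _ (fun n => L * n.+1%:R^-1)) => [n|n|]; first exact: cmodulus_ge0.
    by rewrite (le_trans (lipc_grid_diff n x))// (ler_piMr (mulr_ge0 L0 (n1_ge0 n)))//.
  by rewrite -(mulr0 L); apply: cvgM; [exact: cvg_cst|exact: cvg_harmonic].
exact: (cmeas_cvg (fun n => cmeas_grid (ltn0Sn n) su) cvu).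
Qed.

Lemma cL1_lipc : cL1 mu (u : Rd R d -> R[i]).
Proof. exact: (cL1_bounded_support (mcube M) (cube_oo M) cmeas_lipc lipc_cube_bound). Qed.

Lemma cL2_lipc : cL2 mu (u : Rd R d -> R[i]).
Proof. exact: (cL2_bounded_support (mcube M) (cube_oo M) cmeas_lipc lipc_cube_bound). Qed.

End one_function.

Lemma cmeas_ft (u : Rd R d -> R[i]) : cmeas u -> cmeas (fun xi : Rd R d => ft u xi).
Proof.
move=> mu_; apply: (@cmeas_cint _ _ _ _ R mu (fun z : Rd R d * Rd R d => ch z.1 z.2 * u z.1)).
apply: cmeasM.
  apply: cmeas_expNi; apply: measurable_funM; first exact: measurable_cst.
  apply: measurable_sum => i; apply: measurable_funM.
    by apply: (measurableT_comp (measurable_coord i)); exact: measurable_fst.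
  by apply: (measurableT_comp (measurable_coord i)); exact: measurable_snd.
exact: (cmeas_comp mu_ measurable_fst).
Qed.

Lemma cL1_ch (u : Rd R d -> R[i]) xi : cL1 mu u -> cL1 mu (fun x => ch x xi * u x).
Proof.
move=> L1u; have ch1 (x : Rd R d) : cmodulus (ch x xi) <= 1 by rewrite cmodulus_ch.
exact: (cL1_bounded (cmeas_chl xi) L1u ch1).
Qed.

End lipschitz_compact_support.

(** * Isometry of the Fourier transform on Lipschitz functions *)

Lemma cmodulus_indic_mul (T : Type) (R : realType) (E : set T) (x : T) (z : R[i]) :
  cmodulus (\1_E x * z) = \1_E x * cmodulus z.
Proof. by rewrite cmodulusM indicCE cmodulusR ger0_norm. Qed.

Lemma sqn_le {dT : measure_display} {T : measurableType dT} {R : realType}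
    {mu : {measure set T -> \bar R}} (f g : T -> R[i]) : cL2 mu f -> cL2 mu g ->
  (forall x, cmodulus (f x) <= cmodulus (g x)) -> sqn (L2ip mu) f <= sqn (L2ip mu) g.
Proof.
move=> L2f L2g fg.
have := @sqn_le_sum _ _ _ mu unit [:: tt] 1 f (fun=> g) ler01 L2f (fun=> L2g).
rewrite mul1r big_seq1; apply => x; rewrite mul1r big_seq1.
by rewrite ler_sqr ?nnegrE ?cmodulus_ge0.
Qed.

Section fourier_isometry.
Context {R : realType} {d : nat}.
Hypothesis d0 : (0 < d)%N.
Local Notation mu := (lebesgue_Rd R d).
Local Notation q := (sqn (L2ip mu)).
Implicit Types (x y xi : 'rV[R]_d) (n M T : nat).
Let sip := @L2_semi_ip _ _ _ mu.
Let cubeR n : set 'rV[R]_d := cube n%:R.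
Let mcube n : (lebesgue_outer R d).-cara.-measurable (cubeR n).
Proof. exact: measurable_box. Qed.
Let cube_oo n : (mu (cubeR n) < +oo)%E.
Proof. exact: cube_finite. Qed.

Variables (M : nat) (L : R) (u : 'rV[R]_d -> R[i]).
Hypothesis uL : lipc M L u.
Let L0 : 0 <= L. Proof. by case: uL. Qed.
Let su : supported M u. Proof. by case: uL. Qed.
Let V : R := fine (mu (cubeR M.+2)).
Let V0 : 0 <= V. Proof. exact: fine_ge0. Qed.
Let U n xi := gridft n.+1 u xi.
Let mU n : cmeas (fun xi : Rd R d => U n xi).
Proof. exact: (cmeas_gridft d0 (ltn0Sn n) su). Qed.
Let Ku : R := L * (2 * M%:R).
Let Ku0 : 0 <= Ku. Proof. by rewrite mulr_ge0// mulr_ge0. Qed.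
Let mft : cmeas (fun xi : Rd R d => ft u xi).
Proof. exact: (cmeas_ft (cmeas_lipc uL)). Qed.

Let n1_ge0 n : 0 <= n.+1%:R^-1 :> R. Proof. by rewrite invr_ge0. Qed.

Lemma Rintegral_cube n (c : R) : \int[mu]_x (c * \1_(cubeR n) x) = c * fine (mu (cubeR n)).
Proof.
have := integrableR_indic 1 (mcube n) (cube_oo n).
under eq_fun do rewrite mul1r; move=> i1.
rewrite (RintegralZl _ measurableT i1) /Rintegral.
by rewrite (integral_indic _ measurableT (mcube n)) setIT.
Qed.

Lemma cint_bound (f : Rd R d -> R[i]) n (K : R) : cL1 mu f ->
  (forall x, cmodulus (f x) <= K * \1_(cubeR n) x) ->
  cmodulus (cint mu f) <= K * fine (mu (cubeR n)).
Proof.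
move=> L1f fK; rewrite (le_trans (cmodulus_cint L1f))// -Rintegral_cube.
exact: (le_Rintegral measurableT (cL1_cmodulus L1f) (integrableR_indic K (mcube n) (cube_oo n)) (fun x _ => fK x)).
Qed.

Lemma ft_bounded xi : cmodulus (ft u xi) <= Ku * fine (mu (cubeR M)).
Proof.
apply: cint_bound; first exact: (cL1_ch xi (cL1_lipc d0 uL)).
by move=> x; rewrite cmodulusM cmodulus_ch mul1r; exact: (lipc_cube_bound d0 uL).
Qed.

Lemma cmodulus_chB x y xi (h k : R) : 0 <= h -> 0 <= k ->
  (forall i, `|x ord0 i - y ord0 i| <= h) -> (forall i, `|xi ord0 i| <= k) ->
  cmodulus (ch x xi - ch y xi) <= 2 * pi * (d%:R * (h * k)).
Proof.
move=> h0 k0 hx hk; rewrite (le_trans (cmodulus_expNiB_le _ _))//.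
rewrite -mulrBr normrM ger0_norm ?mulr_ge0 ?pi_ge0// ler_wpM2l ?mulr_ge0 ?pi_ge0//.
rewrite /dot -sumrB (le_trans (ler_norm_sum _ _ _))//.
rewrite -[d in d%:R]card_ord -sumr_const mulr_suml; apply: ler_sum => i _.
by rewrite mul1r -mulrBl normrM ler_pM.
Qed.

(** The term [L] is the error from rounding the argument of [u]. The other term is the error from
    rounding the character at frequencies bounded by [T], times the bound [Ku] of [u]. The volume
    [V] accounts for the integration. *)
Let CT T : R := (L + 2 * pi * (d%:R * T%:R) * Ku) * V.

Lemma gridft_uniform T n xi : cubeR T xi ->
  cmodulus (U n xi - ft u xi) <= CT T / n.+1%:R.
Proof.
move=> /cubeP xiT.
have L1g := cL1_grid d0 (ltn0Sn n) (supported_ch (xi := xi) su).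
have L1u := cL1_ch xi (cL1_lipc d0 uL).
rewrite /U /gridft /ft -(cintB L1g L1u).
rewrite /CT mulrAC; apply: cint_bound; first exact: (cL1D L1g (cL1N L1u)).
move=> x.
have -> : ch (grid n.+1 x) xi * u (grid n.+1 x) - ch x xi * u x =
   ch (grid n.+1 x) xi * (u (grid n.+1 x) - u x) + (ch (grid n.+1 x) xi - ch x xi) * u x.
  by ring.
rewrite (le_trans (cmodulusD _ _))// !cmodulusM cmodulus_ch mul1r mulrDl mulrDl.
have cubeS m k : (m <= k)%N -> \1_(cubeR m) x <= \1_(cubeR k) x :> R.
  move=> mk; have [/cubeP h|h] := pselect (cubeR m x); last by rewrite indicE memNset.
  rewrite (indic_cube1 (n := k)) ?indicE ?lern1 ?leq_b1// => i.
  by rewrite (le_trans (h i))// ler_nat.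
apply: lerD.
  rewrite (le_trans (lipc_grid_diff uL n x))// ler_wpM2l ?mulr_ge0//.
  exact: cubeS.
have h1 : cmodulus (ch (grid n.+1 x) xi - ch x xi) <= 2 * pi * (d%:R * (n.+1%:R^-1 * T%:R)).
  by apply: cmodulus_chB => // i; rewrite distrC; exact: grid_dist.
apply: (le_trans (ler_pM (cmodulus_ge0 _) (cmodulus_ge0 _) h1 (lipc_cube_bound d0 uL x))).
rewrite -/Ku.
have -> : 2 * pi * (d%:R * (n.+1%:R^-1 * T%:R)) * (Ku * \1_(cubeR M) x) =
   2 * pi * (d%:R * T%:R) * Ku / n.+1%:R * \1_(cubeR M) x by ring.
rewrite ler_wpM2l//; last by apply: cubeS; rewrite (leq_trans (leqnSn _)).
by rewrite !mulr_ge0// pi_ge0.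
Qed.

Let L2cU (E : set 'rV[R]_d) n : (lebesgue_outer R d).-cara.-measurable E -> (mu E < +oo)%E ->
  cL2 mu (fun xi => \1_E xi * U n xi).
Proof.
move=> mE Eoo.
pose K := cmodulus ((n.+1%:R^-1 ^+ d)%:C)%C * \sum_(k : {ffun 'I_d -> 'I_(2 * M * n.+1)}) cmodulus (u (pt k)).
have UK (xi : Rd R d) : cmodulus (U n xi) <= K.
  rewrite /U (gridft_sum d0 _ (ltn0Sn n) su) cmodulusM ler_wpM2l ?cmodulus_ge0//.
  rewrite (le_trans (cmodulus_sum _ _ _))//; apply: ler_sum => k _.
  by rewrite cmodulusM cmodulus_ch mulr1.
exact: (cL2_indic_bounded mE Eoo (mU n) UK).
Qed.

Lemma sqr_harmonic_cvg0 (K W : R) : (fun n => (K / n.+1%:R) ^+ 2 * W) @ \oo --> 0.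
Proof.
have c1 : (fun n => K / n.+1%:R) @ \oo --> K * 0 by apply: cvgMr; exact: cvg_harmonic.
rewrite -[X in _ --> X](mul0r W); apply: cvgMl.
have -> : (0 : R) = K * 0 * (K * 0) by rewrite !mulr0.
by under eq_fun do rewrite expr2; exact: cvgM.
Qed.

Lemma measurable_coord_gt i T :
  (lebesgue_outer R d).-cara.-measurable [set xi : 'rV[R]_d | ~~ (`|xi ord0 i| <= T%:R)].
Proof.
have -> : [set xi : 'rV[R]_d | ~~ (`|xi ord0 i| <= T%:R)] =
    ~` ((fun xi : Rd R d => (xi : 'rV[R]_d) ord0 i) @^-1` `[- T%:R, T%:R]%classic).
  by apply/seteqP; split => xi /=; rewrite in_itv/= ler_norml => /negP.
apply: (@measurableC _ (Rd R d)).
have := @measurable_coord R d i measurableT `[- T%:R, T%:R]%classic (measurable_itv _).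
by rewrite setTI.
Qed.

(* Multiplication by 1 - ch (ei i n^-1), which is of size |xi_i| / n on the period
   cube, corresponds to the difference u x - u (x - ei i n^-1) = O (1 / n). *)
Lemma gridft_tail T n i : (0 < T)%N ->
  q (fun xi => \1_(ncube n.+1 `&` [set xi | ~~ (`|xi ord0 i| <= T%:R)]) xi * U n xi) <=
  (L / (2 * pi * sine_slope R * T%:R)) ^+ 2 * V.
Proof.
move=> T0; have T0R : 0 < T%:R :> R by rewrite ltr0n.
set c := L / _.
pose e := ei i (n.+1%:R^-1 : R).
have s0 := sine_slope_gt0 R; have p0 := pi_gt0 R.
set E := ncube n.+1 `&` _.
have mN := measurable_coord_gt i T.
have mE : (lebesgue_outer R d).-cara.-measurable E.
  exact: (@measurableI _ (Rd R d) _ _ (measurable_ncube _) mN).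
have Eoo : (mu E < +oo)%E.
  rewrite (le_lt_trans (y := mu (ncube n.+1)))//; last exact: lebesgue_obox_lty.
  by apply: le_outer_measure => x [].
pose v x := u x - u (x - e).
have sv : supported M.+1 v.
  move=> x vx j; have [ux|ux] := eqVneq (u x) 0; last first.
    by rewrite (lt_le_trans (su ux j))// ler_nat.
  have : u (x - e) != 0 by move: vx; rewrite /v ux sub0r oppr_eq0.
  move=> /su/(_ j); rewrite /e sub_eiE => h.
  rewrite -(natr1 M) -(subrK (if j == i then n.+1%:R^-1 else 0) (x ord0 j)).
  rewrite (le_lt_trans (ler_normD _ _))// ltr_leD//.
  by case: eqP => _; rewrite ?normr0// ger0_norm// invf_le1// ler1n.
have qv : q (fun xi => \1_(ncube n.+1) xi * ((1 - ch e xi) * U n xi)) <= (L / n.+1%:R) ^+ 2 * V.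
  have -> : (fun xi : Rd R d => \1_(ncube n.+1) xi * ((1 - ch e xi) * U n xi)) =
      (fun xi => \1_(ncube n.+1) xi * gridft n.+1 v xi).
    by apply/funext => xi; rewrite /v (gridft_diff d0 i xi (ltn0Sn n) su).
  rewrite (gridft_parseval d0 (ltn0Sn n) sv).
  apply: (sqn_bounded_support (mcube M.+2) (cube_oo M.+2)).
    exact: (cmeas_grid (ltn0Sn n) sv).
  exact: (lipc_grid_shift_diff uL n i).
(* The inverse of the lower bound for $|1-\mathrm{ch}\,e\,\xi|$ where $|\xi_i|>T$. On the period
   cube the phase $2\pi\xi_i/(n+1)$ is at most $\pi$ in size, so the linear lower bound holds
   there. *)
pose k := n.+1%:R / (2 * pi * sine_slope R * T%:R).
have := @sqn_le_sum _ _ _ mu unit [:: tt] (k ^+ 2) (fun xi => \1_E xi * U n xi)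
   (fun _ xi => \1_(ncube n.+1) xi * ((1 - ch e xi) * U n xi)) (sqr_ge0 _) (L2cU n mE Eoo).
have L2d : cL2 mu (fun xi => \1_(ncube n.+1) xi * ((1 - ch e xi) * U n xi)).
  have -> : (fun xi : Rd R d => \1_(ncube n.+1) xi * ((1 - ch e xi) * U n xi)) =
      (fun xi => (1 - ch e xi) * (\1_(ncube n.+1) xi * U n xi)).
    by apply/funext => xi; ring.
  have m1 : cmeas (fun xi : Rd R d => 1 - ch e xi).
    exact: (cmeasB (cmeas_cst 1) (cmeas_ch e)).
  have b1 (xi : Rd R d) : cmodulus (1 - ch e xi) <= 2.
    by rewrite (le_trans (cmodulusD _ _))// cmodulusN cmodulus1 cmodulus_ch.
  exact: (cL2_bounded m1 (L2cU n (measurable_ncube _) (lebesgue_obox_lty d0 _ _)) b1).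
move=> /(_ (fun _ => L2d)); rewrite big_seq1 => H.
apply: (le_trans (H _)); last first.
  apply: (le_trans (ler_wpM2l (sqr_ge0 k) qv)).
  rewrite mulrA -exprMn le_eqVlt; apply/orP; left; apply/eqP; congr (_ ^+ 2 * _).
  by rewrite /k /c mulrC mulrA divfK// pnatr_eq0.
move=> xi; rewrite big_seq1 !cmodulus_indicM_sqr.
rewrite [X in X * _]indicE; case: (boolP (xi \in E)) => [|_]; last first.
  by rewrite mul0r mulr_ge0 ?sqr_ge0// mulr_ge0 ?sqr_ge0.
rewrite inE => -[xiC /= xiT]; rewrite indicE mem_set// !mul1r cmodulusM [X in _ <= _ * X]exprMn.
rewrite (mulrA (k ^+ 2)) -exprMn ler_peMl ?sqr_ge0//.
have D0 : 0 < 2 * pi * sine_slope R * T%:R :> R.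
  by do 3! apply: mulr_gt0 => //; rewrite ltr0n.
rewrite exprn_ege1// /k mulrC mulrA ler_pdivlMr// mul1r -ler_pdivrMr ?ltr0n//.
have xin : `|xi ord0 i| <= n.+1%:R / 2.
  by have /andP[h1 h2] := xiC i; rewrite ler_norml; move: h1 h2; rewrite !mxE => -> /ltW.
rewrite /ch /e dot_eil.
have nE : `|2 * pi * (n.+1%:R^-1 * xi ord0 i)| = 2 * pi * (n.+1%:R^-1 * `|xi ord0 i|).
  by rewrite normrM (@ger0_norm _ (2 * pi)) ?mulr_ge0 ?pi_ge0// normrM (@ger0_norm _ n.+1%:R^-1).
apply: le_trans (cmodulus_1B_expNi_ge _); rewrite nE; last first.
  have := ler_wpM2l (ltW p0) (ler_wpM2l (n1_ge0 n) xin).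
  have -> : pi * (n.+1%:R^-1 * (n.+1%:R / 2)) = pi / 2 :> R by rewrite (mulrA n.+1%:R^-1) mulVf ?pnatr_eq0// mul1r.
  by rewrite -(mulrA 2); set z := pi * (_ * `|_|); lra.
have -> : 2 * pi * sine_slope R * T%:R / n.+1%:R = sine_slope R * (2 * pi * (n.+1%:R^-1 * T%:R)) by ring.
apply: ler_wpM2l; first exact: ltW.
apply: ler_wpM2l; first by rewrite mulr_ge0// ltW.
by apply: ler_wpM2l => //; apply: ltW; rewrite ltNge.
Qed.

(** Parseval's identity splits the norm of the step function into the mass in the cube of radius [T]
    and the mass in the rest of the period cube. The second is bounded independently of $n$; on the
    fixed cube the convergence is uniform, so $n\to\infty$ is allowed. *)
Lemma ft_isometry_cube T : (0 < T)%N ->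
  q u - d%:R * ((L / (2 * pi * sine_slope R * T%:R)) ^+ 2 * V) <= q (fun xi => \1_(cubeR T) xi * ft u xi) <= q u.
Proof.
move=> T0; set eps := _ * (_ * V).
have L2u := cL2_lipc d0 uL.
have mTn n : (lebesgue_outer R d).-cara.-measurable (ncube n.+1 `\` cubeR T).
  exact: (@measurableD _ (Rd R d) _ _ (measurable_ncube _) (mcube _)).
have Tnoo n : (mu (ncube n.+1 `\` cubeR T) < +oo)%E.
  rewrite (le_lt_trans (y := mu (ncube n.+1)))//; last exact: lebesgue_obox_lty.
  by apply: le_outer_measure => x [].
have tail n : q (fun xi => \1_(ncube n.+1 `\` cubeR T) xi * U n xi) <= eps.
  pose E i := ncube n.+1 `&` [set xi : 'rV[R]_d | ~~ (`|xi ord0 i| <= T%:R)].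
  have mE i : (lebesgue_outer R d).-cara.-measurable (E i).
    exact: (@measurableI _ (Rd R d) _ _ (measurable_ncube _) (measurable_coord_gt _ _)).
  have Eoo i : (mu (E i) < +oo)%E.
    rewrite (le_lt_trans (y := mu (ncube n.+1)))//; last exact: lebesgue_obox_lty.
    by apply: le_outer_measure => x [].
  have := @sqn_le_sum _ _ _ mu 'I_d (index_enum 'I_d) 1 _ (fun i xi => \1_(E i) xi * U n xi) ler01 (L2cU n (mTn n) (Tnoo n)) (fun i => L2cU n (mE i) (Eoo i)).
  rewrite mul1r => H; apply: (le_trans (H _)) => [xi|].
    under eq_bigr do rewrite cmodulus_indicM_sqr.
    rewrite mul1r cmodulus_indicM_sqr -mulr_suml ler_wpM2r ?sqr_ge0//.
    rewrite [leLHS]indicE; case: (boolP (xi \in _)) => [|_]; last by apply: sumr_ge0.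
    rewrite inE => -[xiC /cubeP/existsNP[i /negP xiT]].
    rewrite (bigD1 i)//= [X in _ <= X + _]indicE mem_set; last by split.
    by rewrite lerDl sumr_ge0.
  rewrite /eps -[X in X%:R * _]card_ord -sumr_const mulr_suml; apply: ler_sum => i _.
  by rewrite mul1r; exact: gridft_tail.
(* The inequality is strict because [cubeR T] is closed and the period cube is half-open. *)
have split n : (2 * T < n.+1)%N -> q (fun xi => \1_(ncube n.+1) xi * U n xi) =
   q (fun xi => \1_(cubeR T) xi * U n xi) + q (fun xi => \1_(ncube n.+1 `\` cubeR T) xi * U n xi).
  move=> Tn.
  apply: sqn_split_sqr; [exact: (L2cU n (measurable_ncube _) (lebesgue_obox_lty d0 _ _))|exact: (L2cU n (mcube _) (cube_oo _))|exact: (L2cU n (mTn _) (Tnoo _))|].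
  move=> xi; rewrite !cmodulus_indicM_sqr -mulrDl; congr (_ * _).
  have TN : cubeR T `<=` ncube n.+1.
    move=> x /cubeP xT i; have := xT i; rewrite !mxE ler_norml => /andP[h1 h2].
    have h3 : T%:R < n.+1%:R / 2 :> R by rewrite ltr_pdivlMr// -natrM ltr_nat mulnC.
    by rewrite (le_trans _ h1) ?lerN2 ?ltW// (le_lt_trans h2).
  rewrite !indicE in_setD; case: (boolP (xi \in cubeR T)) => xT; last by rewrite andbT add0r.
  by rewrite andbF addr0 mem_set//; apply: TN; rewrite inE in xT.
pose a n := q (fun x => u (grid n.+1 x)).
have mgd n : cmeas ((fun x => u (grid n.+1 x)) - u : Rd R d -> R[i]).
  exact: (cmeasB (cmeas_grid (ltn0Sn n) su) (cmeas_lipc uL)).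
have L2gd n : cL2 mu ((fun x => u (grid n.+1 x)) - u).
  exact: (cL2_bounded_support (mcube M.+1) (cube_oo M.+1) (mgd n) (lipc_grid_diff uL n)).
have L2g n : cL2 mu (fun x => u (grid n.+1 x)).
  rewrite (_ : (fun x => _) = ((fun x => u (grid n.+1 x)) - u) + u); last by rewrite subrK.
  exact: (sipHD sip).
have ca : a @ \oo --> q u.
  apply: (sqn_cvg sip L2g L2u); apply: squeeze_cvg0 (sqr_harmonic_cvg0 L (fine (mu (cubeR M.+1)))) => n; first exact: (sip_ge0 sip).
  exact: (sqn_bounded_support (mcube M.+1) (cube_oo M.+1) (mgd n) (lipc_grid_diff uL n)).
have cb : (fun n => q (fun xi => \1_(cubeR T) xi * U n xi)) @ \oo --> q (fun xi => \1_(cubeR T) xi * ft u xi).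
  have L2f : cL2 mu (fun xi => \1_(cubeR T) xi * ft u xi).
    exact: (cL2_indic_bounded (mcube T) (cube_oo T) mft ft_bounded).
  apply: (sqn_cvg sip (fun n => L2cU n (mcube T) (cube_oo T)) L2f).
  apply: squeeze_cvg0 (sqr_harmonic_cvg0 (CT T) (fine (mu (cubeR T)))) => n.
    exact: (sip_ge0 sip (sipHB sip (L2cU n (mcube T) (cube_oo T)) L2f)).
  have -> : (fun xi : Rd R d => \1_(cubeR T) xi * U n xi) - (fun xi => \1_(cubeR T) xi * ft u xi) =
     (fun xi => \1_(cubeR T) xi * (U n xi - ft u xi)).
    by apply/funext => xi; rewrite mulrBr.
  apply: (sqn_bounded_support (mcube T) (cube_oo T)).
    exact: (cmeasM (cmeas_indic (mcube T)) (cmeasB (mU n) mft)).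
  move=> xi; rewrite cmodulusM indicCE cmodulusR indicE.
  have [xT|xT] := boolP (xi \in cubeR T); last by rewrite normr0 mul0r mulr0.
  by rewrite normr1 mul1r mulr1; apply: gridft_uniform; rewrite inE in xT.
have cn : \forall n \near \oo, q (fun xi => \1_(cubeR T) xi * U n xi) <= a n <= q (fun xi => \1_(cubeR T) xi * U n xi) + eps.
  exists (2 * T)%N => // n /= nT.
  have := split n; rewrite ltnS nT (gridft_parseval d0 (ltn0Sn n) su) -/(a n) => /(_ isT) ->.
  by rewrite lerDl (lerD2l _ _ eps) tail andbT; exact: (sip_ge0 sip (L2cU n (mTn n) (Tnoo n))).
have le1 : q (fun xi => \1_(cubeR T) xi * ft u xi) <= q u.
  by apply: (ler_cvg_to cb ca); apply: filterS cn => n /andP[].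
have cbe : (fun n => q (fun xi => \1_(cubeR T) xi * U n xi) + eps) @ \oo --> q (fun xi => \1_(cubeR T) xi * ft u xi) + eps.
  by apply: cvgD => //; exact: cvg_cst.
rewrite le1 andbT lerBlDr.
by apply: (ler_cvg_to ca cbe); apply: filterS cn => n /andP[].
Qed.

(** Monotone convergence along growing cubes. Square integrability is part of the conclusion: this
    is how it is first obtained for functions given by a Fourier integral. *)
Lemma cL2_cube_bound (f : Rd R d -> R[i]) (K : R) : cmeas f ->
  (forall T, q (fun x => \1_(cubeR T) x * f x) <= K) -> (forall T, cL2 mu (fun x => \1_(cubeR T) x * f x)) ->
  cL2 mu f /\ q f <= K.
Proof.
move=> mf qK L2T.
pose g n x := (cmodulus (\1_(cubeR n) x * f x) ^+ 2)%:E.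
have mg n : measurable_fun [set: Rd R d] (g n).
  by apply/measurable_EFinP; apply: measurable_sqr_cmodulus; case: (L2T n).
have g0 n x : [set: Rd R d] x -> (0 <= g n x)%E by rewrite lee_fin sqr_ge0.
have gE n x : g n x = (\1_(cubeR n) x * cmodulus (f x) ^+ 2)%:E by rewrite /g (cmodulus_indicM_sqr (T := Rd R d)).
have ndg x : [set: Rd R d] x -> nondecreasing_seq (g^~ x).
  move=> _ m n mn; rewrite !gE lee_fin ler_wpM2r ?sqr_ge0// !indicE ler_nat.
  case: (boolP (x \in cubeR m)) => // /[!inE] /cubeP xm.
  rewrite mem_set//; apply/cubeP => i; rewrite (le_trans (xm i))// ler_nat//.
have lg x : limn (g^~ x) = (cmodulus (f x) ^+ 2)%:E.
  apply: cvg_lim => //.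
  have s0 : 0 <= \sum_(i < d) `|(x : 'rV[R]_d) ord0 i| by exact: sumr_ge0.
  apply: (@cvg_trans _ ((cmodulus (f x) ^+ 2)%:E @[_ --> \oo])); last exact: cvg_cst.
  apply: near_eq_cvg; exists (Num.bound (\sum_(i < d) `|(x : 'rV[R]_d) ord0 i|)) => // n /= bn.
  rewrite gE indicE mem_set ?mul1r//; apply/cubeP => i.
  rewrite (le_trans (y := \sum_(i < d) `|(x : 'rV[R]_d) ord0 i|))//.
    by rewrite (bigD1 i)//= lerDl sumr_ge0.
  by rewrite (le_trans (ltW (archi_boundP s0)))// ler_nat.
have := @cvg_monotone_convergence _ (Rd R d) R mu setT measurableT g mg g0 ndg.
under eq_integral do rewrite lg.
move=> cvg_int.
have sK : (sqL2 mu f <= K%:E)%E.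
  rewrite /sqL2 -(cvg_lim _ cvg_int)//; apply: lime_le; first by apply/cvg_ex; eexists; exact: cvg_int.
  apply: nearW => n; have := sqL2E (L2T n); rewrite /sqL2 /g => ->.
  by rewrite lee_fin.
have L2f : cL2 mu f by split=> //; rewrite (le_lt_trans sK)// ltry.
by split=> //; rewrite -lee_fin -sqL2E.
Qed.

Lemma ft_isometry : cL2 mu (fun xi : Rd R d => ft u xi) /\ q (fun xi : Rd R d => ft u xi) = q u.
Proof.
have L2T T : cL2 mu (fun xi => \1_(cubeR T) xi * ft u xi).
  exact: (cL2_indic_bounded (mcube T) (cube_oo T) mft ft_bounded).
have h T : q (fun xi => \1_(cubeR T) xi * ft u xi) <= q u.
  (* The lower estimate divides by [T], so the cube of radius 0 is treated by enlarging it to radius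
     1. *)
  case: T => [|T]; last by have /andP[] := ft_isometry_cube (ltn0Sn T).
  have /andP[_] := ft_isometry_cube (ltn0Sn 0); apply: le_trans.
  apply: (sqn_le (L2T 0) (L2T 1)) => xi; rewrite !cmodulus_indic_mul.
  rewrite ler_wpM2r ?cmodulus_ge0// !indicE ler_nat.
  case: (boolP (xi \in cubeR 0)) => // /[!inE] /cubeP h.
  by rewrite mem_set//; apply/cubeP => i; rewrite (le_trans (h i))// ler_nat.
have [L2f qf] := cL2_cube_bound mft h L2T.
split=> //; apply/eqP; rewrite eq_le qf/=.
have qT T : q (fun xi => \1_(cubeR T) xi * ft u xi) <= q (fun xi : Rd R d => ft u xi).
  apply: (sqn_le (L2T T) L2f) => xi; rewrite cmodulus_indic_mul.
  by rewrite ler_piMl ?cmodulus_ge0// indicE lern1 leq_b1.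
pose c := L / (2 * pi * sine_slope R).
have cT : (fun n : nat => q u - d%:R * ((c / n.+1%:R) ^+ 2 * V)) @ \oo --> q u.
  rewrite -[X in _ --> X](subr0 (q u)) -[X in _ - X](mulr0 d%:R).
  by apply: cvgB; [exact: cvg_cst|apply: cvgMr; exact: sqr_harmonic_cvg0].
apply: (cvg_ubound cT) => n.
have /andP[] := ft_isometry_cube (ltn0Sn n).
have -> : L / (2 * pi * sine_slope R * n.+1%:R) = c / n.+1%:R by rewrite /c invfM mulrA.
by move=> h1 _; exact: le_trans h1 (qT _).
Qed.

End fourier_isometry.

(** * Density of Lipschitz functions *)

Section L2_density.
Import HBNNSimple.
Context {dT : measure_display} {T : measurableType dT} {R : realType}.
Variable mu : {measure set T -> \bar R}.
Local Notation q := (sqn (L2ip mu)).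
Let sip := L2_semi_ip mu.
Implicit Types f g : T -> R[i].

Lemma sqnL2_ge0 f : 0 <= q f.
Proof. by rewrite sqnL2 Rintegral_ge0// => x _; rewrite sqr_ge0. Qed.

Lemma sqnL2_0 : q 0 = 0.
Proof. by rewrite sqnL2; under eq_Rintegral do rewrite cmodulus0 expr0n; rewrite Rintegral_cst// mul0r. Qed.

Lemma sqn_dominated_cvg (f_ : nat -> T -> R[i]) f (g : T -> R) :
  (forall n, cmeas (f_ n)) -> cmeas f ->
  (forall x, (fun n => cmodulus (f_ n x - f x)) @ \oo --> 0) ->
  integrableR mu (fun x => g x ^+ 2) -> (forall n x, cmodulus (f_ n x) <= g x) ->
  (fun n => q (f_ n - f)) @ \oo --> (0 : R).
Proof.
move=> mf_ mf cf ig fg.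
have fgx x : cmodulus (f x) <= g x.
  have c0 : (fun n => g x + cmodulus (f_ n x - f x)) @ \oo --> g x.
    by rewrite -[X in _ --> X]addr0; apply: cvgD; [exact: cvg_cst|exact: cf].
  apply: (cvg_lbound c0) => n.
  have := ler_cmodulusB (f x) (f_ n x); rewrite (cmodulusB (f x)).
  by have := fg n x; lra.
have mB n : cmeas (f_ n - f) by exact: cmeasB.
have c : (fun n => cmodulus (cint mu (fun x => (f_ n - f) x * conjc ((f_ n - f) x)) - cint mu (fun=> 0))) @ \oo --> 0.
  apply: (cint_dominated_cvg (g := fun x => 4 * g x ^+ 2)).
  - by move=> n; apply: cmeasM => //; exact: cmeasJ.
  - exact: cmeas_cst.
  - move=> x; under eq_fun do rewrite subr0 cmodulusM cmodulusJ.
    by rewrite -(mulr0 0); apply: cvgM; exact: cf.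
  - exact: integrableR_Z.
  - move=> n x; rewrite cmodulusM cmodulusJ -expr2.
    rewrite (le_trans (sqr_cmodulusD_le _ _))// cmodulusN.
    have -> : 4 * g x ^+ 2 = 2 * g x ^+ 2 + 2 * g x ^+ 2 by ring.
    have g0 := le_trans (cmodulus_ge0 _) (fgx x).
    by rewrite lerD// ler_pM2l// ler_sqr ?nnegrE ?cmodulus_ge0.
apply: squeeze_cvg0 c => n; first exact: sqnL2_ge0.
by rewrite cint0 subr0 /sqn (le_trans _ (Re_le_cmodulus _))// ler_norm.
Qed.

Variable D : set (T -> R[i]).
Hypothesis DL2 : forall f, D f -> cL2 mu f.
Hypothesis D0 : D 0.
Hypothesis DD : forall f g, D f -> D g -> D (f + g).
Hypothesis DZ : forall (c : R[i]) f, D f -> D (c *: f).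

(** The $L^2$ closure of the subspace [D]. It is closed under linear combinations and $L^2$ limits,
    so its being everything reduces to indicators of sets of finite measure. *)
Definition approximable f := forall e, 0 < e -> exists2 g, D g & q (g - f) <= e.

Lemma approximable_mem f : D f -> approximable f.
Proof. by move=> Df e e0; exists f => //; rewrite subrr sqnL2_0 ltW. Qed.

Lemma approximable_cvg (f_ : nat -> T -> R[i]) f :
  (forall n, cL2 mu (f_ n)) -> cL2 mu f -> (forall n, approximable (f_ n)) ->
  (fun n => q (f_ n - f)) @ \oo --> (0 : R) -> approximable f.
Proof.
move=> L2f_ L2f af_ cf e e0.
have e4 : 0 < e / 4 by rewrite divr_gt0.
have /cvgrPdist_le/(_ _ e4)[N _ /(_ N (leqnn N))] := cf.
rewrite sub0r normrN ger0_norm ?sqnL2_ge0// => qN.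
have [g Dg qg] := af_ N _ e4.
exists g => //.
have -> : g - f = (g - f_ N) + (f_ N - f) by rewrite addrA subrK.
have := sqnD_le sip (sipHB sip (DL2 Dg) (L2f_ N)) (sipHB sip (L2f_ N) L2f).
by lra.
Qed.

Lemma approximableD f g : cL2 mu f -> cL2 mu g -> approximable f -> approximable g -> approximable (f + g).
Proof.
move=> L2f L2g af ag e e0.
have e4 : 0 < e / 4 by rewrite divr_gt0.
have [f1 Df1 q1] := af _ e4; have [g1 Dg1 q2] := ag _ e4.
exists (f1 + g1); first exact: DD.
have -> : f1 + g1 - (f + g) = (f1 - f) + (g1 - g) by rewrite opprD addrACA.
have := sqnD_le sip (sipHB sip (DL2 Df1) L2f) (sipHB sip (DL2 Dg1) L2g).
by lra.
Qed.

Lemma approximableZ c f : cL2 mu f -> approximable f -> approximable (c *: f).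
Proof.
move=> L2f af e e0.
have c0 : 0 < cmodulus c ^+ 2 + 1 by rewrite ltr_wpDl ?sqr_ge0.
have [f1 Df1 q1] := af _ (divr_gt0 e0 c0).
exists (c *: f1); first exact: DZ.
rewrite -scalerBr (sqnZ sip _ (sipHB sip (DL2 Df1) L2f)).
rewrite (le_trans (ler_wpM2l (sqr_ge0 _) q1))// mulrCA ger_pMr// ler_pdivrMr//.
by rewrite mul1r lerDl.
Qed.

Lemma approximable_sum (I : Type) (s : seq I) (F : I -> T -> R[i]) :
  (forall i, cL2 mu (F i) /\ approximable (F i)) ->
  cL2 mu (\sum_(i <- s) F i) /\ approximable (\sum_(i <- s) F i).
Proof.
move=> F_; elim: s => [|i s [L2s as_]].
  by rewrite big_nil; split; [exact: cL2_0|exact: approximable_mem].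
rewrite big_cons; have [L2i ai] := F_ i.
by split; [exact: (sipHD sip)|exact: approximableD].
Qed.

Hypothesis approximable_indic : forall E, measurable E -> (mu E < +oo)%E ->
  approximable (fun x => \1_E x).

Let fR (g : T -> R) : T -> R[i] := (fun x => (g x)%:C)%C.

Lemma cmeas_fR (g : T -> R) : measurable_fun setT g -> cmeas (fR g).
Proof. by move=> mg; split => //=; exact: measurable_cst. Qed.

Lemma cL2_fR (g : T -> R) : measurable_fun setT g -> integrableR mu (fun x => g x ^+ 2) -> cL2 mu (fR g).
Proof.
move=> mg ig; apply: (cL2_le (cmeas_fR mg) ig) => x.
by rewrite /fR cmodulusR real_normK ?num_real.
Qed.

Lemma approximable_scaled_indic (g : T -> R) (c : R) E : measurable E ->
  integrableR mu (fun x => g x ^+ 2) -> (forall x, `|c * \1_E x| <= g x) ->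
  cL2 mu (fR (fun x => c * \1_E x)) /\ approximable (fR (fun x => c * \1_E x)).
Proof.
move=> mE ig cg.
have mcE : measurable_fun setT (fun x => c * \1_E x) by exact: measurable_funM.
have L2E : cL2 mu (fR (fun x => c * \1_E x)).
  apply: (cL2_le (cmeas_fR mcE) ig) => x; rewrite /fR cmodulusR.
  by rewrite ler_sqr ?nnegrE// (le_trans _ (cg x)).
split=> //; have [->|c0] := eqVneq c 0.
  by under [X in approximable X]eq_fun do rewrite mul0r; exact: approximable_mem.
(* For $c\ne 0$ the indicator of [E] is at most $c^{-2}g^2$, which is integrable. A simple function
   below a square integrable one thus has levels of finite measure. *)
have Eoo : (mu E < +oo)%E.
  have ic : integrableR mu (fun x => c^-2 * g x ^+ 2) by exact: integrableR_Z.
  have /integrableP[mc ico] := ic.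
  apply: le_lt_trans ico; rewrite -(setIT E) -(integral_indic mu measurableT mE).
  apply: ge0_le_integral => //.
  - by apply/measurable_EFinP; exact: measurable_indic.
  - by apply/measurable_EFinP; apply: measurableT_comp => //; apply/measurable_EFinP.
  - move=> x _; rewrite /= lee_fin; have := cg x.
    rewrite indicE; case: (x \in E) => [|_]; last by rewrite normr_ge0.
    rewrite mulr1 => h; have nn : 0 <= c ^- 2 * g x ^+ 2 by rewrite mulr_ge0 ?invr_ge0 ?(sqr_ge0 c) ?(sqr_ge0 (g x)).
    rewrite (ger0_norm nn).
    rewrite mulrC ler_pdivlMr ?mul1r; last by rewrite lt_def sqrf_eq0 c0 sqr_ge0.
    have gx0 := le_trans (normr_ge0 _) h.
    by rewrite -(real_normK (num_real c)) ler_sqr ?nnegrE.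
have -> : fR (fun x => c * \1_E x) = (c%:C)%C *: (fun x => \1_E x : R[i]).
  by apply/funext => x; rewrite /fR rmorphM/= -indicCE.
apply: approximableZ; last exact: approximable_indic.
apply: (cL2_bounded_support mE Eoo (cmeas_indic mE) (K := 1)) => x.
by rewrite indicCE cmodulusR mul1r ger0_norm.
Qed.

Lemma approximable_ge0 (g : T -> R) : measurable_fun setT g -> (forall x, 0 <= g x) ->
  integrableR mu (fun x => g x ^+ 2) -> approximable (fR g).
Proof.
move=> mg g0 ig.
have mge : measurable_fun setT (fun x => (g x)%:E) by exact/measurable_EFinP.
pose hs n := nnsfun_approx measurableT mge n; pose h n : T -> R := hs n.
have cvh (x : T) : (fun n => h n x) @ \oo --> g x.
  have := cvg_nnsfun_approx measurableT mge (fun x _ => g0 x : (0 <= (g x)%:E)%E) (I : setT x).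
  by move/fine_cvgP => [].
have hg n (x : T) : h n x <= g x.
  have nd : nondecreasing_seq (h^~ x).
    by move=> a b ab; exact/lefP/(nd_nnsfun_approx measurableT mge).
  rewrite -(cvg_lim _ (cvh x))//; apply: nondecreasing_cvgn_le => //.
  by apply/cvg_ex; exists (g x); exact: cvh.
have hh n : cL2 mu (fR (h n)) /\ approximable (fR (h n)).
  pose s := fset_set (hs n @` setT).
  have -> : fR (h n) = \sum_(i < #|`s|) fR (fun x => s`_i * \1_(h n @^-1` [set s`_i]) x).
    apply/funext => x; rewrite fct_sumE /fR /h fimfunEord rmorph_sum//.
  apply: approximable_sum => i; apply: (approximable_scaled_indic _ ig) => // x.
  rewrite indicE; case: (boolP (x \in _)) => [|_]; last by rewrite mulr0 normr0.
  by move=> /set_mem /= <-; rewrite mulr1 ger0_norm.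
apply: (approximable_cvg (fun n => (hh n).1) (cL2_fR mg ig) (fun n => (hh n).2)).
have cm n : cmeas (fR (h n)) by have [L2h _] := hh n; case: L2h.
apply: (sqn_dominated_cvg cm (cmeas_fR mg) _ ig) => [x|n x]; last by rewrite /fR cmodulusR ger0_norm.
under eq_fun do rewrite /fR -rmorphB/= cmodulusR.
by apply/norm_cvg0P; rewrite -(subrr (g x)); apply: cvgB; [exact: cvh|exact: cvg_cst].
Qed.

Lemma approximable_L2 f : cL2 mu f -> approximable f.
Proof.
move=> L2f; have [mf1 mf2] : cmeas f by case: L2f.
have isq := cL2_sqr_integrable L2f.
have key (g : T -> R) : measurable_fun setT g -> (forall x, `|g x| <= cmodulus (f x)) ->
    cL2 mu (fR g) /\ approximable (fR g).
  move=> mg gf.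
  have fge (p : T -> R) : measurable_fun setT p -> (forall x, 0 <= p x) -> (forall x, p x <= cmodulus (f x)) -> cL2 mu (fR p) /\ approximable (fR p).
    move=> mp p0 pf.
    have L2p : cL2 mu (fR p).
      apply: (cL2_le (cmeas_fR mp) isq) => x; rewrite cmodulusR ger0_norm//.
      by rewrite ler_sqr ?nnegrE ?cmodulus_ge0.
    split=> //; apply: approximable_ge0 => //.
    have := cL2_sqr_integrable L2p.
    by under eq_fun do rewrite /fR cmodulusR ger0_norm//.
  have [|x|x|L2p ap] := fge (fun x => Num.max (g x) 0).
  - exact: measurable_maxr.
  - by rewrite le_max lexx orbT.
  - by rewrite ge_max cmodulus_ge0 andbT (le_trans (ler_norm _) (gf x)).
  have [|x|x|L2n an] := fge (fun x => Num.max (- g x) 0).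
  - by apply: measurable_maxr => //; exact: measurableT_comp.
  - by rewrite le_max lexx orbT.
  - by rewrite ge_max cmodulus_ge0 andbT (le_trans (ler_norm _))// normrN.
  have -> : fR g = fR (fun x => Num.max (g x) 0) + (-1) *: fR (fun x => Num.max (- g x) 0).
    apply/funext => x; rewrite /fR scaleN1r -[RHS]/(_ - _) -rmorphB/=; congr (_%:C)%C.
    by case: (ltP (g x) 0); case: (ltP (- g x) 0); lra.
  by split; [exact: (sipHD sip _ (sipHZ sip _ L2n))|apply: approximableD => //; [exact: (sipHZ sip)|exact: approximableZ]].
have [L1 a1] := key _ mf1 (fun x => Re_le_cmodulus (f x)).
have [L2 a2] := key _ mf2 (fun x => Im_le_cmodulus (f x)).
have -> : f = fR (fun x => complex.Re (f x)) + 'i%C *: fR (fun x => complex.Im (f x)).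
  apply/funext => x; rewrite /fR -[RHS]/(_ + _ * _) [LHS]complexE.
  by [].
by apply: approximableD => //; [exact: (sipHZ sip)|exact: approximableZ].
Qed.

End L2_density.

(** * Tent functions over boxes *)

Section tents.
Context {R : realType} {d : nat}.
Implicit Types (x y a b : 'rV[R]_d) (I J : 'rV[R]_d * 'rV[R]_d) (m n M : nat).

(** For $I_1\le I_2$ this is the distance from a coordinate to the side of the box. The formula also
    makes sense for reversed endpoints, where it is positive everywhere, so empty boxes need no
    separate treatment. *)
Definition idist I x i : R := Num.max 0 (Num.max (I.1 ord0 i - x ord0 i) (x ord0 i - I.2 ord0 i)).

(** One minus $m$ times the $\ell^1$ distance to the box, cut off at 0; as $m$ grows it tends to the
    indicator of the closed box. *)
Definition tent I m x : R := Num.max 0 (1 - m%:R * \sum_(i < d) idist I x i).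

Lemma idist_ge0 I x i : 0 <= idist I x i.
Proof. by rewrite /idist le_max lexx. Qed.

Lemma tent_ge0 I m x : 0 <= tent I m x.
Proof. by rewrite /tent le_max lexx. Qed.

Lemma tent_le1 I m x : tent I m x <= 1.
Proof.
rewrite /tent ge_max ler01 lerBlDr lerDl mulr_ge0// sumr_ge0// => i _.
exact: idist_ge0.
Qed.

Lemma idist0 I x i : (idist I x i == 0) = (I.1 ord0 i <= x ord0 i <= I.2 ord0 i).
Proof.
rewrite eq_le idist_ge0 andbT /idist !ge_max lexx/= subr_le0 subr_le0//.
Qed.

Lemma tent_box I m x : box I x -> tent I m x = 1.
Proof.
move=> Ix; rewrite /tent big1 ?mulr0 ?subr0; last first.
  by move=> i _; apply/eqP; rewrite idist0 Ix.
by apply/max_idPr.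
Qed.

Lemma tent_out I m x i : (1 <= m%:R * idist I x i) -> tent I m x = 0.
Proof.
move=> h; apply/max_idPl; rewrite subr_le0 (le_trans h)// ler_wpM2l//.
by rewrite (bigD1 i)//= lerDl sumr_ge0// => j _; exact: idist_ge0.
Qed.

Lemma max_lip (u v u' v' h : R) : `|u - u'| <= h -> `|v - v'| <= h ->
  `|Num.max u v - Num.max u' v'| <= h.
Proof.
rewrite !ler_norml => /andP[h1 h2] /andP[h3 h4].
by case: (ltP u v) => ?; case: (ltP u' v') => ?; apply/andP; split; lra.
Qed.

Lemma idist_lip I x y i (h : R) : `|x ord0 i - y ord0 i| <= h ->
  `|idist I x i - idist I y i| <= h.
Proof.
move=> hx; have h0 : 0 <= h := le_trans (normr_ge0 _) hx.
apply: max_lip; first by rewrite subrr normr0.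
apply: max_lip.
  by rewrite opprB addrC addrA subrK distrC.
by rewrite opprB addrA subrK.
Qed.

Lemma tent_lip I m x y (h : R) : (forall i, `|x ord0 i - y ord0 i| <= h) -> 0 <= h ->
  `|tent I m x - tent I m y| <= (m * d)%:R * h.
Proof.
move=> hx h0; apply: max_lip; first by rewrite subrr normr0 mulr_ge0.
rewrite opprB addrC addrA subrK -mulrBr normrM ger0_norm// natrM -mulrA ler_wpM2l//.
rewrite -sumrB (le_trans (ler_norm_sum _ _ _))//.
rewrite -[d in d%:R]card_ord -sumr_const mulr_suml; apply: ler_sum => i _.
by rewrite mul1r distrC idist_lip.
Qed.

Lemma box_bounded I : exists M, forall i, `|I.1 ord0 i| <= M%:R /\ `|I.2 ord0 i| <= M%:R.
Proof.
pose s := \sum_(i < d) (`|I.1 ord0 i| + `|I.2 ord0 i|).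
have s0 : 0 <= s by apply: sumr_ge0 => i _; rewrite addr_ge0.
exists (Num.bound s) => i.
have : `|I.1 ord0 i| + `|I.2 ord0 i| <= (Num.bound s)%:R.
  rewrite (le_trans _ (ltW (archi_boundP s0)))// /s (bigD1 i)//= lerDl.
  by apply: sumr_ge0 => j _; rewrite addr_ge0.
have := normr_ge0 (I.1 ord0 i); have := normr_ge0 (I.2 ord0 i).
by split; lra.
Qed.

Lemma tent_supported I m x M : (0 < m)%N ->
  (forall i, `|I.1 ord0 i| <= M%:R /\ `|I.2 ord0 i| <= M%:R) ->
  tent I m x != 0 -> forall i, `|x ord0 i| < M.+1%:R.
Proof.
move=> m0 IM tx i; have [h1 h2] := IM i.
have : ~~ (1 <= m%:R * idist I x i) by apply: contra tx => h; rewrite (tent_out h).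
rewrite -ltNge => h.
have {}h : idist I x i < 1.
  rewrite (le_lt_trans _ h)// ler_peMl ?idist_ge0// ler1n//.
move: h; rewrite /idist !gt_max => /and3P[_ h3 h4].
move: h1 h2; rewrite !ler_norml ltr_norml -natr1 => /andP[? ?] /andP[? ?].
by apply/andP; split; lra.
Qed.

Lemma lipc_tent I m : (0 < m)%N -> exists M, lipc M (m * d)%:R (fun x => (tent I m x)%:C)%C.
Proof.
move=> m0; have [M IM] := box_bounded I; exists M.+1; split=> //.
  move=> x tx i; apply: (tent_supported m0 IM).
  by apply: contra tx => /eqP ->.
by move=> x y h h0 hx; rewrite -rmorphB/= cmodulusR; exact: tent_lip.
Qed.

End tents.

Section lipschitz_algebra.
Context {R : realType} {d : nat}.
Hypothesis d0 : (0 < d)%N.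
Local Notation mu := (lebesgue_Rd R d).
Implicit Types (u v : 'rV[R]_d -> R[i]).

Definition clip : set ('rV[R]_d -> R[i]) := [set u | exists M L, lipc M L u].

Lemma clip0 : clip 0.
Proof.
exists 0%N, 0; split=> //; first by move=> x /eqP.
by move=> x y h h0 _; rewrite subrr cmodulus0 mul0r.
Qed.

Lemma clipD u v : clip u -> clip v -> clip (u + v).
Proof.
move=> [M [L [L0 su lu]]] [M' [L' [L0' sv lv]]]; exists (maxn M M'), (L + L'); split.
- exact: addr_ge0.
- move=> x ux; have [u0|] := eqVneq (u x) 0; last first.
    exact: (supportedW (leq_maxl _ _) su).
  apply: (supportedW (leq_maxr _ _) sv); move: ux.
  by rewrite /GRing.add/= u0 add0r.
- move=> x y h h0 hx.
  have -> : (u + v) x - (u + v) y = (u x - u y) + (v x - v y) by rewrite opprD addrACA.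
  by rewrite mulrDl (le_trans (cmodulusD _ _))// lerD// ?lu ?lv.
Qed.

Lemma clipZ (c : R[i]) u : clip u -> clip (c *: u).
Proof.
move=> [M [L [L0 su lu]]]; exists M, (cmodulus c * L); split.
- by rewrite mulr_ge0// cmodulus_ge0.
- move=> x ux; apply: su; apply: contra ux => /eqP u0.
  by rewrite -[X in X == _]/(c * u x) u0 mulr0.
- move=> x y h h0 hx; rewrite /GRing.scale/= -mulrBr cmodulusM -mulrA.
  by rewrite ler_wpM2l ?cmodulus_ge0// lu.
Qed.

Lemma clipJ u : clip u -> clip (fun x => conjc (u x)).
Proof.
move=> [M [L [L0 su lu]]]; exists M, L; split=> //.
- by move=> x ux; apply: su; apply: contra ux => /eqP ->; rewrite conjc0.
- by move=> x y h h0 hx; rewrite -rmorphB/= cmodulusJ lu.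
Qed.

Lemma clipM u v : clip u -> clip v -> clip (fun x => u x * v x).
Proof.
move=> [M [L uL]] [M' [L' vL]]; have [L0 su lu] := uL; have [L0' sv lv] := vL.
exists M, (L * (2 * M%:R) * L' + L * (L' * (2 * M'%:R))); split.
- by rewrite addr_ge0// !mulr_ge0.
- by move=> x; rewrite mulf_eq0 negb_or => /andP[ux _]; exact: su.
- move=> x y h h0 hx.
  have -> : u x * v x - u y * v y = u x * (v x - v y) + (u x - u y) * v y by ring.
  rewrite (le_trans (cmodulusD _ _))// !cmodulusM mulrDl lerD//.
    by rewrite -mulrA ler_pM ?cmodulus_ge0 ?lv//; exact: (lipc_bounded d0 uL).
  rewrite mulrAC ler_pM ?cmodulus_ge0 ?lu//; exact: (lipc_bounded d0 vL).
Qed.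

Lemma clip_tent I m : (0 < m)%N -> clip (fun x => (tent I m x)%:C)%C.
Proof. by move=> /(lipc_tent I)[M h]; exists M, (m * d)%:R. Qed.

Lemma clip_cL2 u : clip u -> cL2 mu (u : Rd R d -> R[i]).
Proof. by move=> [M [L uL]]; exact: (cL2_lipc d0 uL). Qed.

Lemma clip_cL1 u : clip u -> cL1 mu (u : Rd R d -> R[i]).
Proof. by move=> [M [L uL]]; exact: (cL1_lipc d0 uL). Qed.

End lipschitz_algebra.

Section lipschitz_density.
Context {R : realType} {d : nat}.
Hypothesis d0 : (0 < d)%N.
Local Notation mu := (lebesgue_Rd R d).
Local Notation q := (sqn (L2ip mu)).
Implicit Types (I J : 'rV[R]_d * 'rV[R]_d) (m n M : nat).
Let sip := @L2_semi_ip _ _ _ mu.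
Let appr (f : Rd R d -> R[i]) := approximable mu (@clip R d : set (Rd R d -> R[i])) f.
Let ind (E : set 'rV[R]_d) : Rd R d -> R[i] := fun x => \1_E x.

Let DL2 (u : Rd R d -> R[i]) : (@clip R d : set (Rd R d -> R[i])) u -> cL2 mu u := @clip_cL2 R d d0 u.
Let approxD := approximableD DL2 (@clipD R d).
Let approxZ := approximableZ DL2 (@clipZ R d).

Let mbox I : (lebesgue_outer R d).-cara.-measurable (box I).
Proof. exact: measurable_box. Qed.

Let box_oo I : (mu (box I) < +oo)%E.
Proof. by rewrite /lebesgue_Rd lebesgue_outer_box// ltry. Qed.

Lemma cL2_ind E : (lebesgue_outer R d).-cara.-measurable E -> (mu E < +oo)%E -> cL2 mu (ind E).
Proof.
move=> mE Eoo; apply: (cL2_bounded_support (E := E) (K := 1) mE Eoo (cmeas_indic mE)) => x.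
by rewrite /ind indicCE cmodulusR mul1r ger0_norm.
Qed.

Lemma integrableR_indic_sqr E : (lebesgue_outer R d).-cara.-measurable E -> (mu E < +oo)%E ->
  integrableR mu (fun x => \1_E x ^+ 2).
Proof.
move=> mE Eoo; have := cL2_sqr_integrable (cL2_ind mE Eoo).
by under eq_fun do rewrite /ind indicCE cmodulusR ger0_norm//.
Qed.

Lemma approximable_box I : appr (ind (box I)).
Proof.
pose f m : Rd R d -> R[i] := fun x => (tent I m.+1 x)%:C%C.
have cf m : clip (f m) by exact: clip_tent.
have [M IM] := box_bounded I.
have mC := @measurable_box R d (const_mx (- M.+1%:R), const_mx M.+1%:R).
apply: (approximable_cvg DL2 (f_ := f)).
- by move=> m; exact: DL2.
- exact: cL2_ind.
- by move=> m; exact: (approximable_mem mu (cf m)).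
refine (@sqn_dominated_cvg _ (Rd R d) R mu f (ind (box I)) (\1_(cube M.+1%:R)) _ _ _ _ _).
- by move=> m; case: (DL2 (cf m)).
- exact: cmeas_indic.
- move=> x; have [Ix|Ix] := pselect (box I x).
    rewrite [X in X @ _](_ : _ = fun=> 0); first exact: cvg_cst.
    apply/funext => m; rewrite /f tent_box// /ind indicCE indicE mem_set//.
    by rewrite subrr cmodulus0.
  have [i Ii] : exists i, idist I x i != 0.
    apply: contrapT => /forallNP h; apply: Ix => i; rewrite -idist0.
    by apply/negPn/negP; exact: h.
  have ip : 0 < idist I x i by rewrite lt_def Ii idist_ge0.
  apply: (@cvg_trans _ (0 @[_ --> \oo])); last exact: cvg_cst.
  apply: near_eq_cvg; exists (Num.bound (idist I x i)^-1) => // m /= bm.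
  rewrite /f (@tent_out _ _ _ _ _ i); last first.
    rewrite -ler_pdivrMr// mul1r.
    rewrite (le_trans (ltW (archi_boundP (ltW _))))// ?invr_gt0// ler_nat.
    by rewrite (leq_trans bm).
  by rewrite /ind indicCE indicE memNset// subrr cmodulus0.
- by apply: (integrableR_indic_sqr mC); exact: cube_finite.
- move=> m x; rewrite /f cmodulusR ger0_norm ?tent_ge0//.
  have [->|tx] := eqVneq (tent I m.+1 x) 0; first by [].
  rewrite indicE mem_set ?tent_le1//; apply/cubeP => i.
  exact: ltW (tent_supported _ IM tx i).
Qed.

Definition boxI I J := (\row_i Num.max (I.1 ord0 i) (J.1 ord0 i), \row_i Num.min (I.2 ord0 i) (J.2 ord0 i)).

Lemma box_boxI I J : box (boxI I J) = box I `&` box J.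
Proof.
apply/seteqP; split => [x h|x [h1 h2] i].
  by split => i; have := h i; rewrite !mxE ge_max le_min => /andP[/andP[? ?] /andP[? ?]]; apply/andP.
rewrite !mxE ge_max le_min.
by have /andP[-> ->] := h1 i; have /andP[-> ->] := h2 i.
Qed.

Let W (I : nat -> 'rV[R]_d * 'rV[R]_d) n := \big[setU/set0]_(k < n) box (I k).

Let mW (I : nat -> 'rV[R]_d * 'rV[R]_d) n : (lebesgue_outer R d).-cara.-measurable (W I n).
Proof. exact: (@bigsetU_measurable _ (Rd R d)). Qed.

Let W_oo (I : nat -> 'rV[R]_d * 'rV[R]_d) n : (mu (W I n) < +oo)%E.
Proof.
elim: n => [|n IH]; first by rewrite /W big_ord0 measure0.
rewrite /W big_ord_recr/=; apply: (le_lt_trans (outer_measureU2 (lebesgue_outer R d) _ _)); rewrite -!/(lebesgue_Rd R d _).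
exact: (lte_add_pinfty IH (box_oo (I n))).
Qed.

(** Inclusion and exclusion of the last box. The induction ranges over all families because the
    intersection of the earlier union with that box is again a union of [n] boxes. *)
Lemma approximable_boxes n (I : nat -> 'rV[R]_d * 'rV[R]_d) : appr (ind (W I n)).
Proof.
elim: n I => [|n IH] I.
  have -> : ind (W I 0) = 0 by apply/funext => x; rewrite /ind /W big_ord0 indic0.
  exact: (approximable_mem mu (@clip0 R d)).
have E : W I n `&` box (I n) = W (fun k => boxI (I k) (I n)) n.
  by rewrite /W big_distrl/=; apply: eq_bigr => k _; rewrite box_boxI.
have -> : ind (W I n.+1) = ind (W I n) + ind (box (I n)) + (-1) *: ind (W (fun k => boxI (I k) (I n)) n).
  apply/funext => x; rewrite -E scaleN1r /ind -[RHS]/(_ + _ - _) !indicCE -!rmorphD/= -rmorphB/=.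
  congr (_%:C)%C; rewrite !indicE /W big_ord_recr/= in_setU in_setI.
  by case: (x \in _); case: (x \in _); rewrite /= ?addr0 ?subr0 ?add0r ?addrK ?subrr.
have L2W := fun (I : nat -> 'rV[R]_d * 'rV[R]_d) n => cL2_ind (mW I n) (W_oo I n).
have L2b := cL2_ind (mbox (I n)) (box_oo (I n)).
apply: approxD; first exact: (sipHD sip).
- exact: (sipHZ sip).
- exact: (approxD (L2W I n) L2b (IH I) (approximable_box (I n))).
- exact: (approxZ (-1) (L2W _ _) (IH _)).
Qed.

(** By definition of the outer measure, [E] lies in a countable union of boxes of almost the same
    measure, and that union is the limit of finite unions. *)
Lemma approximable_clip_indic E : (lebesgue_outer R d).-cara.-measurable E -> (mu E < +oo)%E -> appr (ind E).
Proof.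
move=> mE Eoo.
have cover e : 0 < e -> exists2 g, cL2 mu g /\ appr g & q (g - ind E) <= e.
  move=> e0; have [I EI sumI] := lebesgue_outer_cover d0 Eoo e0.
  pose U := \bigcup_n box (I n).
  have mU : (lebesgue_outer R d).-cara.-measurable U by exact: (@bigcupT_measurable _ (Rd R d)).
  have UE : (mu U <= mu E + e%:E)%E.
    apply: le_trans sumI.
    apply: (le_trans (outer_measure_sigma_subadditive (lebesgue_outer R d) (fun n => box (I n)))).
    by apply: lee_nneseries => // n _; rewrite le_eqVlt; apply/orP; left; apply/eqP; exact: lebesgue_outer_box.
  have Uoo : (mu U < +oo)%E by rewrite (le_lt_trans UE)// lte_add_pinfty// ltry.
  exists (ind U); first split.
  - exact: cL2_ind.
  - apply: (approximable_cvg DL2 (f_ := fun n => ind (W I n))).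
    + by move=> n; exact: cL2_ind.
    + exact: cL2_ind.
    + by move=> n; exact: approximable_boxes.
    refine (@sqn_dominated_cvg _ (Rd R d) R mu (fun n => ind (W I n)) (ind U) (\1_U) _ _ _ _ _).
    + by move=> n; exact: cmeas_indic.
    + exact: cmeas_indic.
    + move=> x; have [[k _ Ix]|Ux] := pselect (U x).
        apply: (@cvg_trans _ (0 @[_ --> \oo])); last exact: cvg_cst.
        apply: near_eq_cvg; exists k.+1 => // n /= kn.
        rewrite /ind !indicCE !indicE (mem_set (A := U)); last by exists k.
        rewrite mem_set ?subrr ?cmodulus0//.
        by rewrite /W -(bigcup_mkord n (fun k => box (I k))); exists k.
      rewrite [X in X @ _](_ : _ = fun=> 0); first exact: cvg_cst.
      apply/funext => n; rewrite /ind !indicCE !indicE (memNset Ux).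
      rewrite memNset ?subrr ?cmodulus0//.
      by rewrite /W -(bigcup_mkord n (fun k => box (I k))) => -[k _ Ix]; apply: Ux; exists k.
    + exact: integrableR_indic_sqr.
    + move=> n x; rewrite /ind indicCE cmodulusR ger0_norm// !indicE ler_nat.
      case: (boolP (x \in W I n)) => // /set_mem; rewrite /W -(bigcup_mkord n (fun k => box (I k))) => -[k _ Ix].
      by rewrite mem_set//; exists k.
  have mD : (lebesgue_outer R d).-cara.-measurable (U `\` E) by exact: (@measurableD _ (Rd R d)).
  have Doo : (mu (U `\` E) < +oo)%E.
    by apply: le_lt_trans Uoo; apply: le_outer_measure => x [].
  have := sqn_bounded_support mD Doo (cmeasB (cmeas_indic mU) (cmeas_indic mE)) (K := 1).
  rewrite expr1n mul1r => h; apply: (le_trans (h _)) => [x|].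
    rewrite mul1r !indicCE -rmorphB/= cmodulusR !indicE in_setD.
    case: (boolP (x \in E)) => [/set_mem/EI Ux|_]; last by rewrite subr0 andbT ger0_norm.
    by rewrite (mem_set Ux) subrr normr0.
  have Efin : mu E \is a fin_num by rewrite ge0_fin_numE.
  rewrite -lee_fin fineK ?ge0_fin_numE//.
  rewrite measureD//= setIidr//.
  by rewrite leeBlDr// addeC.
have L2E := cL2_ind mE Eoo.
have [g gP] : {g : nat -> Rd R d -> R[i] & forall n, (cL2 mu (g n) /\ appr (g n)) /\ q (g n - ind E) <= n.+1%:R^-1}.
  apply: (@choice _ _ (fun n g => (cL2 mu g /\ appr g) /\ q (g - ind E) <= n.+1%:R^-1)) => n.
  have n0 : 0 < n.+1%:R^-1 :> R by rewrite invr_gt0.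
  by have [g g1 g2] := cover _ n0; exists g.
apply: (approximable_cvg DL2 (f_ := g)) => //.
- by move=> n; have [[]] := gP n.
- by move=> n; have [[]] := gP n.
apply: squeeze_cvg0 (@cvg_harmonic R) => n; first exact: sqnL2_ge0.
by have [_] := gP n.
Qed.

Lemma clip_dense f : cL2 mu f -> appr f.
Proof.
move=> L2f; apply: (approximable_L2 DL2 (@clip0 R d) (@clipD R d) (@clipZ R d) _ L2f).
exact: approximable_clip_indic.
Qed.

End lipschitz_density.

(** * The Fourier transform on L^2 *)

Section fubini_complex.
Context {d1 d2 : measure_display} {X : measurableType d1} {Y : measurableType d2} {R : realType}.
Variables (m1 : {sigma_finite_measure set X -> \bar R}) (m2 : {sigma_finite_measure set Y -> \bar R}).
Variables (a : X -> R) (b : Y -> R).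
Hypotheses (ia : integrableR m1 a) (ib : integrableR m2 b).

Let slice1 (g : X * Y -> R) : measurable_fun setT g ->
  (forall z, `|g z| <= a z.1 * b z.2) -> forall x, integrableR m2 (fun y => g (x, y)).
Proof.
move=> mg gab x; have ixb := integrableR_Z (a x) ib.
apply: (le_integrable measurableT _ _ ixb).
  by apply/measurable_EFinP; exact: measurableT_comp mg (pair1_measurable x).
by move=> y _; rewrite /= lee_fin (le_trans (gab (x, y)))// ler_norm.
Qed.

Let slice2 (g : X * Y -> R) : measurable_fun setT g ->
  (forall z, `|g z| <= a z.1 * b z.2) -> forall y, integrableR m1 (fun x => g (x, y)).
Proof.
move=> mg gab y; have ixb := integrableR_Z (b y) ia.
apply: (le_integrable measurableT _ _ ixb).
  by apply/measurable_EFinP; exact: measurableT_comp mg (pair2_measurable y).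
by move=> x _; rewrite /= lee_fin (le_trans (gab (x, y)))// mulrC ler_norm.
Qed.

(** The product bound makes every slice integrable, not just almost every one, so the finite parts
    in [Rintegral] can be removed at each point. *)
Lemma Rintegral_Fubini (g : X * Y -> R) : measurable_fun setT g ->
  (forall z, `|g z| <= a z.1 * b z.2) ->
  \int[m1]_x \int[m2]_y g (x, y) = \int[m2]_y \int[m1]_x g (x, y).
Proof.
move=> mg gab.
have mge : measurable_fun setT (fun z => (g z)%:E) by exact/measurable_EFinP.
have ig : (m1 \x m2)%E.-integrable setT (fun z => (g z)%:E).
  apply/(integrable12ltyP m1 m2 mge).
  pose B := \int[m2]_y b y.
  have iaB : integrableR m1 (fun x => a x * B).
    by have := integrableR_Z B ia; under eq_fun do rewrite mulrC.
  have h x : (\int[m2]_y `|(g (x, y))%:E| <= (a x * B)%:E)%E.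
    have ixb := integrableR_Z (a x) ib.
    have -> : (a x * B)%:E = (\int[m2]_y (a x * b y)%:E)%E.
      by rewrite -(RintegralZl _ measurableT ib) /Rintegral fineK//; exact: (integrable_fin_num measurableT ixb).
    apply: ge0_le_integral => //.
    - apply: measurableT_comp => //; apply/measurable_EFinP.
      exact: measurableT_comp mg (pair1_measurable x).
    - by case/integrableP: ixb.
    - by move=> y _; rewrite lee_fin (gab (x, y)).
  case/integrableP: (iaB) => miaB; apply: le_lt_trans.
  apply: ge0_le_integral => //.
  - by move=> x _; exact: integral_ge0.
  - exact: (@measurable_fun_fubini_tonelli_F _ _ _ _ _ m2 (fun z => `|(g z)%:E|)%E (measurableT_comp (@abse_measurable R setT) mge)).
  - exact: measurableT_comp.
  - move=> x _; rewrite (le_trans (h x))// lee_fin ler_norm//.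
have := Fubini ig; rewrite /Rintegral => E; congr fine.
transitivity (\int[m1]_x \int[m2]_y (g (x, y))%:E)%E.
  apply: eq_integral => x _; rewrite fineK//.
  exact: (integrable_fin_num measurableT (slice1 mg gab x)).
rewrite E; apply: eq_integral => y _; rewrite fineK//.
exact: (integrable_fin_num measurableT (slice2 mg gab y)).
Qed.

Lemma cint_Fubini (f : X * Y -> R[i]) : cmeas f -> (forall z, cmodulus (f z) <= a z.1 * b z.2) ->
  cint m1 (fun x => cint m2 (fun y => f (x, y))) = cint m2 (fun y => cint m1 (fun x => f (x, y))).
Proof.
move=> [mf1 mf2] fab; rewrite /cint /=; congr (_ +i* _)%C.
  exact: (Rintegral_Fubini mf1 (fun z => le_trans (Re_le_cmodulus _) (fab z))).
exact: (Rintegral_Fubini mf2 (fun z => le_trans (Im_le_cmodulus _) (fab z))).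
Qed.

End fubini_complex.

Section fourier_L2.
Context {R : realType} {d : nat}.
Hypothesis d0 : (0 < d)%N.
Local Notation mu := (lebesgue_Rd R d).
Local Notation q := (sqn (L2ip mu)).
Local Notation ip := (L2ip mu).
Implicit Types (f g h k u v w : Rd R d -> R[i]).
Let sip := @L2_semi_ip _ _ _ mu.

Lemma chC_sym (x y : 'rV[R]_d) : ch x y = ch y x.
Proof. by rewrite /ch dotC. Qed.

(** Fubini's theorem for a kernel symmetric in its two variables. This identity replaces the
    inversion formula below. *)
Lemma ft_multiplication u v : cL1 mu u -> cL1 mu v ->
  cint mu (fun x => ft u x * v x) = cint mu (fun x => u x * ft v x).
Proof.
move=> L1u L1v.
have iu : integrableR mu (fun x => cmodulus (u x)) by exact: cL1_cmodulus.
have iv : integrableR mu (fun x => cmodulus (v x)) by exact: cL1_cmodulus.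
have mch : cmeas (fun z : Rd R d * Rd R d => ch z.2 z.1 * (u z.2 * v z.1)).
  apply: cmeasM; last exact: (cmeasM (cmeas_comp L1u.1 measurable_snd) (cmeas_comp L1v.1 measurable_fst)).
  apply: cmeas_expNi; apply: measurable_funM; first exact: measurable_cst.
  apply: measurable_sum => i; apply: measurable_funM.
    by apply: (measurableT_comp (@measurable_coord R d i)); exact: measurable_snd.
  by apply: (measurableT_comp (@measurable_coord R d i)); exact: measurable_fst.
have := @cint_Fubini _ _ _ _ _ mu mu _ _ iv iu (fun z => ch z.2 z.1 * (u z.2 * v z.1)) mch.
move=> F.
transitivity (cint mu (fun x => cint mu (fun y => ch y x * (u y * v x)))).
  congr cint; apply/funext => x; rewrite mulrC -(cintZ _ (cL1_ch x L1u)).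
  by congr cint; apply/funext => y; ring.
rewrite F => [|z]; last by rewrite !cmodulusM cmodulus_ch mul1r mulrC.
congr cint; apply/funext => y; rewrite -(cintZ _ (cL1_ch y L1v)).
by congr cint; apply/funext => x; rewrite chC_sym; ring.
Qed.

(** The graph with approximating sequences restricted to Lipschitz functions, on which the isometry
    is known. It is shown below to be the same relation as [fourier_graph]. *)
Definition fgr f g := [/\ cL2 mu f, cL2 mu g & exists phi : nat -> Rd R d -> R[i],
  [/\ forall n, clip (phi n), (fun n => q (phi n - f)) @ \oo --> (0 : R) &
      (fun n => q ((fun xi => ft (phi n) xi) - g)) @ \oo --> (0 : R)]].

Lemma cL2_ft u : clip u -> cL2 mu (fun xi : Rd R d => ft u xi).
Proof. by move=> [M [L uL]]; have [] := ft_isometry d0 uL. Qed.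

Lemma sqn_ft u : clip u -> q (fun xi => ft u xi) = q u.
Proof. by move=> [M [L uL]]; have [] := ft_isometry d0 uL. Qed.

Lemma ftD u v : cL1 mu u -> cL1 mu v ->
  (fun xi : Rd R d => ft (u + v) xi) = (fun xi => ft u xi) + (fun xi => ft v xi).
Proof.
move=> L1u L1v; apply/funext => xi; rewrite /ft.
rewrite -[RHS]/(_ + _) -(cintD (cL1_ch xi L1u) (cL1_ch xi L1v)).
by congr cint; apply/funext => x; rewrite -mulrDr.
Qed.

Lemma ftZ c u : cL1 mu u -> (fun xi : Rd R d => ft (c *: u) xi) = c *: (fun xi => ft u xi).
Proof.
move=> L1u; apply/funext => xi; rewrite /ft.
rewrite -[RHS]/(c * _) -(cintZ c (cL1_ch xi L1u)).
by congr cint; apply/funext => x; rewrite mulrCA.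
Qed.

Lemma ftB u v : cL1 mu u -> cL1 mu v ->
  (fun xi : Rd R d => ft (u - v) xi) = (fun xi => ft u xi) - (fun xi => ft v xi).
Proof.
move=> L1u L1v; apply/funext => xi; rewrite /ft.
rewrite -[RHS]/(_ - _) -(cintB (cL1_ch xi L1u) (cL1_ch xi L1v)).
by congr cint; apply/funext => x; rewrite -mulrBr.
Qed.

Lemma clipB (u v : 'rV[R]_d -> R[i]) : clip u -> clip v -> clip (u - v).
Proof. by move=> cu cv; rewrite -scaleN1r; exact: (clipD cu (clipZ (-1) cv)). Qed.

Lemma sqn_cvgD (u_ v_ : nat -> Rd R d -> R[i]) u v :
  (forall n, cL2 mu (u_ n)) -> (forall n, cL2 mu (v_ n)) -> cL2 mu u -> cL2 mu v ->
  (fun n => q (u_ n - u)) @ \oo --> (0 : R) -> (fun n => q (v_ n - v)) @ \oo --> (0 : R) ->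
  (fun n => q (u_ n + v_ n - (u + v))) @ \oo --> (0 : R).
Proof.
move=> L2u_ L2v_ L2u L2v cu cv.
have c : (fun n => 2 * q (u_ n - u) + 2 * q (v_ n - v)) @ \oo --> (0 : R).
  by rewrite -(addr0 0) -(mulr0 2); apply: cvgD; apply: cvgMr.
apply: squeeze_cvg0 c => n; first exact: sqnL2_ge0.
have -> : u_ n + v_ n - (u + v) = (u_ n - u) + (v_ n - v) by rewrite opprD addrACA.
exact: (sqnD_le sip (sipHB sip (L2u_ n) L2u) (sipHB sip (L2v_ n) L2v)).
Qed.

Lemma fgrD f g h k : fgr f g -> fgr h k -> fgr (f + h) (g + k).
Proof.
move=> [L2f L2g [phi [cphi pf pg]]] [L2h L2k [psi [cpsi ph pk]]].
have L2p n := clip_cL2 d0 (cphi n); have L2q n := clip_cL2 d0 (cpsi n).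
split; [exact: (sipHD sip)|exact: (sipHD sip)|].
exists (fun n => phi n + psi n); split.
- by move=> n; exact: clipD.
- exact: sqn_cvgD.
- rewrite [X in X @ _ --> _](_ : _ = fun n => q ((fun xi => ft (phi n) xi) + (fun xi => ft (psi n) xi) - (g + k))).
    exact: (sqn_cvgD (fun n => cL2_ft (cphi n)) (fun n => cL2_ft (cpsi n)) L2g L2k pg pk).
  apply/funext => n; exact: (congr1 (fun z => q (z - (g + k))) (ftD (clip_cL1 d0 (cphi n)) (clip_cL1 d0 (cpsi n)))).
Qed.

Lemma sqn_cvgZ c (u_ : nat -> Rd R d -> R[i]) u :
  (forall n, cL2 mu (u_ n)) -> cL2 mu u ->
  (fun n => q (u_ n - u)) @ \oo --> (0 : R) ->
  (fun n => q (c *: u_ n - c *: u)) @ \oo --> (0 : R).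
Proof.
move=> L2u_ L2u cu.
rewrite [X in X @ _](_ : _ = fun n => cmodulus c ^+ 2 * q (u_ n - u)); last first.
  by apply/funext => n; rewrite -scalerBr (sqnZ sip _ (sipHB sip (L2u_ n) L2u)).
by rewrite -(mulr0 (cmodulus c ^+ 2)); exact: cvgMr.
Qed.

Lemma fgrZ c f g : fgr f g -> fgr (c *: f) (c *: g).
Proof.
move=> [L2f L2g [phi [cphi pf pg]]].
have L2p n := clip_cL2 d0 (cphi n).
split; [exact: (sipHZ sip)|exact: (sipHZ sip)|].
exists (fun n => c *: phi n); split.
- by move=> n; exact: clipZ.
- exact: sqn_cvgZ.
- rewrite [X in X @ _ --> _](_ : _ = fun n => q (c *: (fun xi => ft (phi n) xi) - c *: g)).
    exact: (sqn_cvgZ c (fun n => cL2_ft (cphi n)) L2g pg).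
  apply/funext => n; exact: (congr1 (fun z => q (z - c *: g)) (ftZ c (clip_cL1 d0 (cphi n)))).
Qed.

Lemma fgr_sqn f g : fgr f g -> q f = q g.
Proof.
move=> [L2f L2g [phi [cphi pf pg]]].
have c1 := sqn_cvg sip (fun n => clip_cL2 d0 (cphi n)) L2f pf.
have c2 := sqn_cvg sip (fun n => cL2_ft (cphi n)) L2g pg.
have c3 : (fun n => q (fun xi => ft (phi n) xi)) @ \oo --> q f.
  by under eq_fun do rewrite (sqn_ft (cphi _)); exact: c1.
by rewrite -(cvg_lim _ c2)// (cvg_lim _ c3).
Qed.

Lemma fgrB f g h k : fgr f g -> fgr h k -> fgr (f - h) (g - k).
Proof. by move=> fg hk; rewrite -!(scaleN1r (V := Rd R d -> R[i])); exact: (fgrD fg (fgrZ (-1) hk)). Qed.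

Lemma fgr_unique f g k : fgr f g -> fgr f k -> q (g - k) = 0.
Proof.
move=> fg fk; rewrite -(fgr_sqn (fgrB fg fk)) subrr; exact: sqnL2_0.
Qed.

(** Polarization: the real part comes from the norm of $f+h$, and the imaginary part from applying
    this to $if$. *)
Lemma fgr_ip f g h k : fgr f g -> fgr h k -> ip f h = ip g k.
Proof.
have key f1 g1 h1 k1 : fgr f1 g1 -> fgr h1 k1 -> complex.Re (ip f1 h1) = complex.Re (ip g1 k1).
  move=> fg hk; have := fgr_sqn (fgrD fg hk).
  have [L2f L2g _] := fg; have [L2h L2k _] := hk.
  rewrite (sqnD sip L2f L2h) (sqnD sip L2g L2k) (fgr_sqn fg) (fgr_sqn hk).
  by lra.
move=> fg hk; apply: complex_ext; first exact: key.
have [L2f L2g _] := fg; have [L2h L2k _] := hk.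
have := key _ _ _ _ (fgrZ 'i%C fg) hk.
rewrite (sipZ sip _ L2f L2h) (sipZ sip _ L2g L2k) !ReM/= !mul0r !mul1r !sub0r.
by move/oppr_inj.
Qed.

Lemma fgr_close f g : cL2 mu f -> cL2 mu g ->
  (forall e, 0 < e -> exists u, [/\ clip u, q (u - f) <= e & q ((fun xi => ft u xi) - g) <= e]) ->
  fgr f g.
Proof.
move=> L2f L2g H; split=> //.
have [phi phiP] : {phi : nat -> Rd R d -> R[i] & forall n,
   [/\ clip (phi n), q (phi n - f) <= n.+1%:R^-1 & q ((fun xi => ft (phi n) xi) - g) <= n.+1%:R^-1]}.
  apply: (@choice _ _ (fun n u => [/\ clip u, q (u - f) <= n.+1%:R^-1 & q ((fun xi => ft u xi) - g) <= n.+1%:R^-1])) => n.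
  have n0 : 0 < n.+1%:R^-1 :> R by rewrite invr_gt0.
  exact: H.
exists phi; split.
- by move=> n; have [] := phiP n.
- apply: squeeze_cvg0 (@cvg_harmonic R) => n; first exact: sqnL2_ge0.
  by have [] := phiP n.
- apply: squeeze_cvg0 (@cvg_harmonic R) => n; first exact: sqnL2_ge0.
  by have [] := phiP n.
Qed.

Lemma fgr_approx f g e : fgr f g -> 0 < e ->
  exists u, [/\ clip u, q (u - f) <= e & q ((fun xi => ft u xi) - g) <= e].
Proof.
move=> [L2f L2g [phi [cphi pf pg]]] e0.
have /cvgrPdist_le/(_ _ e0) H1 := pf; have /cvgrPdist_le/(_ _ e0) H2 := pg.
have [N _ /(_ N (leqnn N))[]] := filterI H1 H2.
rewrite !sub0r !normrN !ger0_norm ?sqnL2_ge0// => h1 h2.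
by exists (phi N).
Qed.

Lemma sqn_sub_le u v w : cL2 mu u -> cL2 mu v -> cL2 mu w ->
  q (u - w) <= 2 * q (u - v) + 2 * q (v - w).
Proof.
move=> L2u L2v L2w; have -> : u - w = (u - v) + (v - w) by rewrite addrA subrK.
exact: (sqnD_le sip (sipHB sip L2u L2v) (sipHB sip L2v L2w)).
Qed.

Lemma quarter_sum (a b e : R) : a <= e / 4 -> b <= e / 4 -> 2 * a + 2 * b <= e.
Proof. lra. Qed.

Lemma fgr_eq f g k : fgr f g -> cL2 mu k -> q (g - k) = 0 -> fgr f k.
Proof.
move=> fg L2k gk; have [L2f L2g _] := fg; apply: fgr_close => // e e0.
have e2 : 0 < e / 2 by rewrite divr_gt0.
have [u [cu uf ug]] := fgr_approx fg e2; exists u; split => //.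
  by rewrite (le_trans uf)//; lra.
have := sqn_sub_le (cL2_ft cu) L2g L2k; rewrite gk; lra.
Qed.

(** The isometry carries an approximating Lipschitz sequence to a Cauchy sequence of transforms, and
    $L^2$ is complete. *)
Lemma fgr_exists f : cL2 mu f -> exists g, fgr f g.
Proof.
move=> L2f.
have [phi phiP] : {phi : nat -> Rd R d -> R[i] & forall n, clip (phi n) /\ q (phi n - f) <= n.+1%:R^-1}.
  apply: (@choice _ _ (fun n u => clip u /\ q (u - f) <= n.+1%:R^-1)) => n.
  have n0 : 0 < n.+1%:R^-1 :> R by rewrite invr_gt0.
  by have [u cu uf] := clip_dense d0 L2f n0; exists u.
have cphi n := (phiP n).1; have L2p n := clip_cL2 d0 (cphi n).
have pf : (fun n => q (phi n - f)) @ \oo --> (0 : R).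
  apply: squeeze_cvg0 (@cvg_harmonic R) => n; first exact: sqnL2_ge0.
  by have [] := phiP n.
have [|g L2g pg] := L2_complete (fun n => cL2_ft (cphi n)); last first.
  by exists g; split => //; exists phi.
move=> e e0; have e4 : 0 < e / 4 by rewrite divr_gt0.
have /cvgrPdist_le/(_ _ e4)[N _ HN] := pf.
exists N => m n Nm Nn.
have -> : (fun xi : Rd R d => ft (phi m) xi) - (fun xi => ft (phi n) xi) = (fun xi => ft (phi m - phi n) xi).
  exact: (esym (ftB (clip_cL1 d0 (cphi m)) (clip_cL1 d0 (cphi n)))).
rewrite (sqn_ft (clipB (cphi m) (cphi n))).
have h1 := HN _ Nm; have h2 := HN _ Nn.
move: h1 h2; rewrite /= !sub0r !normrN !ger0_norm ?sqnL2_ge0// => h1 h2.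
have := sqn_sub_le (L2p m) L2f (L2p n); rewrite (sqnBC sip L2f (L2p n)); lra.
Qed.

Lemma fgr_clip u : clip u -> fgr u (fun xi => ft u xi).
Proof.
move=> cu; split; [exact: (clip_cL2 d0)|exact: cL2_ft|].
by exists (fun=> u); split=> //; under eq_fun do rewrite subrr sqnL2_0; exact: cvg_cst.
Qed.

Let cj f : Rd R d -> R[i] := fun x => conjc (f x).

Lemma sqn_cj f : q (cj f) = q f.
Proof. by rewrite !sqnL2; under eq_Rintegral do rewrite /cj cmodulusJ. Qed.

Lemma cj_sub f g : cj f - cj g = cj (f - g).
Proof. by apply/funext => x; rewrite /cj rmorphB. Qed.

(** The conjugations turn [ip] into the bilinear pairing, for which the transform is symmetric; the
    identity passes to the limit from Lipschitz functions. *)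
Lemma fgr_multiplication f g h k : fgr f g -> fgr h k -> ip g (cj h) = ip f (cj k).
Proof.
move=> [L2f L2g [phi [cphi pf pg]]] [L2h L2k [psi [cpsi ph pk]]].
have cjc (v_ : nat -> Rd R d -> R[i]) v : (fun n => q (v_ n - v)) @ \oo --> (0 : R) ->
    (fun n => q (cj (v_ n) - cj v)) @ \oo --> (0 : R).
  by under [X in _ -> X @ _ --> _]eq_fun do rewrite cj_sub sqn_cj.
have c1 := sip_cvg sip (fun n => cL2_ft (cphi n)) (fun n => cL2J (clip_cL2 d0 (cpsi n))) L2g (cL2J L2h) pg (cjc _ _ ph).
have c2 := sip_cvg sip (fun n => clip_cL2 d0 (cphi n)) (fun n => cL2J (cL2_ft (cpsi n))) L2f (cL2J L2k) pf (cjc _ _ pk).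
have E n : ip (fun xi => ft (phi n) xi) (cj (psi n)) = ip (phi n) (cj (fun xi => ft (psi n) xi)).
  rewrite /L2ip /cj; under eq_fun do rewrite conjcK; under [in RHS]eq_fun do rewrite conjcK.
  exact: (ft_multiplication (clip_cL1 d0 (cphi n)) (clip_cL1 d0 (cpsi n))).
have c12 : (fun n => 2 * cmodulus (ip (fun xi => ft (phi n) xi) (cj (psi n)) - ip g (cj h)) ^+ 2 +
    2 * cmodulus (ip (phi n) (cj (fun xi => ft (psi n) xi)) - ip f (cj k)) ^+ 2) @ \oo --> (0 : R).
  by rewrite -(addr0 0) -(mulr0 2); apply: cvgD; apply: cvgMr.
apply/eqP; rewrite -subr_eq0 -cmodulus_eq0 -sqrf_eq0 eq_le sqr_ge0 andbT.
apply: (cvg_lbound c12) => n; rewrite E.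
set z := ip (phi n) _.
have -> : ip g (cj h) - ip f (cj k) = - (z - ip g (cj h)) + (z - ip f (cj k)) by ring.
by rewrite (le_trans (sqr_cmodulusD_le _ _))// cmodulusN.
Qed.

(* The adjoint of the isometry F is g |-> conj (F (conj g)), an isometry as well. *)
Lemma fgr_surj g : cL2 mu g -> exists f, fgr f g.
Proof.
move=> L2g; have [h gh] := fgr_exists (cL2J L2g).
have [_ L2h _] := gh; have L2f : cL2 mu (cj h) := cL2J L2h.
have [k fk] := fgr_exists L2f; have [_ L2k _] := fk.
exists (cj h); apply: (fgr_eq fk L2g).
have E : ip k g = ip (cj h) (cj h).
  by rewrite -(fgr_multiplication fk gh) /cj; congr ip; apply/funext => x; rewrite conjcK.
(* In $q(k)+q(g)-2\,\mathrm{Re}\langle k,g\rangle$ all three quantities equal $q(h)$, so $k$ and $g$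
   agree up to a null function. *)
rewrite (sqnB sip L2k L2g) E -/(q (cj h)) -(fgr_sqn fk) sqn_cj -(fgr_sqn gh) sqn_cj; lra.
Qed.

Lemma clip_orthogonal v : cL2 mu v -> (forall u, clip u -> ip v u = 0) -> q v = 0.
Proof.
move=> L2v vu; apply: (sqn0_le sip L2v) => e e0.
have [u cu uv] := clip_dense d0 L2v e0; have L2u := clip_cL2 d0 cu.
move: uv; rewrite (sqnBC sip L2u L2v) (sqnB sip L2v L2u) (vu u cu).
by have := sqnL2_ge0 mu u; rewrite /=; lra.
Qed.

(** Both the $L^2$ transform [w] and the integral [ft u] satisfy the multiplication formula against
    Lipschitz functions, so their difference is orthogonal to these. As [ft u] is so far only known
    to be bounded, the comparison is made on cubes. *)
Lemma fgr_integral u : cL1 mu u -> cL2 mu u -> fgr u (fun xi => ft u xi).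
Proof.
move=> L1u L2u; have [w uw] := fgr_exists L2u; have [_ L2w _] := uw.
have mft : cmeas (fun xi : Rd R d => ft u xi) by exact: (cmeas_ft L1u.1).
pose v : Rd R d -> R[i] := w - (fun xi => ft u xi).
have mv : cmeas v by exact: (cmeasB L2w.1 mft).
have cubeL2 T : cL2 mu (fun xi => \1_(cube T%:R) xi * v xi) /\ q (fun xi => \1_(cube T%:R) xi * v xi) = 0.
  pose I : 'rV[R]_d * 'rV[R]_d := (const_mx (- T%:R), const_mx T%:R).
  (* A cutoff equal to 1 on the cube and of compact support: it makes both terms square integrable
     and keeps test functions Lipschitz. *)
  pose chi : Rd R d -> R[i] := fun x => (tent I 1 x)%:C%C.
  have cchi : clip chi by exact: clip_tent.
  have L2chi := clip_cL2 d0 cchi.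
  have chi1 x : cmodulus (chi x) <= 1 by rewrite cmodulusR ger0_norm ?tent_ge0// tent_le1.
  have L2a : cL2 mu (fun x => chi x * w x) by exact: (cL2_bounded L2chi.1 L2w chi1).
  have L2b : cL2 mu (fun x => chi x * ft u x).
    have bu xi : cmodulus (ft u xi) <= \int[mu]_x cmodulus (u x).
      rewrite (le_trans (cmodulus_cint (cL1_ch xi L1u)))//.
      by under eq_Rintegral do rewrite cmodulusM cmodulus_ch mul1r.
    have := cL2_bounded mft L2chi bu.
    by under eq_fun do rewrite mulrC.
  pose vc : Rd R d -> R[i] := (fun x => chi x * w x) - (fun x => chi x * ft u x).
  have L2vc : cL2 mu vc by exact: (sipHB sip L2a L2b).
  have vcE x : vc x = chi x * v x by rewrite /vc /v -[LHS]/(_ - _) -mulrBr.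
  have qvc : q vc = 0.
    apply: (clip_orthogonal L2vc) => psi cpsi; have L2psi := clip_cL2 d0 cpsi.
    (* Moving the cutoff onto the test function turns the pairing with [vc] into the integral of [v]
       against a Lipschitz function. *)
    pose rho : Rd R d -> R[i] := fun x => chi x * conjc (psi x).
    have crho : clip rho by exact: (clipM d0 cchi (clipJ cpsi)).
    rewrite /vc (sipB sip L2a L2b L2psi); apply/eqP; rewrite subr_eq0; apply/eqP.
    transitivity (cint mu (fun x => w x * rho x)).
      by rewrite /L2ip; congr cint; apply/funext => x; rewrite /rho; ring.
    transitivity (cint mu (fun x => ft u x * rho x)); last first.
      by rewrite /L2ip; congr cint; apply/funext => x; rewrite /rho; ring.
    have := fgr_multiplication uw (fgr_clip crho).
    rewrite /L2ip /cj; under eq_fun do rewrite conjcK; under [in X in _ = X -> _]eq_fun do rewrite conjcK.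
    by move=> ->; rewrite (ft_multiplication L1u (clip_cL1 d0 crho)).
  have cvE x : \1_(cube T%:R) x * v x = \1_(cube T%:R) x * vc x :> R[i].
    rewrite vcE !indicCE indicE; case: (boolP (x \in cube T%:R)) => [/set_mem xT|_]; last by rewrite !mul0r.
    by rewrite /chi tent_box// !mul1r.
  have i1 (x : Rd R d) : cmodulus (\1_(cube T%:R) x : R[i]) <= 1.
    by rewrite indicCE cmodulusR ger0_norm// indicE lern1 leq_b1.
  have mcube : (lebesgue_outer R d).-cara.-measurable (cube T%:R : set 'rV[R]_d) by exact: measurable_box.
  have L2i : cL2 mu (fun xi => \1_(cube T%:R) xi * v xi).
    have := cL2_bounded (cmeas_indic mcube) L2vc i1.
    by under [in X in _ -> X]eq_fun do rewrite cvE.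
  split=> //; apply/eqP; rewrite eq_le sqnL2_ge0 andbT -qvc.
  apply: (sqn_le L2i L2vc) => x; rewrite cvE cmodulusM.
  by rewrite ler_piMl ?cmodulus_ge0.
have q0T T : q (fun xi => \1_(cube T%:R) xi * v xi) <= 0 by have [_ ->] := cubeL2 T.
have [L2v qv] := cL2_cube_bound mv q0T (fun T => (cubeL2 T).1).
have q0 : q (w - (fun xi => ft u xi)) = 0 by apply/eqP; rewrite eq_le qv sqnL2_ge0.
apply: (fgr_eq uw _ q0).
have -> : (fun xi : Rd R d => ft u xi) = w - v by rewrite /v opprB addrC subrK.
exact: (sipHB sip).
Qed.

(** The definition allows arbitrary approximants in $L^1\cap L^2$. Each of them is on the restricted
    graph by [fgr_integral], and can be replaced by a nearby Lipschitz function with a nearby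
    transform. *)
Lemma fourier_graph_fgr f g : fourier_graph f g <-> fgr f g.
Proof.
split=> [[L2f L2g [u [u12 uf ug]]]|[L2f L2g [phi [cphi pf pg]]]]; last first.
  split=> //; exists phi; split.
  - by move=> n; split; [exact: (clip_cL1 d0 (cphi n))|exact: (clip_cL2 d0 (cphi n))].
  - exact: (cvg_sqL2 (fun n => clip_cL2 d0 (cphi n)) L2f).2.
  - exact: (cvg_sqL2 (fun n => cL2_ft (cphi n)) L2g).2.
have fu n : fgr (u n) (fun xi => ft (u n) xi) by have [? ?] := u12 n; exact: fgr_integral.
have L2u n : cL2 mu (u n) by have [] := fu n.
have L2fu n : cL2 mu (fun xi => ft (u n) xi) by have [] := fu n.
have cuf := (cvg_sqL2 L2u L2f).1 uf; have cug := (cvg_sqL2 L2fu L2g).1 ug.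
apply: fgr_close => // e e0; have e4 : 0 < e / 4 by rewrite divr_gt0.
have /cvgrPdist_le/(_ _ e4) H1 := cuf; have /cvgrPdist_le/(_ _ e4) H2 := cug.
have [N _ /(_ N (leqnn N))[]] := filterI H1 H2.
rewrite !sub0r !normrN !ger0_norm ?sqnL2_ge0// => h1 h2.
have [v [cv vu vfu]] := fgr_approx (fu N) e4; exists v; split=> //.
  exact: (le_trans (sqn_sub_le (clip_cL2 d0 cv) (L2u N) L2f) (quarter_sum vu h1)).
exact: (le_trans (sqn_sub_le (cL2_ft cv) (L2fu N) L2g) (quarter_sum vfu h2)).
Qed.

Lemma fgr_fourier f : cL2 mu f -> fgr f (fourier f).
Proof.
move=> L2f; rewrite /fourier; case: xgetP => [g _ /fourier_graph_fgr//|h].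
by have [g /fourier_graph_fgr fg] := fgr_exists L2f; have := h g; case.
Qed.

Lemma fgr_inverse_fourier g : cL2 mu g -> fgr (inverse_fourier g) g.
Proof.
move=> L2g; rewrite /inverse_fourier; case: xgetP => [f _ /fourier_graph_fgr//|h].
by have [f /fourier_graph_fgr fg] := fgr_surj L2g; have := h f; case.
Qed.

End fourier_L2.

(** * The concentration operator *)

Lemma cvg0_eventually_le {R : realType} (u : nat -> R) (e : R) : u @ \oo --> (0 : R) -> 0 < e ->
  exists N, forall n, (N <= n)%N -> u n <= e.
Proof.
move=> u0 e0; have /cvgrPdist_le/(_ _ e0)[N _ HN] := u0.
exists N => n Nn; have := HN n Nn; rewrite sub0r normrN; apply: le_trans; exact: ler_norm.
Qed.

Section concentration_operator.
Context {R : realType} {d : nat}.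
Hypothesis d0 : (0 < d)%N.
Local Notation mu := (lebesgue_Rd R d).
Local Notation q := (sqn (L2ip mu)).
Local Notation ip := (L2ip mu).
Implicit Types (f g h k u v w : Rd R d -> R[i]).
Let sip := @L2_semi_ip _ _ _ mu.
Variables (A B : set 'rV[R]_d).
Hypotheses (mA : (lebesgue_outer R d).-cara.-measurable A)
  (mB : (lebesgue_outer R d).-cara.-measurable B).

Lemma indic_le1 (E : set 'rV[R]_d) (x : Rd R d) : cmodulus (\1_E x : R[i]) <= 1.
Proof. by rewrite indicCE cmodulusR ger0_norm// indicE lern1 leq_b1. Qed.

Lemma cL2_P_op E f : (lebesgue_outer R d).-cara.-measurable E -> cL2 mu f -> cL2 mu (P_op E f).
Proof. move=> mE L2f; exact: (cL2_bounded (cmeas_indic mE) L2f (indic_le1 E)). Qed.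

Lemma P_op_ip E f g : ip (P_op E f) g = ip f (P_op E g).
Proof.
rewrite /L2ip /P_op; congr cint; apply/funext => x.
by rewrite rmorphM/= indicCE conjc_real; ring.
Qed.

Lemma P_op_idem E f : P_op E (P_op E f) = P_op E f.
Proof.
apply/funext => x; rewrite /P_op !indicCE indicE.
by case: (_ \in _); rewrite ?mul1r ?mul0r.
Qed.

Lemma P_op_ip2 E f g : ip (P_op E f) (P_op E g) = ip (P_op E f) g.
Proof. by rewrite -P_op_ip P_op_idem. Qed.

Lemma P_opD E f g : P_op E (f + g) = P_op E f + P_op E g.
Proof. by apply/funext => x; rewrite /P_op -mulrDr. Qed.

Lemma P_opB E f g : P_op E (f - g) = P_op E f - P_op E g.
Proof. by apply/funext => x; rewrite /P_op -mulrBr. Qed.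

Lemma P_opZ E c f : P_op E (c *: f) = c *: P_op E f.
Proof. by apply/funext => x; rewrite /P_op [LHS]mulrCA. Qed.

Lemma P_op_le E f : (lebesgue_outer R d).-cara.-measurable E -> cL2 mu f -> q (P_op E f) <= q f.
Proof.
move=> mE L2f; apply: (sqn_le (cL2_P_op mE L2f) L2f) => x.
by rewrite /P_op cmodulusM ler_piMl ?cmodulus_ge0// indic_le1.
Qed.

Lemma fgr_sum (I : finType) (c : I -> R[i]) (h g : I -> Rd R d -> R[i]) :
  (forall i, fgr (h i) (g i)) -> fgr (\sum_i c i *: h i) (\sum_i c i *: g i).
Proof.
move=> hg; have f00 : fgr (0 : Rd R d -> R[i]) 0.
  have [k k0] := fgr_exists d0 (cL2_0 mu); have := fgrB d0 k0 k0.
  by rewrite !subrr.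
elim: (index_enum I) => [|i s IH]; first by rewrite !big_nil.
by rewrite !big_cons; exact: (fgrD d0 (fgrZ d0 (c i) (hg i)) IH).
Qed.

Lemma P_op_id E f : (forall x, f x != 0 -> E x) -> P_op E f = f.
Proof.
move=> fE; apply/funext => x; rewrite /P_op indicCE indicE.
have [->|fx] := eqVneq (f x) 0; first by rewrite mulr0.
by rewrite mem_set ?mul1r//; exact: fE.
Qed.

Lemma sum_support (I : finType) (c : I -> R[i]) (h : I -> Rd R d -> R[i]) (E : set 'rV[R]_d) x :
  (forall i x, h i x != 0 -> E x) -> (\sum_i c i *: h i) x != 0 -> E x.
Proof.
move=> hE; apply: contra_neqP => Ex; rewrite fct_sumE big1// => i _.
rewrite -[LHS]/(c i * h i x); have [->|/hE//] := eqVneq (h i x) 0.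
by rewrite mulr0.
Qed.

Lemma cL2_S_op u : cL2 mu u -> cL2 mu (S_op A B u).
Proof.
move=> L2u; rewrite /S_op /Q_op; apply: (cL2_P_op mA).
have [_ L2g _] := fgr_fourier d0 (cL2_P_op mA L2u).
by have [] := fgr_inverse_fourier d0 (cL2_P_op mB L2g).
Qed.

(** Any functions related to [P_op A u] and [P_op A w] by the graph may serve as transforms, not
    only the representatives chosen by [fourier]. In particular linear combinations of known
    transforms can be used. *)
Lemma S_op_form u w gu gw : cL2 mu u -> cL2 mu w -> fgr (P_op A u) gu -> fgr (P_op A w) gw ->
  ip (S_op A B u) w = ip (P_op B gu) (P_op B gw).
Proof.
move=> L2u L2w ugu wgw; rewrite /S_op /Q_op P_op_ip.
have ug := fgr_fourier d0 (cL2_P_op mA L2u).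
have [_ L2g _] := ug; have [_ L2gu _] := ugu; have [_ L2gw _] := wgw.
have kg := fgr_inverse_fourier d0 (cL2_P_op mB L2g).
rewrite (fgr_ip d0 kg wgw) P_op_ip2.
apply: (sip_eqB sip (cL2_P_op mB L2g) (cL2_P_op mB L2gu) L2gw).
have gg := fgr_unique d0 ug ugu.
apply/eqP; rewrite eq_le sqnL2_ge0 andbT -P_opB -gg.
exact: (P_op_le mB (sipHB sip L2g L2gu)).
Qed.

Opaque S_op P_op.

Let F u := fourier (P_op A u).
Let FP u : cL2 mu u -> fgr (P_op A u) (F u).
Proof. by move=> L2u; exact: (fgr_fourier d0 (cL2_P_op mA L2u)). Qed.

Let SE u w : cL2 mu u -> cL2 mu w -> ip (S_op A B u) w = ip (P_op B (F u)) (P_op B (F w)).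
Proof. by move=> L2u L2w; exact: S_op_form (FP L2u) (FP L2w). Qed.

(** The chosen transform [F] is not pointwise additive, so linearity is read off from [S_op_form]
    with the transforms [F u + F v] and [a *: F u]. Symmetry and positivity are inherited from the
    $L^2$ product of the functions [P_op B (F u)]. *)
Lemma S_op_semi_ip : semi_ip (cL2 mu) (fun u w => ip (S_op A B u) w).
Proof.
have L2PF u : cL2 mu u -> cL2 mu (P_op B (F u)).
  by move=> L2u; have [_ L2F _] := FP L2u; exact: (cL2_P_op mB).
split.
- exact: (sipHD sip).
- exact: (sipHZ sip).
- move=> u v w L2u L2v L2w.
  have uv : fgr (P_op A (u + v)) (F u + F v).
    by rewrite P_opD; exact: (fgrD d0 (FP L2u) (FP L2v)).
  have e1 := S_op_form (sipHD sip L2u L2v) L2w uv (FP L2w).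
  have e2 := congr1 (fun z => ip z (P_op B (F w))) (P_opD B (F u) (F v)).
  have e3 := sipD sip (L2PF _ L2u) (L2PF _ L2v) (L2PF _ L2w).
  have e4 := f_equal2 +%R (SE L2u L2w) (SE L2v L2w).
  exact: (etrans e1 (etrans e2 (etrans e3 (esym e4)))).
- move=> a u w L2u L2w.
  have au : fgr (P_op A (a *: u)) (a *: F u).
    by rewrite P_opZ; exact: (fgrZ d0 a (FP L2u)).
  have e1 := S_op_form (sipHZ sip a L2u) L2w au (FP L2w).
  have e2 := congr1 (fun z => ip z (P_op B (F w))) (P_opZ B a (F u)).
  have e3 := sipZ sip a (L2PF _ L2u) (L2PF _ L2w).
  exact: (etrans e1 (etrans e2 (etrans e3 (esym (congr1 ( *%R a) (SE L2u L2w)))))).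
- move=> u v L2u L2v; have e := sipJ sip (L2PF _ L2u) (L2PF _ L2v).
  exact: (etrans (SE L2v L2u) (etrans e (congr1 conjc (esym (SE L2u L2v))))).
- move=> u L2u; have e := congr1 (@complex.Re R) (SE L2u L2u).
  exact: (eq_ind_r (fun z => 0 <= z) (sip_ge0 sip (L2PF _ L2u)) e).
Qed.

Lemma S_op_form_le u : cL2 mu u -> sqn (fun u w => ip (S_op A B u) w) u <= q u.
Proof.
move=> L2u; rewrite {1}/sqn (SE L2u L2u) -/(q _).
have [L2P L2F _] := FP L2u.
rewrite (le_trans (P_op_le mB L2F))// -(fgr_sqn d0 (FP L2u)).
exact: (P_op_le mA L2u).
Qed.

Hypothesis cS : compact_operator (S_op A B).

Let S_compact (u : nat -> Rd R d -> R[i]) : (forall n, cL2 mu (u n)) ->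
  (exists M, forall n, q (u n) <= M) ->
  exists (phi : nat -> nat) g, [/\ {homo phi : m n / (m < n)%N}, cL2 mu g &
    (fun n => q (S_op A B (u (phi n)) - g)) @ \oo --> (0 : R)].
Proof.
move=> L2u [M uM].
have [||phi [g [hphi L2g c]]] := cS (u := u).
- exact: L2u.
- exists M => n; have := sqL2E (L2u n); rewrite /sqL2 /sqL2norm => ->.
  by rewrite lee_fin.
exists phi, g; split => //.
exact: (cvg_sqL2 (fun n => cL2_S_op (L2u (phi n))) L2g).1 c.
Qed.

Variables (lam : nat -> R) (v : nat -> Rd R d -> R[i]).
Hypothesis eigS : eigensystem (S_op A B) lam v.

Let L2v n : cL2 mu (v n).
Proof. by have [_ _ _ /(_ n)[]] := eigS. Qed.

Let eigv n : q (S_op A B (v n) - ((lam n)%:C)%C *: v n) = 0.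
Proof.
have [_ _ _ /(_ n)[L2vn ae] _] := eigS.
by have [] := ae_eq_cL2 ae (cL2_S_op (L2v n)).1 (sipHZ sip ((lam n)%:C)%C (L2v n)).
Qed.

Lemma S_op_eigenvalue_lower_bound (I : finType) (h : I -> Rd R d -> R[i]) (eps : R) :
  0 < eps -> (forall i, clip (h i)) -> (forall i x, h i x != 0 -> A x) ->
  (forall c : I -> R[i], (exists i, c i != 0) ->
    0 < q (\sum_i c i *: h i) /\
    eps * q (\sum_i c i *: h i) <= q (P_op B (\sum_i c i *: (fun xi => ft (h i) xi)))) ->
  forall m, (m < #|I|)%N -> eps <= lam m.
Proof.
move=> eps0 ch hA H.
have [lam01 lamn ov eigp full] := eigS.
apply: (eigenvalue_lower_bound sip (cL2_0 mu) cL2_S_op S_op_semi_ip S_op_form_le S_compact L2v lamn eigv _ eps0).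
- move=> nu w nu0 L2w Tw wv.
  have ae := sqn_ae_eq (cL2_S_op L2w) (sipHZ sip (nu%:C)%C L2w) Tw.
  by have [] := ae_eq0_sqn (full nu w nu0 (conj L2w ae) wv) L2w.1.
- by move=> i; exact: (clip_cL2 d0 (ch i)).
move=> c c0; have [H1 H2] := H c c0; split=> //.
set u := \sum_i _ in H1 H2 *.
have L2u : cL2 mu u by apply: (sipH_sum sip) => [|i]; [exact: cL2_0|exact: (clip_cL2 d0 (ch i))].
have ug : fgr u (\sum_i c i *: (fun xi => ft (h i) xi)).
  exact: (fgr_sum c (fun i => fgr_clip d0 (ch i))).
have Au : P_op A u = u by apply: P_op_id => x; apply: (sum_support hA).
have ug' : fgr (P_op A u) (\sum_i c i *: (fun xi => ft (h i) xi)) by rewrite Au.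
by rewrite [X in _ <= X]/sqn (S_op_form L2u L2u ug' ug').
Qed.

(** If all eigenvalues were at least $c>0$, the images of two distinct orthonormal eigenvectors
    would be at squared distance $\lambda_a^2+\lambda_b^2>c^2$, so they could have no convergent
    subsequence. *)
Lemma eigenvalues_cvg0 : lam @ \oo --> (0 : R).
Proof.
have [lam01 lamn ov eigp full] := eigS.
suff key c : 0 < c -> exists n, lam n < c.
  apply/cvgrPdist_lt => e e0; have [n ne] := key e e0.
  exists n => // m /= nm; rewrite sub0r normrN ger0_norm; last by have /andP[] := lam01 m.
  exact: le_lt_trans (lamn _ _ nm) ne.
move=> c0; apply: contrapT => /forallNP h.
have lc n : c <= lam n by rewrite leNgt; apply/negP/h.
have qv n : q (v n) = 1.
  by have := ov n n; rewrite eqxx /sqn => /(congr1 (@complex.Re R)).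
have [|phi [g [hphi L2g cg]]] := S_compact L2v; first by exists 1 => n; rewrite qv.
(* Two terms within $c^2/4$ of the limit are at squared distance at most $c^2$ from each other, by
   [quarter_sum]. *)
have e0 : 0 < c ^+ 2 / 4 by rewrite divr_gt0// exprn_gt0.
have [N HN] := cvg0_eventually_le cg e0.
have := HN N (leqnn N); have := HN N.+1 (leqnSn N).
set a := phi N.+1; set b := phi N => h1 h2.
have ab : (b < a)%N by exact: hphi.
have L2S n := cL2_S_op (L2v n).
have L2l n : cL2 mu (((lam n)%:C)%C *: v n) := sipHZ sip _ (L2v n).
have : q (S_op A B (v a) - S_op A B (v b)) <= c ^+ 2.
  have := sqn_sub_le (L2S a) L2g (L2S b); rewrite (sqnBC sip L2g (L2S b)).
  move=> h3; exact: (le_trans h3 (quarter_sum h1 h2)).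
have -> : q (S_op A B (v a) - S_op A B (v b)) = lam a ^+ 2 + lam b ^+ 2.
  have L2dS := sipHB sip (L2S a) (L2S b); have L2dl := sipHB sip (L2l a) (L2l b).
  have E0 : q (S_op A B (v a) - S_op A B (v b) - (((lam a)%:C)%C *: v a - ((lam b)%:C)%C *: v b)) = 0.
    apply/eqP; rewrite eq_le sqnL2_ge0 andbT.
    have -> : S_op A B (v a) - S_op A B (v b) - (((lam a)%:C)%C *: v a - ((lam b)%:C)%C *: v b) =
        (S_op A B (v a) - ((lam a)%:C)%C *: v a) - (S_op A B (v b) - ((lam b)%:C)%C *: v b).
      by rewrite !opprD !opprK addrACA.
    rewrite (le_trans (sqnB_le sip (sipHB sip (L2S a) (L2l a)) (sipHB sip (L2S b) (L2l b))))//.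
    by rewrite !eigv !mulr0 addr0.
  rewrite (sqn_eqB sip L2dS L2dl E0) (sqnB sip (L2l a) (L2l b)) !(sqnZ sip _ (L2v _)) !qv.
  rewrite (sipZ sip _ (L2v a) (L2l b)) (sipZr sip _ (L2v a) (L2v b)).
  have -> : ip (v a) (v b) = 0 by have := ov a b; rewrite gtn_eqF.
  by rewrite !mulr0 !cmodulusR !real_normK ?num_real// !mulr1 subr0.
have la : c ^+ 2 <= lam a ^+ 2.
  by rewrite ler_sqr ?nnegrE ?(ltW c0)// (le_trans (ltW c0)).
have lb : 0 < lam b ^+ 2 by rewrite exprn_gt0// (lt_le_trans c0).
by rewrite leNgt (le_lt_trans la)// ltrDl.
Qed.

Transparent S_op P_op.

End concentration_operator.

(** * Tensor Vandermonde systems *)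

Section vandermonde.
Context {R : realType}.
Local Notation C := R[i].

(** Multiplication by $X-a$ with $|a|\le 1$ at most doubles the largest coefficient. *)
Lemma coef_prod_XsubC_le (s : seq C) k : (forall z, z \in s -> cmodulus z <= 1) ->
  cmodulus (\prod_(z <- s) ('X - z%:P))`_k <= 2 ^+ size s.
Proof.
elim: s k => [|a s IH] k s1; first by rewrite big_nil coef1; case: (k == 0)%N; rewrite ?cmodulus1 ?cmodulus0.
have a1 : cmodulus a <= 1 by apply: s1; rewrite inE eqxx.
have {}IH j := IH j (fun z zs => s1 z (mem_behead (s := a :: s) zs)).
rewrite big_cons mulrBl coefB coefCM coefXM exprS.
rewrite (le_trans (cmodulusD _ _))// cmodulusN cmodulusM.
have h1 : cmodulus (if (k == 0)%N then 0 else (\prod_(j <- s) ('X - j%:P))`_k.-1) <= 2 ^+ size s.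
  by case: ifP => // _; rewrite cmodulus0 exprn_ge0.
have h2 : cmodulus a * cmodulus (\prod_(j <- s) ('X - j%:P))`_k <= 2 ^+ size s.
  by rewrite (le_trans _ (IH k))// ler_piMl ?cmodulus_ge0.
lra.
Qed.

Variables (n : nat) (z : 'I_n -> C) (delta : R).
Hypotheses (delta0 : 0 < delta) (z1 : forall l, cmodulus (z l) <= 1)
  (zd : forall j l, j != l -> delta <= cmodulus (z j - z l)).

(** The inverse of a Vandermonde matrix consists of the coefficients of the Lagrange basis
    polynomials. Numerators have $n-1$ roots in the unit disc, which gives $2^{n-1}$; denominators
    are products of $n-1$ differences, each at least [delta]. *)
Lemma lagrange_coefficients : exists L : 'I_n -> 'I_n -> C,
  (forall j j', \sum_k L j k * z j' ^+ k = (j == j')%:R) /\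
  (forall j k, cmodulus (L j k) <= (2 / delta) ^+ n.-1).
Proof.
pose p j := \prod_(l | l != j) ('X - (z l)%:P).
pose w j := \prod_(l | l != j) (z j - z l).
have pE j : p j = \prod_(a <- [seq z l | l <- [seq l <- index_enum 'I_n | l != j]]) ('X - a%:P).
  by rewrite big_map big_filter.
have sz j : size [seq z l | l <- [seq l <- index_enum 'I_n | l != j]] = n.-1.
  by rewrite -sum1_size big_map big_filter sum1_card cardC1 card_ord.
have sp j : (size (p j) <= n)%N.
  rewrite pE size_prod_XsubC sz; rewrite prednK//; exact: leq_ltn_trans (leq0n j) (ltn_ord j).
have wj j : w j != 0.
  apply/prodf_neq0 => l lj; rewrite -cmodulus_eq0; apply: lt0r_neq0.
  by rewrite (lt_le_trans delta0)// zd// eq_sym.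
exists (fun j k => (w j)^-1 * (p j)`_k); split => [j j'|j k].
  under eq_bigr do rewrite -mulrA.
  rewrite -mulr_sumr -(horner_coef_wide _ (sp j)) /p horner_prod.
  under eq_bigr do rewrite hornerXsubC.
  have [<-|jj'] := eqVneq j j'; first by rewrite mulVf.
  by rewrite (bigD1 j') ?[j' == j]eq_sym//= subrr mul0r mulr0.
rewrite cmodulusM cmodulusV expr_div_n mulrC ler_pM ?cmodulus_ge0 ?invr_ge0 ?cmodulus_ge0//.
  by rewrite pE (le_trans (coef_prod_XsubC_le _ _)) ?sz// => _ /mapP[l _ ->].
rewrite lef_pV2 ?posrE ?exprn_gt0//; last by rewrite lt_def cmodulus_eq0 wj cmodulus_ge0.
rewrite /w cmodulus_prod -[n.-1]/(n.-1) -[X in X.-1](card_ord n) -(cardC1 j) -prodr_const.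
apply: ler_prod => l lj; rewrite (ltW delta0)/= zd// eq_sym.
exact: lj.
Qed.

Variable d : nat.
Local Notation J := {ffun 'I_d -> 'I_n}.

Lemma sqr_sum_le (I : finType) (F : I -> R) : (\sum_i F i) ^+ 2 <= #|I|%:R * \sum_i F i ^+ 2.
Proof.
have E : #|I|%:R * \sum_i F i ^+ 2 = \sum_i \sum_j (F i ^+ 2 + F j ^+ 2) / 2.
  transitivity (\sum_i (#|I|%:R * F i ^+ 2 + \sum_j F j ^+ 2) / 2).
    by rewrite -mulr_suml big_split/= -mulr_sumr sumr_const -mulr_natl; lra.
  by apply: eq_bigr => i _; rewrite -mulr_suml big_split/= sumr_const mulr_natl.
rewrite E expr2 mulr_suml; apply: ler_sum => i _; rewrite mulr_sumr; apply: ler_sum => j _.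
by have := sqr_ge0 (F i - F j); rewrite sqrrB; lra.
Qed.

(** The inverse of the tensor power is the tensor power of the inverse, with entries at most
    $(2/\delta)^{(n-1)d}$. Summing over [j] costs the factor $n^d$ that is squared, and passing from
    the sum of moduli of the values to the sum of their squares costs the other $n^d$. *)
Lemma tensor_vandermonde_bound (b : J -> C) :
  (\sum_j cmodulus (b j)) ^+ 2 <=
  ((n ^ d)%:R * ((2 / delta) ^+ n.-1) ^+ d) ^+ 2 * (n ^ d)%:R *
    \sum_(k : J) cmodulus (\sum_j b j * \prod_i z (j i) ^+ k i) ^+ 2.
Proof.
have [L [LE Lb]] := lagrange_coefficients.
set D := 2 / delta; pose P (k : J) := \sum_(j : J) b j * \prod_(i < d) z (j i) ^+ k i.
have bE j : b j = \sum_(k : J) (\prod_(i < d) L (j i) (k i)) * P k.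
  under eq_bigr do rewrite /P mulr_sumr.
  rewrite exchange_big/=.
  transitivity (\sum_(j' : J) b j' * (j == j')%:R).
    by rewrite (bigD1 j)//= eqxx mulr1 big1 ?addr0// => j' /negPf; rewrite eq_sym => ->; rewrite mulr0.
  apply: eq_bigr => j' _.
  under eq_bigr do rewrite mulrCA -big_split/=.
  rewrite -mulr_sumr -(bigA_distr_bigA (fun i k => L (j i) k * z (j' i) ^+ k)); congr (_ * _).
  under eq_bigr do rewrite LE.
  have [->|jj'] := eqVneq j j'; first by rewrite big1// => i _; rewrite eqxx.
  have [i ji] : exists i, j i != j' i.
    apply/existsP; apply: contraNT jj' => /existsPn h; apply/eqP/ffunP => i.
    by apply/eqP/negPn/h.
  by rewrite (bigD1 i)//= (negPf ji) mul0r.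
have D0 : 0 <= D by rewrite divr_ge0// ltW.
have bb j : cmodulus (b j) <= (D ^+ n.-1) ^+ d * \sum_k cmodulus (P k).
  rewrite bE (le_trans (cmodulus_sum _ _ _))// mulr_sumr; apply: ler_sum => k _.
  rewrite cmodulusM ler_wpM2r ?cmodulus_ge0// cmodulus_prod.
  rewrite -[X in _ <= _ ^+ X](card_ord d) -prodr_const; apply: ler_prod => i _.
  by rewrite cmodulus_ge0 Lb.
have SP0 : 0 <= \sum_k cmodulus (P k) by apply: sumr_ge0 => k _; exact: cmodulus_ge0.
have S1 : \sum_j cmodulus (b j) <= (n ^ d)%:R * (D ^+ n.-1) ^+ d * \sum_k cmodulus (P k).
  rewrite (le_trans (ler_sum _ (fun j _ => bb j)))// sumr_const card_ffun !card_ord.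
  by rewrite -[leLHS]mulr_natl -mulrA.
have S0 : 0 <= \sum_j cmodulus (b j) by apply: sumr_ge0 => k _; exact: cmodulus_ge0.
have := sqr_sum_le (fun k : J => cmodulus (P k)); rewrite card_ffun !card_ord => h.
have nd0 : 0 <= (n ^ d)%:R * (D ^+ n.-1) ^+ d by rewrite mulr_ge0// exprn_ge0// exprn_ge0.
rewrite (le_trans (y := ((n ^ d)%:R * (D ^+ n.-1) ^+ d * \sum_k cmodulus (P k)) ^+ 2))//.
  by rewrite ler_sqr ?nnegrE//; exact: (mulr_ge0 nd0 SP0).
by rewrite exprMn -[leRHS]mulrA ler_wpM2l ?sqr_ge0.
Qed.

End vandermonde.

(** * Test functions and eigenvalue lower bounds *)

Section translations.
Context {R : realType} {d : nat}.
Hypothesis d0 : (0 < d)%N.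
Local Notation mu := (lebesgue_Rd R d).
Local Notation q := (sqn (L2ip mu)).
Implicit Types (a x xi : 'rV[R]_d).

Lemma sqL2_shift (f : Rd R d -> R[i]) a : cmeas f ->
  sqL2 mu (fun x => f ((x : 'rV[R]_d) + a)) = sqL2 mu f.
Proof.
move=> mf; have mp := measure_preserving_shift d0 a.
rewrite /sqL2 -(ge0_integral_preserving mp (f := fun x => (cmodulus (f x) ^+ 2)%:E))//.
- by apply/measurable_EFinP; exact: measurable_sqr_cmodulus.
- by move=> x; rewrite lee_fin sqr_ge0.
Qed.

Lemma cL2_shift (f : Rd R d -> R[i]) a : cL2 mu f -> cL2 mu (fun x => f ((x : 'rV[R]_d) + a)).
Proof.
move=> [mf foo]; split; last by rewrite sqL2_shift.
exact: (cmeas_preserving (measure_preserving_shift d0 a) mf).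
Qed.

Lemma sqn_shift (f : Rd R d -> R[i]) a : cL2 mu f ->
  q (fun x => f ((x : 'rV[R]_d) + a)) = q f.
Proof.
move=> L2f; have := sqL2E (cL2_shift a L2f); rewrite (sqL2_shift a L2f.1) (sqL2E L2f).
by case.
Qed.

Lemma clip_shift (u : 'rV[R]_d -> R[i]) a : clip u -> clip (fun x => u (x - a)).
Proof.
move=> [M [L [L0 su lu]]].
have s0 : 0 <= \sum_(i < d) `|a ord0 i| by exact: sumr_ge0.
exists (M + Num.bound (\sum_(i < d) `|a ord0 i|))%N, L; split=> //.
  move=> x ux i; have := su _ ux i; rewrite !mxE => h.
  rewrite -(subrK (a ord0 i) (x ord0 i)) (le_lt_trans (ler_normD _ _))// natrD ltr_leD//.
  rewrite (le_trans _ (ltW (archi_boundP s0)))// (bigD1 i)//= lerDl.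
  by apply: sumr_ge0.
move=> x y h h0 hx; apply: lu => // i.
by rewrite !mxE opprD addrACA subrr addr0.
Qed.

Lemma ft_shift (u : 'rV[R]_d -> R[i]) a xi : clip u ->
  ft (fun x => u (x - a)) xi = ch a xi * ft u xi.
Proof.
move=> cu; have L1u := clip_cL1 d0 cu; have L1s := clip_cL1 d0 (clip_shift a cu).
rewrite /ft -(cintZ _ (cL1_ch xi L1u)).
rewrite -(cint_preserving (measure_preserving_shift d0 a) (cL1_ch xi L1s).1).
by congr cint; apply/funext => x; rewrite addrK chDl mulrA [ch x xi * _]mulrC.
Qed.

End translations.

Section test_functions.
Context {R : realType} {d : nat}.
Hypothesis d0 : (0 < d)%N.
Local Notation mu := (lebesgue_Rd R d).
Local Notation q := (sqn (L2ip mu)).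
Implicit Types (x xi : 'rV[R]_d) (m : nat).
Let sip := @L2_semi_ip _ _ _ mu.

Definition bump m x : R[i] := (tent (0, 0) m x)%:C%C.

Lemma idist00 x i : idist (0, 0) x i = `|x ord0 i|.
Proof.
rewrite /idist !mxE sub0r subr0.
by case: (ler0P (x ord0 i)) => h; rewrite /Num.max; do ?[case: ifPn]; lra.
Qed.

Lemma bump_support m x i : (0 < m)%N -> bump m x != 0 -> `|x ord0 i| < m%:R^-1.
Proof.
move=> m0 bx; have m0R : 0 < m%:R :> R by rewrite ltr0n.
rewrite -[_^-1]mulr1 ltr_pdivlMl// ltNge; apply: contra bx => h.
by rewrite /bump (@tent_out _ _ _ _ _ i)// idist00.
Qed.

Lemma clip_bump m : (0 < m)%N -> clip (bump m).
Proof. exact: clip_tent. Qed.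

Lemma cmodulus_bump m x : cmodulus (bump m x) = tent (0, 0) m x.
Proof. by rewrite /bump cmodulusR ger0_norm ?tent_ge0. Qed.

Lemma bump_le1 m x : cmodulus (bump m x) <= 1.
Proof. by rewrite cmodulus_bump tent_le1. Qed.

Let mass m : R := \int[mu]_x cmodulus (bump m x).

Lemma bump_mass_gt0 m : (0 < m)%N -> 0 < mass m.
Proof.
(* On the cube of radius [e] the $\ell^1$ norm is at most $de=1/(2m)$, so the bump is at least $1/2$
   there. *)
move=> m0; pose e : R := ((2 * m * d)%:R)^-1.
have e0 : 0 < e by rewrite invr_gt0 ltr0n !muln_gt0 m0.
pose Q : set 'rV[R]_d := box (const_mx (- e), const_mx e).
have mQ : (lebesgue_outer R d).-cara.-measurable Q by exact: measurable_box.
have vQ : mu Q = ((2 * e) ^+ d)%:E.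
  rewrite /lebesgue_Rd lebesgue_outer_box// /box_volume; congr (_%:E).
  rewrite -[X in _ ^+ X](card_ord d) -prodr_const; apply: eq_bigr => i _ /=.
  by rewrite !mxE opprK (_ : e + e = 2 * e) ?max_r//; lra.
have Qoo : (mu Q < +oo)%E by rewrite vQ ltry.
apply: (@lt_le_trans _ _ (2^-1 * fine (mu Q))).
  by rewrite vQ /= mulr_gt0 ?invr_gt0 ?exprn_gt0// mulr_gt0.
have -> : 2^-1 * fine (mu Q) = \int[mu]_x (2^-1 * \1_Q x).
  have := integrableR_indic 1 mQ Qoo; under eq_fun do rewrite mul1r; move=> i1.
  rewrite (RintegralZl _ measurableT i1) /Rintegral.
  by rewrite (integral_indic _ measurableT mQ) setIT.
apply: (le_Rintegral measurableT (integrableR_indic 2^-1 mQ Qoo) (cL1_cmodulus (clip_cL1 d0 (clip_bump m0)))) => x _.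
rewrite cmodulus_bump indicE; case: (boolP (x \in Q)) => [/set_mem xQ|_]; last by rewrite mulr0 tent_ge0.
rewrite mulr1 /tent le_max; apply/orP; right.
have : m%:R * \sum_(i < d) idist (0, 0) x i <= 2^-1.
  apply: (@le_trans _ _ (m%:R * \sum_(i < d) e)).
    apply: ler_wpM2l => //; apply: ler_sum => i _; rewrite idist00 ler_norml.
    by have := xQ i; rewrite !mxE.
  have mn : m%:R != 0 :> R by rewrite pnatr_eq0 -lt0n.
  have dn : d%:R != 0 :> R by rewrite pnatr_eq0 -lt0n.
  rewrite sumr_const card_ord -mulr_natr /e !natrM le_eqVlt; apply/orP; left; apply/eqP.
  by field; rewrite mn dn.
lra.
Qed.

(** The bump is nonnegative and concentrated near 0, so at frequencies bounded by [K] the character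
    differs from 1 by at most $1/2$ on its support and the transform keeps half of the mass. *)
Lemma ft_bump_ge m xi (K : R) : (0 < m)%N -> (forall i, `|xi ord0 i| <= K) ->
  2 * pi * (d%:R * (m%:R^-1 * K)) <= 2^-1 -> mass m / 2 <= cmodulus (ft (bump m) xi).
Proof.
move=> m0 xiK Km; have L1b := clip_cL1 d0 (clip_bump m0).
have m1 : 0 <= m%:R^-1 :> R by rewrite invr_ge0.
have K0 : 0 <= K.
  by have := xiK (Ordinal d0); apply: le_trans.
have E : cint mu (bump m : Rd R d -> R[i]) = (mass m)%:C%C.
  rewrite /cint /mass /=; congr (_ +i* _)%C.
    by apply: eq_Rintegral => x _; rewrite cmodulus_bump.
  by rewrite /Rintegral integral0.
have h : cmodulus (cint mu (bump m : Rd R d -> R[i]) - ft (bump m) xi) <= mass m / 2.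
  rewrite /ft -(cintB L1b (cL1_ch xi L1b)).
  have L1d := cL1D L1b (cL1N (cL1_ch xi L1b)).
  rewrite (le_trans (cmodulus_cint L1d))//.
  have i2 := integrableR_Z 2^-1 (cL1_cmodulus L1b).
  have -> : mass m / 2 = \int[mu]_x (2^-1 * cmodulus (bump m x)).
    by rewrite (RintegralZl _ measurableT (cL1_cmodulus L1b)) mulrC.
  apply: (le_Rintegral measurableT (cL1_cmodulus L1d) i2) => x _.
  rewrite -{1}[bump m x]mul1r -mulrBl cmodulusM.
  have [->|bx] := eqVneq (bump m x) 0; first by rewrite cmodulus0 !mulr0.
  rewrite ler_wpM2r ?cmodulus_ge0// (le_trans _ Km)//.
  have -> : 1 = ch (0 : 'rV[R]_d) xi.
    by rewrite /ch /dot big1 ?mulr0 ?expNi0// => i _; rewrite mxE mul0r.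
  apply: cmodulus_chB => // i.
  by rewrite mxE sub0r normrN; exact: ltW (bump_support i m0 bx).
have := ler_cmodulusB (cint mu (bump m : Rd R d -> R[i])) (ft (bump m) xi).
rewrite E cmodulusR ger0_norm; last exact: ltW (bump_mass_gt0 m0).
by rewrite E in h; move=> h2; have := le_trans h2 h; lra.
Qed.

End test_functions.

Section eigenvalue_estimate.
Context {R : realType} {d : nat}.
Hypothesis d0 : (0 < d)%N.
Local Notation mu := (lebesgue_Rd R d).
Local Notation q := (sqn (L2ip mu)).
Implicit Types (x xi : 'rV[R]_d) (m n : nat).
Let sip := @L2_semi_ip _ _ _ mu.
Variables (A B : set 'rV[R]_d).
Hypotheses (mA : (lebesgue_outer R d).-cara.-measurable A)
  (mB : (lebesgue_outer R d).-cara.-measurable B).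
Variables (x0 xi0 : 'rV[R]_d) (r : R).
Hypotheses (r0 : 0 < r) (r1 : r <= 1).
Hypotheses (hA : forall x, (forall i, `|x ord0 i - x0 ord0 i| <= r) -> A x)
  (hB : forall xi, (forall i, `|xi ord0 i - xi0 ord0 i| <= r) -> B xi).

Let box_finite I : (mu (box I) < +oo)%E.
Proof. by rewrite (le_lt_trans (lebesgue_outer_box_le _))// ltry. Qed.

(** [K] bounds the frequencies in the box inside [B], as $r\le 1$. The first summand in [m] puts the
    support of the bump within $r/2$ of 0, the second makes [ft_bump_ge] applicable up to [K]. *)
Let K : R := \sum_(i < d) `|xi0 ord0 i| + 1.
Let m : nat := (Num.bound (2 / r + 4 * pi * d%:R * K)).+1.
Let psi := @bump R d m.
Let c1 : R := (\int[mu]_x cmodulus (psi x)) / 2.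

Let K0 : 0 < K.
Proof. by rewrite ltr_wpDl// sumr_ge0. Qed.

Let m_gt : 2 / r + 4 * pi * d%:R * K <= m%:R.
Proof.
have h : 0 <= 2 / r + 4 * pi * d%:R * K.
  by rewrite addr_ge0 ?divr_ge0 ?(ltW r0)// !mulr_ge0 ?pi_ge0 ?(ltW K0).
by rewrite (le_trans (ltW (archi_boundP h)))// ler_nat.
Qed.

Let mR : 0 < m%:R :> R. Proof. by rewrite ltr0n. Qed.

Let m_inv : m%:R^-1 <= r / 2.
Proof.
rewrite -[r / 2]invrK lef_pV2 ?posrE ?invr_gt0 ?divr_gt0//.
rewrite invf_div (le_trans _ m_gt)// lerDl !mulr_ge0 ?pi_ge0 ?(ltW K0)//.
Qed.

Let m_K : 2 * pi * (d%:R * (m%:R^-1 * K)) <= 2^-1.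
Proof.
have h : 4 * pi * d%:R * K <= m%:R.
  by apply: le_trans m_gt; rewrite lerDr divr_ge0// ltW.
have -> : 2 * pi * (d%:R * (m%:R^-1 * K)) = (4 * pi * d%:R * K) / m%:R / 2 by field; rewrite gt_eqF.
by rewrite ler_pdivrMr// mulVf// ler_pdivrMr// mul1r.
Qed.

Let c10 : 0 < c1. Proof. by rewrite divr_gt0// (bump_mass_gt0 d0). Qed.

Let V0 : R := fine (mu (box (x0 - const_mx r, x0 + const_mx r))).

Let V00 : 0 < V0.
Proof.
have -> : V0 = (2 * r) ^+ d; last by rewrite exprn_gt0// mulr_gt0.
rewrite /V0 -[RHS]/(fine ((2 * r) ^+ d)%:E); congr fine.
apply: (etrans (lebesgue_outer_box d0 _)); rewrite /box_volume; congr (_%:E).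
rewrite -[X in _ ^+ X](card_ord d) -prodr_const; apply: eq_bigr => i _ /=.
by rewrite !mxE (_ : _ - _ = 2 * r) ?max_r//; [rewrite mulr_ge0// ltW|ring].
Qed.

Section fixed_n.
Variable n : nat.
Hypothesis n0 : (0 < n)%N.
Local Notation J := {ffun 'I_d -> 'I_n}.

Let nR : 0 < n%:R :> R. Proof. by rewrite ltr0n. Qed.

(** The translations by $t j$ with $j<n$ stay within $r/2$, leaving $r/2$ for the support of the
    bump. The sampling step [tau] is also the side of the cell, so $n$ consecutive cells fill a
    length $r$ in each direction. *)
Let t : R := r / (2 * n%:R).
Let tau : R := r / n%:R.
Let aj (j : J) : 'rV[R]_d := x0 + \row_i (t * (j i)%:R).
Let tk (k : J) : 'rV[R]_d := \row_i (tau * (k i)%:R).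
Let h (j : J) : Rd R d -> R[i] := fun x => psi (x - aj j).
Let alpha : R := 2 * pi * (t * tau).
Let z (l : 'I_n) : R[i] := expNi (alpha * l%:R).
Let delta : R := sine_slope R * (pi * r ^+ 2) / n%:R ^+ 2.

Let t0 : 0 < t. Proof. by rewrite divr_gt0// mulr_gt0. Qed.
Let tau0 : 0 < tau. Proof. by rewrite divr_gt0. Qed.

Let alphaE : alpha = pi * r ^+ 2 / n%:R ^+ 2.
Proof. by rewrite /alpha /t /tau; field; rewrite gt_eqF. Qed.

Let delta0 : 0 < delta.
Proof. by rewrite divr_gt0 ?exprn_gt0// mulr_gt0 ?sine_slope_gt0// mulr_gt0 ?pi_gt0 ?exprn_gt0. Qed.

Let ord_le (l : 'I_n) : l%:R <= n%:R - 1 :> R.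
Proof. by rewrite lerBrDr natr1 ler_nat. Qed.

Let clip_h j : clip (h j).
Proof. exact: (clip_shift (aj j) (clip_bump (ltn0Sn _))). Qed.

Let h_support j x : h j x != 0 -> forall i, `|x ord0 i - x0 ord0 i| <= r.
Proof.
move=> hx i; have := bump_support i (ltn0Sn _) hx.
rewrite -/m !mxE opprD addrA => h1.
have tj : t * (j i)%:R <= r / 2.
  have -> : r / 2 = t * n%:R by rewrite /t; field; rewrite gt_eqF.
  by rewrite ler_wpM2l ?(ltW t0)// ler_nat ltnW.
have tj0 : 0 <= t * (j i)%:R by rewrite mulr_ge0 ?(ltW t0).
rewrite -(subrK (t * (j i)%:R) (x ord0 i - x0 ord0 i)).
rewrite (le_trans (ler_normD _ _))// (ger0_norm tj0).
by have := m_inv; lra.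
Qed.

Let z1 l : cmodulus (z l) <= 1.
Proof. by rewrite /z cmodulus_expNi. Qed.

(** Phases differ by at most $\alpha n=\pi r^2/n\le\pi$, so the nodes do not wrap around the circle.
    Distinct nodes have phases at least $\alpha$ apart, which gives [delta] through the slope of the
    sine. *)
Let zd (j l : 'I_n) : j != l -> delta <= cmodulus (z j - z l).
Proof.
move=> jl; have a0 : 0 <= alpha by rewrite alphaE divr_ge0 ?exprn_ge0 ?mulr_ge0 ?pi_ge0 ?exprn_ge0 ?(ltW r0).
have -> : z j - z l = z j * (1 - expNi (alpha * (l%:R - j%:R))).
  by rewrite /z mulrBr mulr1 -expNiD -mulrDr [j%:R + _]addrC subrK.
rewrite cmodulusM {1}/z cmodulus_expNi mul1r.
have jl1 : 1 <= `|l%:R - j%:R : R|.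
  move: jl; rewrite -val_eqE neq_ltn/= ler_normr => /orP[] h1; apply/orP; [left|right];
    by move: h1; rewrite -(ler_nat R) -natr1; lra.
have jln : `|l%:R - j%:R : R| <= n%:R.
  rewrite ler_norml; have := ord_le l; have := ord_le j.
  have : 0 <= l%:R :> R by []. have : 0 <= j%:R :> R by [].
  by move=> ? ? ? ?; apply/andP; split; lra.
apply: le_trans (cmodulus_1B_expNi_ge _); rewrite normrM (ger0_norm a0).
  rewrite /delta -mulrA -alphaE ler_wpM2l ?(ltW (sine_slope_gt0 _))//.
  by rewrite ler_peMr.
rewrite (le_trans (ler_wpM2l a0 jln))// alphaE.
have -> : pi * r ^+ 2 / n%:R ^+ 2 * n%:R = pi * (r ^+ 2 / n%:R) by field; rewrite gt_eqF.
rewrite ler_piMr ?pi_ge0// ler_pdivrMr// mul1r.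
have r21 : r ^+ 2 <= 1 by rewrite exprn_ile1// ltW.
by rewrite (le_trans r21)// ler1n.
Qed.

Let D : R := (n ^ d)%:R * ((2 / delta) ^+ n.-1) ^+ d.
Let Lam : R := D ^+ 2 * (n ^ d)%:R.
Let kappa : R := c1 ^+ 2 * tau ^+ d / (Lam * (n ^ d)%:R).

Let cell : set 'rV[R]_d := box (xi0, xi0 + const_mx tau).

Let mcell : (lebesgue_outer R d).-cara.-measurable cell.
Proof. exact: measurable_box. Qed.

Let vcell : mu cell = (tau ^+ d)%:E.
Proof.
rewrite /lebesgue_Rd lebesgue_outer_box// /box_volume; congr (_%:E).
rewrite -[X in _ ^+ X](card_ord d) -prodr_const; apply: eq_bigr => i _ /=.
by rewrite !mxE [X in X - _]addrC addrK max_r// ltW.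
Qed.

Let cell_oo : (mu cell < +oo)%E. Proof. by rewrite vcell ltry. Qed.

Let cell_B s k : cell s -> forall i, `|(s + tk k) ord0 i - xi0 ord0 i| <= r.
Proof.
move=> cs i; have /andP[] := cs i; rewrite !mxE => h1 h2.
have tk0 : 0 <= tau * (k i)%:R by rewrite mulr_ge0// ltW.
have tk1 : tau * (k i)%:R <= r - tau.
  have -> : r - tau = tau * (n%:R - 1) by rewrite /tau; field; rewrite gt_eqF.
  by rewrite ler_wpM2l ?(ltW tau0).
by rewrite ger0_norm; lra.
Qed.

Section coefficients.
Variable c : J -> R[i].
Let S : R := \sum_j cmodulus (c j).
Let G : Rd R d -> R[i] := \sum_j c j *: (fun xi => ft (h j) xi).

Let L2G : cL2 mu G.
Proof. apply: (sipH_sum sip) => [|i]; [exact: cL2_0|exact: (cL2_ft d0 (clip_h i))]. Qed.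

(** At $s+\tau k$ the transform of the combination is the transform of one bump times a tensor
    Vandermonde sum. The phase depending on [s] is absorbed in the coefficients [b j] without
    changing their moduli, so the bound is uniform in [s]. *)
Let G_lower s : cell s -> (c1 * S) ^+ 2 <= Lam * \sum_(k : J) cmodulus (G (s + tk k)) ^+ 2.
Proof.
move=> cs; pose b j := c j * ch (\row_i (t * (j i)%:R)) s.
have bc j : cmodulus (b j) = cmodulus (c j) by rewrite /b cmodulusM cmodulus_ch mulr1.
have GE (k : J) : G (s + tk k) = ch x0 (s + tk k) * ft psi (s + tk k) *
    \sum_(j : J) b j * \prod_(i < d) z (j i) ^+ k i.
  rewrite /G fct_sumE mulr_sumr; apply: eq_bigr => j _.
  rewrite -[LHS]/(c j * ft (h j) (s + tk k)).
  have -> : ft (h j) (s + tk k) = ch (aj j) (s + tk k) * ft psi (s + tk k).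
    exact: (ft_shift d0 (aj j) (s + tk k) (clip_bump (ltn0Sn _))).
  have -> : \prod_(i < d) z (j i) ^+ k i = ch (\row_i (t * (j i)%:R)) (tk k).
    rewrite /ch /dot mulr_sumr (big_morph _ (@expNiD R) (@expNi0 R)).
    by apply: eq_bigr => i _; rewrite !mxE /z -expNiX; congr expNi; rewrite /alpha; ring.
  rewrite /aj chDl (chDr _ _ (\row_i _)) /b; ring.
have Glow (k : J) : c1 ^+ 2 * cmodulus (\sum_(j : J) b j * \prod_(i < d) z (j i) ^+ k i) ^+ 2 <=
    cmodulus (G (s + tk k)) ^+ 2.
  rewrite GE !cmodulusM cmodulus_ch mul1r [leRHS]exprMn ler_wpM2r ?sqr_ge0//.
  rewrite ler_sqr ?nnegrE ?cmodulus_ge0 ?(ltW c10)//.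
  apply: (ft_bump_ge d0 (ltn0Sn _) _ m_K) => i.
  have := cell_B k cs i; rewrite -{2}(subrK (xi0 ord0 i) ((s + tk k) ord0 i)) => hi.
  rewrite (le_trans (ler_normD _ _))// /K addrC lerD ?(le_trans hi)//.
  by rewrite (bigD1 i)//= lerDl sumr_ge0.
have TV := tensor_vandermonde_bound delta0 z1 zd b.
rewrite exprMn /S; under eq_bigr do rewrite -bc.
apply: (le_trans (ler_wpM2l (sqr_ge0 c1) TV)).
rewrite mulrCA ler_wpM2l//.
  by rewrite mulr_ge0 ?sqr_ge0.
by rewrite mulr_sumr; apply: ler_sum.
Qed.

(** [G_lower] is integrated over [s] in one cell. Each of the $n^d$ translated cells lies in the box
    inside [B] and is bounded by the whole of [q (P_op B G)]; this costs the last factor $n^d$ in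
    [kappa]. *)
Lemma test_function_lower_bound : kappa * S ^+ 2 <= q (P_op B G).
Proof.
have L2PG := cL2_P_op mB L2G.
pose g (k : J) : Rd R d -> R[i] := fun s => \1_cell s * G ((s : 'rV[R]_d) + tk k).
have L2g k : cL2 mu (g k).
  exact: (cL2_bounded (cmeas_indic mcell) (cL2_shift d0 (tk k) L2G) (indic_le1 cell)).
have qg k : q (g k) <= q (P_op B G).
  rewrite -(sqn_shift d0 (- tk k) (L2g k)).
  apply: (sqn_le (cL2_shift d0 (- tk k) (L2g k)) L2PG) => s.
  rewrite /g subrK /P_op !cmodulus_indic_mul ler_wpM2r ?cmodulus_ge0// !indicE ler_nat.
  case: (boolP (_ \in cell)) => // /set_mem cs.
  by rewrite mem_set//; apply: hB => i; have := cell_B k cs i; rewrite subrK.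
pose f : Rd R d -> R[i] := fun s => \1_cell s * ((c1 * S)%:C)%C.
have L2f : cL2 mu f.
  apply: (cL2_indic_bounded (K := cmodulus ((c1 * S)%:C)%C) mcell cell_oo (cmeas_cst _)) => x.
  exact: lexx.
have qf : q f = (c1 * S) ^+ 2 * tau ^+ d.
  rewrite sqnL2.
  have := integrableR_indic 1 mcell cell_oo; under eq_fun do rewrite mul1r; move=> i1.
  under eq_Rintegral do rewrite cmodulus_indicM_sqr cmodulusR real_normK ?num_real// mulrC.
  rewrite (RintegralZl _ measurableT i1) /Rintegral.
  by rewrite (integral_indic _ measurableT mcell) setIT [X in fine X]vcell.
have Lam0 : 0 <= Lam by rewrite mulr_ge0 ?sqr_ge0.
have := @sqn_le_sum _ _ _ mu J (index_enum J) Lam f g Lam0 L2f L2g.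
have pw x : cmodulus (f x) ^+ 2 <= Lam * \sum_k cmodulus (g k x) ^+ 2.
  rewrite /f /g (cmodulus_indicM_sqr (T := Rd R d) cell (fun=> ((c1 * S)%:C)%C)).
  under eq_bigr => k _ do rewrite (cmodulus_indicM_sqr (T := Rd R d) cell (fun s => G ((s : 'rV[R]_d) + tk k))).
  rewrite -mulr_sumr [leRHS]mulrCA (cmodulusR (c1 * S)) (real_normK (num_real (c1 * S))) indicE.
  case: (boolP (x \in cell)) => [/set_mem cs|_]; last by rewrite !mul0r.
  by rewrite !mul1r; exact: G_lower.
move=> /(_ pw); rewrite qf => H.
have {}H : (c1 * S) ^+ 2 * tau ^+ d <= Lam * ((n ^ d)%:R * q (P_op B G)).
  apply: (le_trans H); rewrite ler_wpM2l//.
  rewrite (le_trans (ler_sum _ (fun k _ => qg k)))// sumr_const card_ffun !card_ord.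
  by rewrite mulr_natl.
have LN : 0 < Lam * (n ^ d)%:R.
  have nd : 0 < (n ^ d)%:R :> R by rewrite ltr0n expn_gt0 n0.
  by rewrite mulr_gt0// mulr_gt0// exprn_gt0// mulr_gt0// exprn_gt0// exprn_gt0// divr_gt0.
rewrite /kappa mulrAC ler_pdivrMr//.
by rewrite mulrAC -exprMn (le_trans H)// mulrA mulrC.
Qed.

Lemma test_function_norm : q (\sum_j c j *: h j) <=
  S ^+ 2 * fine (mu (box (x0 - const_mx r, x0 + const_mx r))).
Proof.
apply: sqn_bounded_support.
- exact: measurable_box.
- exact: box_finite.
- suff : cL2 mu (\sum_j c j *: h j) by case.
  by apply: (sipH_sum sip) => [|i]; [exact: cL2_0|exact: (clip_cL2 d0 (clip_h i))].
move=> x; rewrite fct_sumE (le_trans (cmodulus_sum _ _ _))// /S mulr_suml.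
apply: ler_sum => j _; rewrite -[X in cmodulus X]/(c j * h j x) cmodulusM ler_wpM2l ?cmodulus_ge0//.
have [->|hx] := eqVneq (h j x) 0; first by rewrite cmodulus0.
rewrite indicE mem_set ?bump_le1// => i /=; rewrite !mxE.
by have := h_support hx i; rewrite ler_norml => /andP[? ?]; apply/andP; split; lra.
Qed.

Lemma test_function_fgr : fgr (\sum_j c j *: h j) G.
Proof. exact: (fgr_sum d0 c (fun j => fgr_clip d0 (clip_h j))). Qed.

Lemma test_function_P_op_le : q (P_op B G) <= q (\sum_j c j *: h j).
Proof. by rewrite (fgr_sqn d0 test_function_fgr); exact: (P_op_le mB L2G). Qed.

End coefficients.

Let nd0 : 0 < (n ^ d)%:R :> R. Proof. by rewrite ltr0n expn_gt0 n0. Qed.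

Let LN : 0 < Lam * (n ^ d)%:R.
Proof.
by rewrite mulr_gt0// mulr_gt0// exprn_gt0// mulr_gt0// exprn_gt0// exprn_gt0// divr_gt0.
Qed.

Let kappa0 : 0 < kappa.
Proof. by rewrite divr_gt0// mulr_gt0 ?exprn_gt0. Qed.

Section eigensystem.
Hypothesis cS : compact_operator (S_op A B).
Variables (lam : nat -> R) (v : nat -> Rd R d -> R[i]).
Hypothesis eigS : eigensystem (S_op A B) lam v.

Lemma eigenvalue_kappa_bound k : (k < n ^ d)%N -> kappa / V0 <= lam k.
Proof.
move=> kn.
apply: (S_op_eigenvalue_lower_bound d0 mA mB cS eigS (h := h) (divr_gt0 kappa0 V00) clip_h).
- by move=> j x hx; apply: hA; exact: h_support hx.
- move=> c [i ci].
  have S0 : 0 < \sum_j cmodulus (c j).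
    rewrite (bigD1 i)//= ltr_wpDr ?sumr_ge0// => [j _|]; first exact: cmodulus_ge0.
    by rewrite lt_def cmodulus_eq0 ci cmodulus_ge0.
  have lb := test_function_lower_bound c; have ub := test_function_norm c.
  split.
    (* Linear independence of the translates needs no separate proof: the norm of the combination
       dominates that of its transform on [B], which is already bounded below. *)
    apply: (lt_le_trans _ (test_function_P_op_le c)); apply: lt_le_trans lb.
    by rewrite mulr_gt0// exprn_gt0.
  apply: le_trans lb; apply: (le_trans (ler_wpM2l _ ub)); first by rewrite divr_ge0// ltW.
  by rewrite mulrCA mulrC divfK// gt_eqF.
- by rewrite card_ffun !card_ord.
Qed.

End eigensystem.

(** In the exponent $5d$, one $d$ comes from $\tau^d$ and four from the powers of $n^d$ in
    [Lam * (n ^ d)%:R]. The maximum with 1 makes the base at least 1, so that $n-1$ may be raised to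
    $n$. The constant [C2] does not depend on [n]. *)
Lemma kappa_ge : exists2 C2, C2 = c1 ^+ 2 * r ^+ d / V0 &
  C2 / (n%:R ^+ (5 * d) * ((Num.max 1 (2 / (sine_slope R * (pi * r ^+ 2))) * n%:R ^+ 2) ^+ (2 * d * n))) <= kappa / V0.
Proof.
eexists; first reflexivity.
set E := Num.max 1 _.
have E1 : 1 <= E by rewrite le_max lexx.
have n1 : 1 <= n%:R :> R by rewrite ler1n.
have En : 1 <= E * n%:R ^+ 2 by rewrite mulr_ege1// exprn_ege1.
have dE : 2 / delta <= E * n%:R ^+ 2.
  rewrite /delta invf_div mulrCA [leLHS]mulrC ler_wpM2r ?exprn_ge0//.
  by rewrite le_max lexx orbT.
have d20 : 0 <= 2 / delta by rewrite divr_ge0// ltW.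
have X : (2 / delta) ^+ n.-1 <= (E * n%:R ^+ 2) ^+ n.
  rewrite (le_trans (y := (E * n%:R ^+ 2) ^+ n.-1))//; first by rewrite lerXn2r// ?nnegrE// (le_trans d20).
  by rewrite ler_weXn2l// leq_pred.
have -> : kappa / V0 = c1 ^+ 2 * r ^+ d / V0 / (n%:R ^+ d * (Lam * (n ^ d)%:R)).
  rewrite /kappa /tau (expr_div_n r) [in RHS](invfM (n%:R ^+ d)).
  by move: (c1 ^+ 2) (r ^+ d) ((n%:R ^+ d)^-1) ((Lam * (n ^ d)%:R)^-1) (V0^-1) => *; ring.
rewrite ler_wpM2l//; first by rewrite divr_ge0 ?(ltW V00)// mulr_ge0 ?exprn_ge0 ?(ltW c10) ?(ltW r0).
rewrite lef_pV2 ?posrE; last 2 first.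
- by rewrite mulr_gt0 ?exprn_gt0// (lt_le_trans _ En).
- by rewrite mulr_gt0 ?exprn_gt0.
set Y := (E * n%:R ^+ 2) ^+ (2 * d * n).
have -> : n%:R ^+ (5 * d) * Y = n%:R ^+ d * ((n ^ d)%:R ^+ 4 * Y).
  have -> : (5 * d = d + d * 4)%N by rewrite -mulnS mulnC.
  by rewrite exprD exprM natrX mulrA.
rewrite ler_wpM2l ?exprn_ge0// /Lam /D.
set Z := ((2 / delta) ^+ n.-1) ^+ d; set N := (n ^ d)%:R.
have -> : (N * Z) ^+ 2 * N * N = N ^+ 4 * Z ^+ 2 by ring.
have -> : Y = ((E * n%:R ^+ 2) ^+ n) ^+ (d * 2).
  by rewrite /Y -exprM mulnC [(2 * d)%N]mulnC.
rewrite ler_wpM2l ?exprn_ge0// /Z -exprM.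
by rewrite lerXn2r ?nnegrE ?exprn_ge0// (le_trans _ En).
Qed.

End fixed_n.

Lemma eigenvalue_exp_lower_bound (lam : nat -> R) (v : nat -> Rd R d -> R[i]) :
  compact_operator (S_op A B) -> eigensystem (S_op A B) lam v ->
  exists2 C, 0 < C & forall n k, (2 <= n)%N -> (k < n ^ d)%N ->
    expR (- (C * (n%:R * ln n%:R))) <= lam k.
Proof.
move=> cS eigS.
set E := Num.max 1 (2 / (sine_slope R * (pi * r ^+ 2))).
have E1 : 1 <= E by rewrite le_max lexx.
pose C2 := c1 ^+ 2 * r ^+ d / fine (mu (box (x0 - const_mx r, x0 + const_mx r))).
have C20 : 0 < C2 by rewrite divr_gt0 ?V00// mulr_gt0// exprn_gt0.
have l2 : 0 < ln 2 :> R by rewrite ln_gt0// ltr1n.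
pose c3 := `|ln C2|; have c30 : 0 <= c3 by exact: normr_ge0.
have lE : 0 <= ln E by rewrite ln_ge0.
pose D : R := d%:R.
have D0 : 0 < D by rewrite ltr0n.
(* The terms account in turn for the constant factor, the polynomial factor and the exponential
   factor in [kappa_ge]. Since $n\ge 2$, division by [ln 2] lets $n\ln n$ absorb constants and
   multiples of $n$. *)
pose C := c3 / ln 2 + 5 * D + 2 * D * (ln E / ln 2 + 2).
have q1 : 0 <= c3 / ln 2 by rewrite divr_ge0// ltW.
have q2 : 0 <= ln E / ln 2 by rewrite divr_ge0// ltW.
exists C; first by rewrite /C ltr_wpDr ?mulr_ge0 ?addr_ge0 ?(ltW D0)// ltr_wpDl// mulr_gt0.
move=> n k n2 kn; have n0 : (0 < n)%N by rewrite (leq_trans _ n2).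
have nR : 0 < n%:R :> R by rewrite ltr0n.
apply: le_trans (eigenvalue_kappa_bound n0 cS eigS kn).
have [_ -> ] := kappa_ge n0; apply: le_trans; rewrite -/C2 -/E.
set y := ln n%:R.
have y2 : ln 2 <= y by rewrite ler_ln ?posrE// ler_nat.
have y0 : 0 < y := lt_le_trans l2 y2.
have ny : y <= n%:R * y by rewrite ler_peMl ?(ltW y0)// ler1n.
have nl : n%:R <= n%:R * y / ln 2 by rewrite ler_pdivlMr// ler_wpM2l// ltW.
have l1 : 1 <= n%:R * y / ln 2 by rewrite (le_trans _ nl)// ler1n.
have -> : n%:R ^+ (5 * d) * (E * n%:R ^+ 2) ^+ (2 * d * n) =
    expR (5 * D * y + (2 * D * n%:R) * (ln E + 2 * y)).
  rewrite expRD; congr (_ * _).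
    by rewrite /D -natrM expRM_natl /y lnK ?posrE.
  rewrite /D -!natrM expRM_natl expRD expRM_natl !lnK ?posrE//.
  exact: lt_le_trans E1.
rewrite -expRN.
apply: (@le_trans _ _ (expR (- c3) * expR (- (5 * D * y + (2 * D * n%:R) * (ln E + 2 * y))))); last first.
  rewrite ler_wpM2r ?expR_ge0// -[leRHS](lnK (x := C2)) ?posrE// ler_expR /c3.
  by rewrite lerNl -normrN ler_norm.
rewrite -expRD ler_expR -opprD lerN2 /C.
have h1 : c3 <= c3 / ln 2 * (n%:R * y).
  by rewrite mulrAC -mulrA ler_peMr.
have h2 : 5 * D * y <= 5 * D * (n%:R * y) by rewrite ler_wpM2l// mulr_ge0// ltW.
have h3 : 2 * D * n%:R * (ln E + 2 * y) <= 2 * D * (ln E / ln 2 + 2) * (n%:R * y).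
  have -> : 2 * D * n%:R * (ln E + 2 * y) = 2 * D * (ln E * n%:R + 2 * (n%:R * y)) by ring.
  rewrite -[leRHS]mulrA; apply: ler_wpM2l; first by rewrite mulr_ge0// ltW.
  rewrite [leRHS]mulrDl; apply: lerD => //.
  by rewrite -[leRHS]mulrA; apply: ler_wpM2l => //; rewrite mulrC.
lra.
Qed.

End eigenvalue_estimate.

(** * The admissibility integral *)

(** With $n=p+1$ and $d=k+1$: at least $n^{d-1}$ integers lie in $[(n-1)^d,n^d)$. *)
Lemma expn_succ_sub p k : (p ^ k.+1 + p.+1 ^ k <= p.+1 ^ k.+1)%N.
Proof.
rewrite !expnS mulSn addnC leq_add2l leq_mul//.
by case: k => // k; rewrite leq_exp2r.
Qed.

Section admissibility.
Context {R : realType}.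
Implicit Types (f : R -> R[i]) (C : R).

Lemma measurable_inv : measurable_fun [set: R] (fun x : R => x^-1).
Proof.
have mN : measurable [set x : R | x != 0].
  rewrite (_ : [set x : R | x != 0] = ~` [set 0]); first exact: measurableC.
  by apply/seteqP; split => x /=; [move/eqP|move=> h; exact/eqP].
rewrite (_ : [set: R] = [set x | x != 0] `|` [set 0]); last first.
  by apply/seteqP; split => x //= _; have [->|] := eqVneq x 0; [right|left].
apply/measurable_funU => //; split; last exact: measurable_fun_set1.
apply: open_continuous_measurable_fun; last by move=> x; rewrite inE/= => x0; exact: inv_continuous.
exact: open_neq.
Qed.

Lemma M0_nondecreasing f (x y : R) : x <= y -> (M0 f x <= M0 f y)%E.
Proof.
move=> xy; apply: ereal_sup_le => _ [z /= + <-].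
rewrite in_itv/= => /andP[z0 zx]; exists z => //=.
by rewrite in_itv/= z0 (le_trans zx).
Qed.

(** [M0 f] is non-decreasing, so its upper level sets are intervals; no measurability of [f] is
    assumed. *)
Lemma measurable_M0 f : measurable_fun [set: R] (M0 f).
Proof.
apply: (measurability _ (ErealGenOInfty.measurableE R)) => //.
move=> _ [_ [r ->] <-]; rewrite setTI; apply: is_interval_measurable.
move=> x y /= + + z /andP[xz zy]; rewrite !in_itv/= => /andP[rx _] _.
by rewrite (lt_le_trans rx (M0_nondecreasing _ xz)).
Qed.

Lemma M0_ge0 f (x : R) : 0 <= x -> (0 <= M0 f x)%E.
Proof.
move=> x0; apply: (@le_trans _ _ (cmodulus (f 0))%:E); first by rewrite lee_fin cmodulus_ge0.
by apply: ereal_sup_ubound; exists 0 => //=; rewrite in_itv/= lexx.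
Qed.

Lemma integral_inv (a b : R) : 0 < a -> a < b ->
  (\int[lebesgue_measure]_(x in `[a, b]) (x^-1)%:E = (ln b - ln a)%:E)%E.
Proof.
move=> a0 ab.
rewrite (@continuous_FTC2 _ (fun x : R => x^-1) (@ln R))//.
- apply: continuous_in_subspaceT => x /set_mem /=; rewrite in_itv/= => /andP[ax _].
  by apply: inv_continuous; rewrite gt_eqF// (lt_le_trans a0).
- split => [x| |].
  + rewrite in_itv/= => /andP[ax _].
    by have := is_derive1_ln (lt_trans a0 ax) => -[].
  + by apply: cvg_at_right_filter; exact: continuous_ln.
  + by apply: cvg_at_left_filter; apply: continuous_ln; exact: lt_trans ab.
- move=> x; rewrite in_itv/= => /andP[ax _].
  by rewrite derive1E; have := is_derive1_ln (lt_trans a0 ax) => -[].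
Qed.

Variables (d : nat) (C : R) (lam : nat -> R) (f : R -> R[i]) (beta : R).
Hypotheses (d0 : (0 < d)%N) (C0 : 0 < C) (b0 : 0 < beta)
  (lam0 : lam @ \oo --> (0 : R)) (lam_ge : forall n k, (2 <= n)%N -> (k < n ^ d)%N ->
    expR (- (C * (n%:R * ln n%:R))) <= lam k)
  (f_mono : forall x y : R, 0 <= x -> x <= y -> y <= beta -> cmodulus (f x) <= cmodulus (f y))
  (tc : (\sum_(0 <= n <oo) (cmodulus (f (lam n)))%:E < +oo)%E).

Let g x := cmodulus (f x).
Let phi n : R := C * (n%:R * ln n%:R).
Let e n : R := expR (- phi n).
(** Once $\ln n\ge T$, the constant [C] costs at most half of the logarithm: $\ln(Cn\ln n)\ge\ln
    n-|\ln C|\ge\ln(n)/2$, where $\ln\ln n\ge 0$ was dropped. *)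
Let T : R := Num.max 1 (2 * `|ln C|).

(** The condition on [lam] has [k.+1] because it is used for $k\ge(n-1)^d$, and then only $k+1\ge
    n\ge N$ is known. *)
Let threshold : exists N, [/\ (2 <= N)%N, forall k, (N <= k.+1)%N -> lam k <= beta,
  forall n, (N <= n)%N -> T <= ln n%:R & forall n, (N <= n)%N -> e n <= beta].
Proof.
have [K0 K0P] : exists K0, forall k, (K0 <= k)%N -> lam k <= beta.
  have /cvgrPdist_le/(_ _ b0)[K0 _ H] := lam0.
  exists K0 => k Kk; have := H k Kk; rewrite sub0r normrN; apply: le_trans; exact: ler_norm.
pose N := (2 + K0 + Num.bound (expR T) + Num.bound (`|ln beta| / C))%N.
have T1 : 1 <= T by rewrite le_max lexx.
have lnT n : (N <= n)%N -> T <= ln n%:R.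
  move=> Nn; have h : expR T <= n%:R.
    rewrite (le_trans (ltW (archi_boundP (expR_ge0 _))))// ler_nat (leq_trans _ Nn)// /N.
    by rewrite -addnA addnCA leq_addr.
  by rewrite -[leLHS]expRK ler_ln ?posrE ?expR_gt0// (lt_le_trans (expR_gt0 T)).
exists N; split=> //.
- move=> k Nk; apply: K0P; rewrite -ltnS (leq_trans _ Nk)// /N.
  by rewrite -!addnA addSn ltnS addnCA leq_addr.
- move=> n Nn; rewrite /e -[leRHS]lnK ?posrE// ler_expR lerNl.
  have lC : 0 <= `|ln beta| / C by rewrite divr_ge0// ltW.
  have h : `|ln beta| / C <= n%:R.
    rewrite (le_trans (ltW (archi_boundP lC)))// ler_nat (leq_trans _ Nn)// /N.
    by rewrite leq_addl.
  rewrite (le_trans (y := C * n%:R))//.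
    have := ler_norm (- ln beta); rewrite normrN => h2; apply: (le_trans h2).
    by rewrite mulrC -ler_pdivrMr.
  by rewrite /phi ler_pM2l// ler_peMr// (le_trans T1)// lnT.
Qed.

Lemma trace_class_admissible_of_lower_bound : trace_class_admissible d f.
Proof.
have [N [N2 lamN TN eN]] := threshold.
have T1 : 1 <= T by rewrite le_max lexx.
have TC : 2 * `|ln C| <= T by rewrite le_max lexx orbT.
have y1 n : (N <= n)%N -> 1 <= ln n%:R :> R by move=> /TN; exact: le_trans.
have nR n : (N <= n)%N -> 0 < n%:R :> R by move=> Nn; rewrite ltr0n (leq_trans _ Nn)// (leq_trans _ N2).
have phi0 n : (N <= n)%N -> 0 < phi n.
  by move=> Nn; rewrite !mulr_gt0// ?nR// (lt_le_trans ltr01)// y1.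
have lnphi n : (N <= n)%N -> ln n%:R / 2 <= ln (phi n).
  move=> Nn; have Y := y1 n Nn; have Y0 : 0 < ln n%:R :> R := lt_le_trans ltr01 Y.
  rewrite /phi !lnM ?posrE ?mulr_gt0 ?nR//.
  have := ln_ge0 Y; have := TN n Nn; have := ler_norm (- ln C); rewrite normrN.
  by have := TC; lra.
have phi_incr n : (N <= n)%N -> phi n < phi n.+1.
  move=> Nn; rewrite /phi ltr_pM2l//; have Y := y1 n Nn.
  have Y' : ln n%:R <= ln n.+1%:R :> R by rewrite ler_ln ?posrE ?nR// ?(leqW Nn)// ler_nat.
  apply: (@le_lt_trans _ _ (n%:R * ln n.+1%:R)); first by rewrite ler_wpM2l.
  by rewrite ltr_pM2r ?ltr_nat// (lt_le_trans _ Y')// (lt_le_trans ltr01).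
pose delta := e N.
exists delta; split.
  rewrite expR_gt0 ltr_expR ltrN2 /=.
  (* The condition $\delta<1/e$ means $\phi(N)>1$. *)
  have h : 0 < ln (phi N) by rewrite (lt_le_trans _ (lnphi N _))// divr_gt0// (lt_le_trans ltr01)// y1.
  rewrite ltNge; apply/negP => h2; move: h; apply/negP; rewrite -leNgt.
  by rewrite ln_le0.
pose w (x : R) : R := ln x^-1 ^+ d.-1 / (x * ln (ln x^-1) ^+ d).
pose h x := (M0 f x * (w x)%:E)%E.
have mw : measurable_fun [set: R] w.
  have ml : measurable_fun [set: R] (fun x : R => ln x^-1).
    exact: measurableT_comp (@measurable_ln R) measurable_inv.
  apply: measurable_funM; first exact: measurable_funX.
  apply: (measurableT_comp measurable_inv); apply: measurable_funM => //.
  by apply: measurable_funX; exact: measurableT_comp (@measurable_ln R) ml.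
have mh : measurable_fun [set: R] h.
  by apply: emeasurable_funM; [exact: measurable_M0|exact/measurable_EFinP].
pose I n : set R := `](e (N + n).+1), (e (N + n)%N)]%classic.
have cover : `]0, delta[%classic `<=` \bigcup_n I n.
  move=> x /=; rewrite in_itv/= => /andP[x0 xd].
  have [m em] : exists m, e (N + m)%N < x.
    have lC : 0 <= `|ln x| / C by rewrite divr_ge0// ltW.
    exists (Num.bound (`|ln x| / C)); set m := (N + _)%N.
    have Nm : (N <= m)%N by exact: leq_addr.
    have h1 : `|ln x| / C < m%:R.
      by rewrite (lt_le_trans (archi_boundP lC))// ler_nat leq_addl.
    rewrite -[ltRHS]lnK ?posrE// ltr_expR ltrNl (le_lt_trans (ler_norm _))// normrN.
    rewrite (lt_le_trans (y := C * m%:R))//; first by rewrite mulrC -ltr_pdivrMr.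
    by rewrite /phi ler_pM2l// ler_peMr ?y1// ltW ?nR.
  case: (ex_minnP (ex_intro (fun m => e (N + m)%N < x) m em)) => -[|k] ek kmin.
    by move: ek; rewrite addn0 => /(lt_trans xd); rewrite ltxx.
  exists k => //; rewrite /I /= in_itv/= -addnS ek /= leNgt; apply/negP => /kmin.
  by rewrite ltnn.
(* The constants of $\phi(n+1)\le 4Cn\ln n$, $\phi(n+1)-\phi(n)\le 3C\ln n$ and
   $\ln\phi(n)\ge\ln(n)/2$; the powers of $\ln n$ cancel and leave $n^{d-1}$. *)
pose K : R := (4 * C) ^+ d.-1 * (3 * C) * 2 ^+ d.
have hw n x : (N <= n)%N -> e n.+1 < x -> x <= e n ->
    0 <= w x <= phi n.+1 ^+ d.-1 / (ln n%:R / 2) ^+ d * x^-1.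
  move=> Nn ex xe; have x0 : 0 < x := lt_trans (expR_gt0 _) ex.
  have Y2 : 0 < ln n%:R / 2 :> R by rewrite divr_gt0// (lt_le_trans ltr01)// y1.
  have lx1 : phi n <= ln x^-1.
    by rewrite lnV ?posrE// lerNr -[leRHS]expRK ler_ln ?posrE ?expR_gt0.
  have lx2 : ln x^-1 <= phi n.+1.
    by rewrite lnV ?posrE// lerNl -[leLHS]expRK ler_ln ?posrE ?expR_gt0// ltW.
  have p0 := phi0 n Nn.
  have llx : ln n%:R / 2 <= ln (ln x^-1).
    by rewrite (le_trans (lnphi n Nn))// ler_ln ?posrE// (lt_le_trans p0).
  have lx0 : 0 <= ln x^-1 by rewrite (le_trans (ltW p0)).
  have llx0 : 0 < ln (ln x^-1) by exact: lt_le_trans llx.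
  apply/andP; split; first by rewrite /w divr_ge0 ?exprn_ge0// mulr_ge0 ?exprn_ge0 ?ltW.
  rewrite /w invfM [x^-1 * _]mulrC mulrA ler_wpM2r ?invr_ge0 ?(ltW x0)//.
  apply: ler_pM; rewrite ?exprn_ge0 ?invr_ge0 ?exprn_ge0 ?(ltW llx0)//.
    by rewrite lerXn2r// ?nnegrE// (le_trans lx0).
  by rewrite lef_pV2 ?posrE ?exprn_gt0// lerXn2r// ?nnegrE ltW.
have h0 n x : I n x -> (0 <= h x)%E.
  rewrite /I /= in_itv/= => /andP[x1 x2].
  have /andP[w0 _] := hw _ x (leq_addr n N) x1 x2.
  by apply: mule_ge0; rewrite ?lee_fin//; apply: M0_ge0; rewrite (le_trans (expR_ge0 _) (ltW x1)).
have mI n : measurable (I n) by exact: measurable_itv.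
have hI n : (\int[lebesgue_measure]_(x in I n) h x <= (K * ((N + n)%:R ^+ d.-1 * g (e (N + n)%N)))%:E)%E.
  set n' := (N + n)%N; have Nn : (N <= n')%N by exact: leq_addr.
  have nn := nR _ Nn; have Y := y1 _ Nn; set y : R := ln n'%:R in Y.
  have Y0 : 0 < y := lt_le_trans ltr01 Y.
  have ee : e n'.+1 < e n' by rewrite ltr_expR ltrN2 phi_incr.
  set c := phi n'.+1 ^+ d.-1 / (y / 2) ^+ d.
  have c0 : 0 <= c by rewrite divr_ge0 ?exprn_ge0 ?divr_ge0 ?(ltW Y0)// ltW// phi0// leqW.
  have g0 : 0 <= g (e n') by exact: cmodulus_ge0.
  have minv (D : set R) : measurable_fun D (fun x : R => (x^-1)%:E).
    by apply/measurable_EFinP; exact: measurable_funS measurable_inv.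
  have minvc (D : set R) : measurable_fun D (fun x : R => ((g (e n') * c)%:E * (x^-1)%:E)%E).
    under eq_fun do rewrite -EFinM; apply/measurable_EFinP; apply: measurable_funM => //.
    exact: measurable_funS measurable_inv.
  (* Only the factor $1/x$ of the weight is kept as a function. It integrates to
     $\phi(n'+1)-\phi(n')$, while the other factors and [M0 f] are replaced by their bounds on the
     shell. *)
  apply: (@le_trans _ _ (\int[lebesgue_measure]_(x in `[e n'.+1, e n']) ((g (e n') * c)%:E * (x^-1)%:E))%E).
    apply: (@le_trans _ _ (\int[lebesgue_measure]_(x in I n) ((g (e n') * c)%:E * (x^-1)%:E))%E).
      apply: ge0_le_integral => //.
      - exact: mI.
      - exact: h0.
      - exact: measurable_funS mh.
      - exact: minvc.
      - move=> x; rewrite /I /= in_itv/= => /andP[x1 x2].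
        have /andP[w0 w1] := hw _ x Nn x1 x2.
        rewrite /h -EFinM -mulrA EFinM; apply: lee_pmul => //.
        + by apply: M0_ge0; rewrite (le_trans (expR_ge0 _) (ltW x1)).
        + apply: ge_ereal_sup => _ [z /= + <-]; rewrite in_itv/= lee_fin => /andP[z0 zx].
          by apply: f_mono => //; [exact: le_trans x2|exact: eN].
    apply: ge0_subset_integral => //.
    - exact: mI.
    - exact: minvc.
    - move=> x /=; rewrite in_itv/= => /andP[x1 _].
      have x0 : 0 <= x^-1 by rewrite invr_ge0 (le_trans (expR_ge0 _) x1).
      exact: (mulr_ge0 (mulr_ge0 g0 c0) x0).
    - by apply: subset_itvr; rewrite bnd_simp.
  rewrite ge0_integralZl_EFin//; last 3 first.
  - by move=> x /=; rewrite in_itv/= lee_fin invr_ge0 => /andP[x1 _]; rewrite (le_trans (expR_ge0 _) x1).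
  - exact: minv.
  - by rewrite mulr_ge0.
  rewrite integral_inv ?expR_gt0// /e !expRK opprK addrC -EFinM lee_fin.
  rewrite -mulrA [leRHS]mulrA [leRHS]mulrC ler_wpM2l//.
  have n2 : (2 <= n')%N := leq_trans N2 Nn.
  (* For $n'\ge 2$ one has $n'+1\le n'^2$. *)
  have l1 : ln n'.+1%:R <= 2 * y.
    rewrite mulr_natl -lnXn ?posrE// ler_ln ?posrE ?exprn_gt0// -natrX ler_nat.
    by rewrite -{1}(expn1 n') ltn_exp2l.
  have l2 : ln n'.+1%:R - y <= n'%:R^-1.
    rewrite /y -ln_div ?posrE// -natr1 mulrDl mulfV ?gt_eqF// mul1r.
    by rewrite le_ln1Dx// (lt_trans _ (_ : 0 < _)) ?ltrN10 ?invr_gt0.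
  have p1 : phi n'.+1 <= 4 * C * n'%:R * y.
    rewrite /phi (_ : 4 * C * n'%:R * y = C * ((2 * n'%:R) * (2 * y))); last by ring.
    rewrite ler_pM2l// ler_pM ?ln_ge0 ?ler1n// -natr1 mulr_natl mulr2n lerD2l.
    by rewrite ler1n (leq_trans _ n2).
  have p2 : phi n'.+1 - phi n' <= 3 * C * y.
    have -> : phi n'.+1 - phi n' = C * (n'%:R * (ln n'.+1%:R - y) + ln n'.+1%:R).
      by rewrite /phi -/y -natr1; ring.
    rewrite (_ : 3 * C * y = C * (y + 2 * y)); last by ring.
    rewrite ler_pM2l// lerD// (le_trans (ler_wpM2l (ltW nn) l2))// mulfV ?gt_eqF//.
  rewrite (le_trans (ler_wpM2l c0 p2))//.
  have -> : K * n'%:R ^+ d.-1 = (4 * C * n'%:R * y) ^+ d.-1 / (y / 2) ^+ d * (3 * C * y).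
    rewrite /K -(prednK d0) /= [X in _ / X]exprS !exprMn exprVn exprS.
    by field; rewrite !expf_neq0// gt_eqF.
  rewrite ler_wpM2r ?mulr_ge0 ?(ltW C0) ?(ltW Y0)// ler_wpM2r ?invr_ge0 ?exprn_ge0 ?divr_ge0 ?(ltW Y0)//.
  have q0 := ltW (phi0 n'.+1 (leqW Nn)).
  by rewrite lerXn2r// nnegrE// (le_trans q0).
have h0U x : (\bigcup_n I n) x -> (0 <= h x)%E by move=> [n _]; exact: h0.
apply: (@le_lt_trans _ _ (\int[lebesgue_measure]_(x in \bigcup_n I n) h x)%E).
  apply: ge0_subset_integral => //; first exact: bigcupT_measurable.
  exact: measurable_funS mh.
rewrite ge0_integral_bigcup//; last 2 first.
- exact: measurable_funS mh.
- apply: ltn_trivIset => n m mn; rewrite -subset0 => x [] /=; rewrite /I/= !in_itv/=.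
  move=> /andP[h1 _] /andP[_ h2].
  have h3 : e (N + n)%N <= e (N + m).+1.
    rewrite ler_expR lerN2; elim: n mn {h2} => // n IH; rewrite ltnS leq_eqVlt => /orP[/eqP <-|mn].
      by rewrite addnS.
    by rewrite addnS (le_trans (IH mn))// ltW// phi_incr// leq_addr.
  by have := lt_le_trans h1 (le_trans h2 h3); rewrite ltxx.
pose S := fine (\sum_(0 <= n <oo) (cmodulus (f (lam n)))%:E)%E.
(* The index blocks $[(n-1)^d,n^d)$ for $N\le n<N+M$ are consecutive, hence the upper limit
   [(N + M).-1 ^ d]; the terms below $(N-1)^d$ only enlarge the right side. *)
have partial M : \sum_(n < M) ((N + n)%:R ^+ d.-1 * g (e (N + n)%N)) <= \sum_(0 <= k < (N + M).-1 ^ d) g (lam k).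
  elim: M => [|M IH]; first by rewrite big_ord0; apply: sumr_ge0 => k _; exact: cmodulus_ge0.
  set n := (N + M)%N; have Nn : (N <= n)%N by exact: leq_addr.
  have n0 : (0 < n)%N by rewrite (leq_trans _ Nn)// (leq_trans _ N2).
  rewrite big_ord_recr/= addnS /= -/n (@big_cat_nat _ _ _ (n.-1 ^ d))//=; last by rewrite leq_exp2r// leq_pred.
  apply: lerD; first exact: IH.
  have cnt : (n ^ d.-1 <= n ^ d - n.-1 ^ d)%N.
    rewrite leq_subRL ?leq_exp2r// ?leq_pred//.
    by have := expn_succ_sub n.-1 d.-1; rewrite !prednK.
  apply: (@le_trans _ _ (\sum_(n.-1 ^ d <= k < n ^ d) g (e n))).
    by rewrite sumr_const_nat -[leRHS]mulr_natl ler_wpM2r ?cmodulus_ge0// -natrX ler_nat.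
  rewrite !big_nat; apply: ler_sum => k /andP[k1 k2]; apply: f_mono; first exact: expR_ge0.
    by apply: lam_ge => //; exact: leq_trans N2 Nn.
  apply: lamN; rewrite (leq_trans Nn)// -(prednK n0) ltnS (leq_trans _ k1)//.
  by rewrite -{1}[n.-1]expn1; case: (n.-1) => [|p]; rewrite ?exp0n// leq_pexp2l.
have partialS M : \sum_(0 <= k < M) g (lam k) <= S.
  have := @nneseries_lim_ge R (fun n => (cmodulus (f (lam n)))%:E) xpredT 0 M (fun n _ _ => _).
  rewrite sumEFin /S => hS; rewrite -lee_fin fineK; last first.
    rewrite ge0_fin_numE// nneseries_ge0// => n _ _.
    by rewrite lee_fin cmodulus_ge0.
  by apply: hS => n; rewrite lee_fin cmodulus_ge0.
apply: (@le_lt_trans _ _ (K * S)%:E); last exact: ltry.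
apply: lime_le; first by apply: is_cvg_nneseries => n _ _; apply: integral_ge0 => x; exact: h0.
apply: nearW => M; apply: (@le_trans _ _ (\sum_(0 <= n < M) (K * ((N + n)%:R ^+ d.-1 * g (e (N + n)%N)))%:E)%E).
  by apply: lee_sum => n _.
rewrite sumEFin lee_fin -mulr_sumr ler_wpM2l//.
  by rewrite !mulr_ge0 ?exprn_ge0 ?mulr_ge0 ?(ltW C0).
by rewrite big_mkord (le_trans (partial M)).
Qed.

End admissibility.

Lemma interior_box {R : realType} {d : nat} (A : set 'rV[R]_d) : interior A !=set0 ->
  exists x0 : 'rV[R]_d, exists2 r : R, 0 < r &
    forall x : 'rV[R]_d, (forall i, `|x ord0 i - x0 ord0 i| <= r) -> A x.
Proof.
move=> [x0 /nbhs_ballP[e /= e0 eA]]; exists x0, (e / 2); first by rewrite divr_gt0.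
move=> x h; apply: eA; split=> // i j; rewrite (ord1 i) /ball/= distrC (le_lt_trans (h j))//.
lra.
Qed.

Unset Implicit Arguments.

Theorem theorem1p10 (R : realType) (d : nat) (hd : (0 < d)%N)
    (A B : set 'rV[R]_d)
    (mA : (lebesgue_outer R d).-cara.-measurable A)
    (mB : (lebesgue_outer R d).-cara.-measurable B)
    (iA : interior A !=set0) (iB : interior B !=set0)
    (cS : compact_operator (S_op A B))
    (f : R -> R[i]) (f0 : f 0 = 0)
    (f_mono : exists beta : R, 0 < beta <= 1 /\
      forall x y : R, 0 <= x -> x <= y -> y <= beta ->
        cmodulus (f x) <= cmodulus (f y))
    (tc : trace_class_fun f (S_op A B)) :
  trace_class_admissible d f.
Proof.
have [lam [v [eigS sumf]]] := tc.
have [beta [/andP[beta0 _] fb]] := f_mono.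
have [x0 [r1 r10 hA]] := interior_box iA; have [xi0 [r2 r20 hB]] := interior_box iB.
(* One radius serves both boxes. The cap at 1 keeps the phases of the Vandermonde nodes below $\pi$
   and the sampled frequencies within the bound [K]. *)
pose r := Num.min 1 (Num.min r1 r2).
have r0 : 0 < r by rewrite !lt_min ltr01 r10 r20.
have rle1 : r <= 1 by rewrite ge_min lexx.
have rr1 : r <= r1 by rewrite !ge_min lexx orbT.
have rr2 : r <= r2 by rewrite !ge_min lexx !orbT.
have [C C0 lamC] := eigenvalue_exp_lower_bound hd mA mB r0 rle1
  (fun x h => hA x (fun i => le_trans (h i) rr1))
  (fun x h => hB x (fun i => le_trans (h i) rr2)) cS eigS.
exact: (trace_class_admissible_of_lower_bound hd C0 beta0
  (eigenvalues_cvg0 hd mA mB cS eigS) lamC fb sumf).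
Qed.
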